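(* Let $f\not\equiv 0$ be a weakly holomorphic modular function for $\mathrm{SL}(2,\mathbb{Z})$ such that $f(e^{it})$ is real and non-negative for all $t\in[\pi/3,2\pi/3]$. Define $\tilde\Lambda_f:[0,1/2]\cap\mathbb{Q}\to\mathbb{R}^+$ by $\tilde\Lambda_f(p/q)=\Lambda_f(w(p/q))$. Then $\tilde\Lambda_f$ extends to a continuous, decreasing and convex function $\tilde\Lambda_f:[0,1/2]\to\mathbb{R}^+$.
   Context: Let $T=\begin{pmatrix}1&1\\0&1\end{pmatrix}$, $V=\begin{pmatrix}1&0\\1&1\end{pmatrix}$. For hyperbolic $A\in\mathrm{SL}(2,\mathbb{Z})$ with repelling/attracting fixed points $w,\tilde w$, let $Q(x,y)=ax^2+bxy+cy^2$ be the primitive integral form vanishing at $(w,1),(\tilde w,1)$ with $\mathrm{sgn}(a)=\mathrm{sgn}(w-\tilde w)$, $D=b^2-4ac$, and $I_f(A)=\int_{\tau_0}^{A\tau_0}\frac{f(\tau)\sqrt D}{Q(\tau,1)}d\tau$ ($\tau_0\in\mathbb{H}$ arbitrary), $I_f(A)=0$ for non-hyperbolic $A$. For irrational $x=[a_1;a_2,\ldots]>0$ let $A_n$ be the product of the first $n$ letters of the infinite word $T^{a_1}V^{a_2}T^{a_3}V^{a_4}\cdots$, and $\Lambda_f(x)=\limsup_n\mathrm{Re}(I_f(A_n))/n$. For real quadratic irrationals with purely periodic continued fractions $u=[\overline{a_1;\ldots,a_r}]$, $v=[\overline{b_1;\ldots,b_s}]$ written with minimal even period lengths, set $u\odot v=[\overline{a_1;\ldots,a_r,b_1,\ldots,b_s}]$.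 Fractions $a/b<c/d$ in $[0,1/2]$ in lowest terms are neighbors if $bc-ad=1$; the mediant is $(a+c)/(b+d)$; every rational in $(0,1/2)$ is the mediant of a unique pair of neighbors. Define $w:[0,1/2]\cap\mathbb{Q}\to\mathbb{R}$ recursively by $w(0/1)=[\overline{1;1}]$, $w(1/2)=[\overline{2;2}]$, $w\big(\frac{a+c}{b+d}\big)=w(c/d)\odot w(a/b)$ for neighbors $a/b<c/d$ (the Farey parametrization of the Markov irrationalities). *)

(* Defs.v *)
From Stdlib Require Import Reals ZArith List Lia Lra Znumtheory.
From Stdlib Require Import ClassicalEpsilon.
From Coquelicot Require Import Coquelicot.
Import ListNotations.
Open Scope R_scope.

Record mat2 := Mat { ma : Z; mb : Z; mc : Z; md : Z }.

Definition mdet (A : mat2) : Z := (ma A * md A - mb A * mc A)%Z.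
Definition mtr (A : mat2) : Z := (ma A + md A)%Z.
Definition mone : mat2 := Mat 1 0 0 1.
Definition mmul (A B : mat2) : mat2 :=
  Mat (ma A * ma B + mb A * mc B) (ma A * mb B + mb A * md B)
      (mc A * ma B + md A * mc B) (mc A * mb B + md A * md B).

Definition matT : mat2 := Mat 1 1 0 1.
Definition matV : mat2 := Mat 1 0 1 1.

Definition ZtoC (n : Z) : C := RtoC (IZR n).

Definition moebius (A : mat2) (tau : C) : C :=
  ((ZtoC (ma A) * tau + ZtoC (mb A)) / (ZtoC (mc A) * tau + ZtoC (md A)))%C.

Definition moebiusR (A : mat2) (x : R) : R :=
  (IZR (ma A) * x + IZR (mb A)) / (IZR (mc A) * x + IZR (md A)).

Definition upper_half_plane (tau : C) : Prop := 0 < Im tau.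

Definition nome (tau : C) : C :=
  RtoC (exp (- (2 * PI * Im tau))) *
  (cos (2 * PI * Re tau), sin (2 * PI * Re tau)).

(* The last clause is meromorphy at the cusp: [f] has a q-expansion
   [f = sum_(n >= -N) c (n + N) * q ^ n] with finite principal part. *)
Definition weakly_holomorphic_modular_function (f : C -> C) : Prop :=
  (forall tau, upper_half_plane tau -> ex_derive f tau) /\
  (forall A tau, mdet A = 1%Z -> upper_half_plane tau ->
     f (moebius A tau) = f tau) /\
  (exists (N : nat) (c : nat -> C), forall tau, upper_half_plane tau ->
     is_pseries c (nome tau) (nome tau ^ N * f tau)%C).

Definition hyperbolic (A : mat2) : Prop := (2 < Z.abs (mtr A))%Z.

(* For hyperbolic [A] of determinant 1 the entry [mc A] is nonzero, so both
   fixed points are finite and neither is the pole of [moebiusR A]. *)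
Definition repelling_fixed_point (A : mat2) (x : R) : Prop :=
  moebiusR A x = x /\ 1 < Rabs (Derive (moebiusR A) x).
Definition attracting_fixed_point (A : mat2) (x : R) : Prop :=
  moebiusR A x = x /\ Rabs (Derive (moebiusR A) x) < 1.

(* [(a, b, c)] stands for the form [a x^2 + b x y + c y^2]. *)
Definition form := (Z * Z * Z)%type.

Definition form_disc (Q : form) : Z := let '(a, b, c) := Q in (b * b - 4 * a * c)%Z.

Definition form_eval (Q : form) (x y : C) : C :=
  let '(a, b, c) := Q in
  (ZtoC a * (x * x) + ZtoC b * (x * y) + ZtoC c * (y * y))%C.

Definition is_fixed_form (A : mat2) (Q : form) : Prop :=
  let '(a, b, c) := Q in
  Z.gcd (Z.gcd a b) c = 1%Z /\
  exists w w' : R,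
    repelling_fixed_point A w /\ attracting_fixed_point A w' /\
    form_eval Q w 1 = 0 /\ form_eval Q w' 1 = 0 /\
    sign (IZR a) = sign (w - w').

Definition fixed_form (A : mat2) : form :=
  epsilon (inhabits (0, 0, 0)%Z) (is_fixed_form A).

Definition segment_integral (g : C -> C) (z1 z2 : C) : C :=
  RInt (V := C_R_CompleteNormedModule)
    (fun t : R => (g (z1 + t * (z2 - z1)) * (z2 - z1))%C) 0 1.

(* The path of integration is the segment from [tau0] to [A tau0], which stays
   in the (convex) upper half-plane. *)
Definition cycle_integral (f : C -> C) (tau0 : C) (A : mat2) : C :=
  if excluded_middle_informative (hyperbolic A) then
    let Q := fixed_form A in
    segment_integral
      (fun tau => (f tau * RtoC (sqrt (IZR (form_disc Q))) / form_eval Q tau 1)%C)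
      tau0 (moebius A tau0)
  else 0.

Fixpoint cf_convergent (a : nat -> nat) (n : nat) : R :=
  match n with
  | O => INR (a O)
  | S m => INR (a O) + / cf_convergent (fun k => a (S k)) m
  end.

(* [x = [a 0; a 1, a 2, ...]], an infinite regular continued fraction; the
   partial quotients are numbered from 0. *)
Definition is_cf (x : R) (a : nat -> nat) : Prop :=
  (forall n, (0 < a (S n))%nat) /\ is_lim_seq (cf_convergent a) x.

Definition partial_quotients (x : R) : nat -> nat :=
  epsilon (inhabits (fun _ => O)) (is_cf x).

(* Every block but the first is nonempty, so the [S n] blocks below contain at
   least [n] letters. *)
Definition cutting_word (a : nat -> nat) (n : nat) : list mat2 :=
  firstn n
    (concat
       (map (fun k => repeat (if Nat.even k then matT else matV) (a k))
            (seq 0 (S n)))).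

Definition cutting_matrix (a : nat -> nat) (n : nat) : mat2 :=
  fold_right mmul mone (cutting_word a n).

Definition Lambda (f : C -> C) (tau0 : C) (x : R) : Rbar :=
  LimSup_seq (fun n =>
    Re (cycle_integral f tau0 (cutting_matrix (partial_quotients x) n)) / INR n).

Definition periodic (s : list nat) (k : nat) : nat :=
  nth (Nat.modulo k (length s)) s O.

Definition periodic_cf (s : list nat) : R :=
  epsilon (inhabits 0) (fun x => is_cf x (periodic s)).

Definition even_period (u : R) (s : list nat) : Prop :=
  s <> [] /\ Nat.Even (length s) /\ is_cf u (periodic s).

Definition minimal_even_period (u : R) : list nat :=
  epsilon (inhabits []) (fun s =>
    even_period u s /\
    forall t, even_period u t -> (length s <= length t)%nat).

Definition odot (u v : R) : R :=
  periodic_cf (minimal_even_period u ++ minimal_even_period v).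

(* [a / b < c / d] in [[0, 1/2]]; the determinant condition forces lowest
   terms and the strict inequality. *)
Definition farey_neighbors (a b c d : Z) : Prop :=
  (0 <= a /\ 0 < b /\ 0 < d /\ 2 * c <= d /\ b * c - a * d = 1)%Z.

Definition farey_parametrization (w : R -> R) : Prop :=
  w 0 = periodic_cf [1; 1]%nat /\
  w (1 / 2) = periodic_cf [2; 2]%nat /\
  forall a b c d : Z, farey_neighbors a b c d ->
    w (IZR (a + c) / IZR (b + d)) =
    odot (w (IZR c / IZR d)) (w (IZR a / IZR b)).

Definition farey_w : R -> R :=
  epsilon (inhabits (fun _ => 0)) farey_parametrization.

Definition is_parents (p q : Z) (x : Z * Z * Z * Z) : Prop :=
  let '(a, b, c, d) := x in
  farey_neighbors a b c d /\ p = (a + c)%Z /\ q = (b + d)%Z.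

Lemma is_parents_unique p q x y :
  is_parents p q x -> is_parents p q y -> x = y.
Proof.
destruct x as [[[a b] c] d], y as [[[a' b'] c'] d'].
unfold is_parents, farey_neighbors.
intros [[A1 [A2 [A3 [A4 A5]]]] [P Q]] [[B1 [B2 [B3 [B4 B5]]]] [P' Q']].
assert (E1 : (p * b - q * a = 1)%Z) by (subst p q; nia).
assert (E2 : (p * b' - q * a' = 1)%Z) by (subst p q; rewrite P', Q'; nia).
assert (Hpq : rel_prime q p).
{ apply rel_prime_sym, bezout_rel_prime.
  apply Bezout_intro with b (- a)%Z. lia. }
assert (D : (q | b - b')%Z).
{ apply Gauss with p; [exists (a - a')%Z; lia | exact Hpq]. }
destruct D as [k Hk].
assert (Hb : (0 < b < q)%Z) by lia.
assert (Hb' : (0 < b' < q)%Z) by lia.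
clear A4 A5 B4 B5 Hpq.
assert (Hk0 : k = 0%Z).
{ clear - Hk Hb Hb'.
  assert (k < 1)%Z by (apply (Zmult_lt_reg_r _ _ q); lia).
  assert (-1 < k)%Z by (apply (Zmult_lt_reg_r _ _ q); lia).
  lia. }
rewrite Hk0 in Hk.
assert (b = b') by lia. subst b'.
assert (a = a') by (apply (Z.mul_reg_l _ _ q); lia).
subst a'. repeat f_equal; lia.
Qed.

(* Recursion on the denominator, with fuel. *)
Fixpoint farey_rec (n : nat) (p q : Z) : R :=
  match n with
  | O => 0
  | S m =>
    if Z.eq_dec p 0 then periodic_cf [1; 1]%nat
    else if Z.eq_dec (2 * p) q then periodic_cf [2; 2]%nat
    else match excluded_middle_informative (exists x, is_parents p q x) with
         | left E =>
           let '(a, b, c, d) := proj1_sig (constructive_indefinite_description _ E) in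
           odot (farey_rec m c d) (farey_rec m a b)
         | right _ => 0
         end
  end.

Lemma farey_rec_stable n : forall m p q,
  (0 < q)%Z -> (q <= Z.of_nat n)%Z -> (q <= Z.of_nat m)%Z ->
  farey_rec n p q = farey_rec m p q.
Proof.
induction n as [|n IH]; intros m p q Hq Hn Hm; [lia|].
destruct m as [|m]; [lia|]; simpl.
destruct (Z.eq_dec p 0); [reflexivity|].
destruct (Z.eq_dec _ q); [reflexivity|].
destruct excluded_middle_informative as [E|]; [|reflexivity].
destruct constructive_indefinite_description as [[[[a b] c] d] H]; simpl.
destruct H as [[A1 [A2 [A3 [A4 A5]]]] [P Q]].
f_equal; apply IH; lia.
Qed.

Definition farey_fun (x : R) : R :=
  let '(p, q) := epsilon (inhabits (0, 1)%Z) (fun pq =>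
    (0 < snd pq)%Z /\ rel_prime (fst pq) (snd pq) /\
    x = IZR (fst pq) / IZR (snd pq)) in
  farey_rec (Z.to_nat q) p q.

Lemma farey_fun_eq p q : (0 < q)%Z -> rel_prime p q ->
  farey_fun (IZR p / IZR q) = farey_rec (Z.to_nat q) p q.
Proof.
intros Hq Hpq. unfold farey_fun.
match goal with |- context [epsilon ?i ?P] =>
  assert (H := epsilon_spec i P (ex_intro _ (p, q) (conj Hq (conj Hpq eq_refl))));
  destruct (epsilon i P) as [p' q'] end.
simpl in H. destruct H as [Hq' [Hpq' E]].
assert (E' : (p * q' = p' * q)%Z).
{ apply eq_IZR. rewrite !mult_IZR.
  apply IZR_lt in Hq, Hq'. simpl in *.
  apply (Rmult_eq_compat_r (IZR q * IZR q')) in E.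
  field_simplify in E; lra. }
assert (D1 : (q | q')%Z).
{ apply Gauss with p; [exists p'; lia | now apply rel_prime_sym]. }
assert (D2 : (q' | q)%Z).
{ apply Gauss with p'; [exists p; lia | now apply rel_prime_sym]. }
assert (q' = q) by (apply Z.divide_antisym_nonneg; (lia || assumption)).
subst q'. assert (p' = p) by nia. now subst p'.
Qed.

Lemma farey_w_spec : farey_parametrization farey_w.
Proof.
unfold farey_w. apply epsilon_spec. exists farey_fun. split; [|split].
- replace 0 with (IZR 0 / IZR 1) at 1 by field.
  rewrite farey_fun_eq; [reflexivity | lia | ].
  apply bezout_rel_prime, Bezout_intro with 0%Z 1%Z; lia.
- rewrite farey_fun_eq; [reflexivity | lia | ].
  apply bezout_rel_prime, Bezout_intro with 1%Z 0%Z; lia.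
- intros a b c d N. assert (N' := N).
  destruct N' as [A1 [A2 [A3 [A4 A5]]]].
  rewrite !farey_fun_eq; try lia.
  2-4: apply bezout_rel_prime;
       first [apply Bezout_intro with b (- a)%Z; lia
             |apply Bezout_intro with (- d)%Z c; lia].
  replace (Z.to_nat (b + d)) with (S (Z.to_nat (b + d - 1))) by lia.
  cbn [farey_rec].
  destruct (Z.eq_dec (a + c) 0); [nia|].
  destruct (Z.eq_dec (2 * (a + c)) (b + d)); [nia|].
  destruct excluded_middle_informative as [E|E].
  + destruct constructive_indefinite_description as [x H]; simpl.
    assert (x = (a, b, c, d)) as ->.
    { apply (is_parents_unique _ _ _ _ H). now repeat split. }
    f_equal; apply farey_rec_stable; lia.
  + exfalso. apply E. exists (a, b, c, d). now repeat split.
Qed.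

(* Main.v *)
(* With w, x the repelling and attracting fixed points of A,
   sqrt D / Q(tau, 1) = 1 / (tau - w) - 1 / (tau - x).  Both T and V map
   e^(2 pi i / 3) to e^(i pi / 3), so for a word A in T and V the path from
   e^(2 pi i / 3) to A e^(2 pi i / 3) can be deformed into translates of the arc
   [pi / 3, 2 pi / 3] of the unit circle, one for each letter.  Hence
   Re I_f(A) is the sum, over the futures x_k and the pasts y_k of all the
   letters of A, of F(x_k) + F(y_k), where F is a nonnegative mixture of the
   functions s / (s^2 - k), s = x + 1 / x, 0 <= k <= 1.

   In terms of the blocks TV and TTVV the future sums satisfy a twist condition:
   the derivative of the sum over a past with respect to the future is monotone
   in the past.  By Aubry's crossing argument, exchanging the tails of two
   crossing periodic words does not increase the sum, so that
   value (X Y) <= value X + value Y whenever the word X is below Y both in the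
   future and in the past.  In the Farey tree this applies to X = L V^k and
   Y = V^l R, V = R L, and gives the convexity at every vertex V of every level.
   The slopes at both ends of [0, 1/2] give the Lipschitz bound and the strict
   decrease.  The mixture is nonzero because the Fourier coefficients of f are
   integrals of f e^(-2 pi i m tau) over the arc. *)
Require Import Defs.
From Stdlib Require Import Reals ZArith List Lra Lia Psatz Znumtheory Classical ClassicalEpsilon.
From Coquelicot Require Import Coquelicot.
Import ListNotations.
Open Scope R_scope.

(** * Complex derivatives and path integrals *)

(** The mixture [F] is largest at 1, so as functions of the future [z] the value at [T z] decreases
    and the value at [V z] increases: no monotonicity holds letter by letter. Over a whole block the
    sum is increasing on [[8/5, 5/2]], an interval which both blocks preserve and which contains the
    fixed points of all block words. The twist condition concerns pasts of any length. A single
    constant [M] reduces it to one block: the slope of one block is at most [M] times one minus the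
    slope of its action, so the slope of the sum over any past lies between 0 and [M], and at the
    first difference of two pasts the gain of TTVV over TV outweighs [M] times the slope of the
    action of TV. These conditions are linear inequalities in [F]. They are proved for each [k] and
    then integrated over the arc. Pasts need no separate treatment. Inversion preserves [F] and
    exchanges T with V, and each block read backwards is the block with its letters exchanged, so a
    sum over pasts is a sum over futures of the reversed block word. Convexity does not decide the
    sign of the slopes. The strict decrease rests on a numerical margin at the end 1/2, uniform in
    the level. *)

Lemma functional_choice {A B} (R : A -> B -> Prop) :
  (forall x, exists y, R x y) -> exists f, forall x, R x (f x).
Proof.
intros H. exists (fun x => proj1_sig (constructive_indefinite_description _ (H x))).
intros x. exact (proj2_sig (constructive_indefinite_description _ (H x))).
Qed.

(** Estimates in [Cmod] are the common form of derivatives over [C] and over the reals, so that maps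
    of [C] and paths can be composed below. *)
Lemma is_derive_C_eps (g : C -> C) (z l : C) :
  is_derive (K := C_AbsRing) (V := C_NormedModule) g z l <->
  forall eps, 0 < eps -> exists delta, 0 < delta /\ forall z' : C,
    Cmod (z' - z) < delta ->
    Cmod (g z' - g z - l * (z' - z)) <= eps * Cmod (z' - z).
Proof.
split.
- intros [_ H] eps Heps.
  specialize (H z (fun P HP => HP) (mkposreal eps Heps)).
  destruct H as [d Hd]. exists d. split; [apply cond_pos|].
  intros z' Hz'. specialize (Hd z' Hz').
  change (Cmod ((g z' - g z) - (z' - z) * l) <= eps * Cmod (z' - z)) in Hd.
  now rewrite (Cmult_comm l).
- intros H. split; [apply is_linear_scal_l|].
  intros x Hx. apply (is_filter_lim_locally_unique (V := AbsRing_NormedModule C_AbsRing)) in Hx. subst x.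
  intros eps. destruct (H eps (cond_pos eps)) as [d [Hd H']].
  exists (mkposreal d Hd). intros y Hy. specialize (H' y Hy).
  change (Cmod ((g y - g z) - (y - z) * l) <= eps * Cmod (y - z)).
  now rewrite (Cmult_comm _ l).
Qed.

Lemma is_derive_path_eps (g : R -> C) (t : R) (l : C) :
  is_derive (V := C_R_NormedModule) g t l <->
  forall eps, 0 < eps -> exists delta, 0 < delta /\ forall s : R,
    Rabs (s - t) < delta ->
    Cmod (g s - g t - l * RtoC (s - t)) <= eps * Rabs (s - t).
Proof.
assert (E : forall s, scal (V := C_R_NormedModule) s l = (l * RtoC s)%C).
{ intros s. destruct l as [u v]. unfold Cmult, RtoC, scal; simpl.
  unfold prod_scal, scal; simpl. unfold mult; simpl. f_equal; ring. }
split.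
- intros [_ H] eps Heps.
  specialize (H t (fun P HP => HP) (mkposreal eps Heps)).
  destruct H as [d Hd]. exists d. split; [apply cond_pos|].
  intros s Hs. specialize (Hd s Hs). rewrite E in Hd.
  rewrite <- Cmod_norm in Hd. exact Hd.
- intros H. split; [apply is_linear_scal_l|].
  intros x Hx. apply (is_filter_lim_locally_unique (V := R_NormedModule)) in Hx. subst x.
  intros eps. destruct (H eps (cond_pos eps)) as [d [Hd H']].
  exists (mkposreal d Hd). intros y Hy. specialize (H' y Hy).
  rewrite E, <- Cmod_norm. exact H'.
Qed.

(** The outer derivative is over the complex numbers, the inner one over the reals. The error splits
    into the remainder of [P] at [g s] and [p] times the remainder of [g], half of [eps] for
    each. *)
Lemma is_derive_path_comp (P : C -> C) (p : C) (g : R -> C) (l : C) (t : R) :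
  is_derive (K := C_AbsRing) (V := C_NormedModule) P (g t) p ->
  is_derive (V := C_R_NormedModule) g t l ->
  is_derive (V := C_R_NormedModule) (fun s => P (g s)) t (p * l)%C.
Proof.
rewrite is_derive_C_eps, !is_derive_path_eps.
intros HP Hg eps Heps.
set (K := Cmod l + 1). assert (0 < K) by (pose proof (Cmod_ge_0 l); unfold K; lra).
set (L := Cmod p + 1). assert (0 < L) by (pose proof (Cmod_ge_0 p); unfold L; lra).
destruct (HP (eps / (2 * K))) as [d1 [Hd1 H1]].
{ apply Rdiv_lt_0_compat; lra. }
destruct (Hg (Rmin 1 (eps / (2 * L)))) as [d2 [Hd2 H2]].
{ apply Rmin_pos; [lra|apply Rdiv_lt_0_compat; lra]. }
exists (Rmin d2 (d1 / K)). split.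
{ apply Rmin_pos; [lra|apply Rdiv_lt_0_compat; lra]. }
intros s Hs.
assert (Hs2 := H2 s (Rlt_le_trans _ _ _ Hs (Rmin_l _ _))).
pose proof (Rabs_pos (s - t)) as Ha.
assert (HK : Cmod (g s - g t) <= K * Rabs (s - t)).
{ replace (g s - g t)%C with ((g s - g t - l * RtoC (s - t)) + l * RtoC (s - t))%C by ring.
  eapply Rle_trans; [apply Cmod_triangle|]. rewrite Cmod_mult, Cmod_R.
  pose proof (Rmin_l 1 (eps / (2 * L))). unfold K. nra. }
assert (Hd : Cmod (g s - g t) < d1).
{ eapply Rle_lt_trans; [exact HK|].
  apply Rlt_le_trans with (K * (d1 / K)); [|right; field; lra].
  apply Rmult_lt_compat_l; [lra|]. eapply Rlt_le_trans; [exact Hs|apply Rmin_r]. }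
specialize (H1 _ Hd).
replace (P (g s) - P (g t) - p * l * RtoC (s - t))%C with
  ((P (g s) - P (g t) - p * (g s - g t)) + p * (g s - g t - l * RtoC (s - t)))%C by ring.
eapply Rle_trans; [apply Cmod_triangle|]. rewrite Cmod_mult.
assert (E1 : eps / (2 * K) * Cmod (g s - g t) <= eps / 2 * Rabs (s - t)).
{ apply Rle_trans with (eps / (2 * K) * (K * Rabs (s - t))); [|right; field; lra].
  apply Rmult_le_compat_l; [|exact HK]. left; apply Rdiv_lt_0_compat; lra. }
assert (E2 : Cmod p * Cmod (g s - g t - l * RtoC (s - t)) <= eps / 2 * Rabs (s - t)).
{ apply Rle_trans with (L * (eps / (2 * L) * Rabs (s - t))); [|right; field; lra].
  apply Rmult_le_compat; try apply Cmod_ge_0; [unfold L; lra|].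
  eapply Rle_trans; [exact Hs2|].
  apply Rmult_le_compat_r; [exact Ha|apply Rmin_r]. }
lra.
Qed.

(* Uniform-structure balls of [C] are squares. *)
Lemma continuous_path_eps (g : R -> C) (t : R) :
  continuous (U := C_UniformSpace) g t <->
  forall eps, 0 < eps -> exists delta, 0 < delta /\ forall s : R,
    Rabs (s - t) < delta -> Cmod (g s - g t) <= eps.
Proof.
split.
- intros H eps Heps.
  assert (Heps2 : 0 < eps / 2) by lra.
  specialize (H (ball (M := C_UniformSpace) (g t) (mkposreal _ Heps2)) (locally_ball _ _)).
  destruct H as [d Hd]. exists d. split; [apply cond_pos|].
  intros s Hs. specialize (Hd s Hs). destruct Hd as [A B].
  change (Rabs (fst (g s) - fst (g t)) < eps / 2) in A.
  change (Rabs (snd (g s) - snd (g t)) < eps / 2) in B.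
  replace (g s - g t)%C with (RtoC (fst (g s) - fst (g t)) + Ci * RtoC (snd (g s) - snd (g t)))%C
    by (apply injective_projections; simpl; ring).
  eapply Rle_trans; [apply Cmod_triangle|].
  rewrite Cmod_mult, !Cmod_R.
  rewrite Cmod_Ci.
  lra.
- intros H P [e He].
  assert (He2 : 0 < e / 2) by (pose proof (cond_pos e); lra).
  destruct (H _ He2) as [d [Hd H']]. exists (mkposreal d Hd).
  intros s Hs. apply He. specialize (H' s Hs).
  pose proof (Rmax_Cmod (g s - g t)%C) as M. pose proof (cond_pos e).
  pose proof (Rmax_l (Rabs (fst (g s - g t)%C)) (Rabs (snd (g s - g t)%C))).
  pose proof (Rmax_r (Rabs (fst (g s - g t)%C)) (Rabs (snd (g s - g t)%C))).
  split.
  + change (Rabs (fst (g s) - fst (g t)) < e). simpl in *. unfold Rminus in *. lra.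
  + change (Rabs (snd (g s) - snd (g t)) < e). simpl in *. unfold Rminus in *. lra.
Qed.

Definition cint (h : R -> C) (a b : R) : C :=
  RInt (V := C_R_CompleteNormedModule) h a b.

Definition path_continuous (h : R -> C) (a b : R) : Prop :=
  forall t, Rmin a b <= t <= Rmax a b -> continuous (U := C_UniformSpace) h t.

Lemma cint_correct h a b : path_continuous h a b ->
  is_RInt (V := C_R_NormedModule) h a b (cint h a b).
Proof.
intros H. apply (RInt_correct (V := C_R_CompleteNormedModule)).
apply (ex_RInt_continuous (V := C_R_CompleteNormedModule)). exact H.
Qed.

Lemma cint_unique h a b (l : C) : is_RInt (V := C_R_NormedModule) h a b l ->
  cint h a b = l.
Proof. intros H. now apply (is_RInt_unique (V := C_R_CompleteNormedModule)). Qed.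

Lemma cint_FTC (P h : R -> C) (a b : R) :
  (forall t, Rmin a b <= t <= Rmax a b ->
     is_derive (V := C_R_NormedModule) P t (h t)) ->
  path_continuous h a b ->
  cint h a b = (P b - P a)%C.
Proof.
intros H1 H2. apply cint_unique.
apply (is_RInt_derive (V := C_R_CompleteNormedModule) P h); assumption.
Qed.

Lemma cint_Chasles h a b c :
  path_continuous h a b -> path_continuous h b c ->
  (cint h a b + cint h b c)%C = cint h a c.
Proof.
intros H1 H2. unfold cint.
apply (RInt_Chasles (V := C_R_CompleteNormedModule));
  now apply (ex_RInt_continuous (V := C_R_CompleteNormedModule)).
Qed.

Lemma path_continuous_swap h a b : path_continuous h a b -> path_continuous h b a.
Proof. intros H t. rewrite Rmin_comm, Rmax_comm. apply H. Qed.

Lemma cint_swap h a b : path_continuous h a b -> cint h b a = (- cint h a b)%C.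
Proof.
intros H. unfold cint. symmetry.
apply (opp_RInt_swap (V := C_R_CompleteNormedModule)).
now apply (ex_RInt_continuous (V := C_R_CompleteNormedModule)).
Qed.

Lemma cint_minus h k a b :
  path_continuous h a b -> path_continuous k a b ->
  cint (fun t => h t - k t)%C a b = (cint h a b - cint k a b)%C.
Proof.
intros H1 H2. unfold cint.
apply (RInt_minus (V := C_R_CompleteNormedModule));
  now apply (ex_RInt_continuous (V := C_R_CompleteNormedModule)).
Qed.

Lemma cint_bound h a b M : a <= b -> path_continuous h a b ->
  (forall t, a <= t <= b -> Cmod (h t) <= M) ->
  Cmod (cint h a b) <= M * (b - a).
Proof.
intros Hab Hh HM. rewrite Cmod_norm.
apply (norm_RInt_le (V := C_R_NormedModule) h (fun _ => M) a b).
- exact Hab.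
- intros t Ht. rewrite <- Cmod_norm. now apply HM.
- now apply cint_correct.
- replace (M * (b - a)) with (scal (b - a) M) by (unfold scal; simpl; unfold mult; simpl; ring).
  apply (is_RInt_const (V := R_NormedModule)).
Qed.

Lemma cint_bound_abs h a b M : path_continuous h a b ->
  (forall t, Rmin a b <= t <= Rmax a b -> Cmod (h t) <= M) ->
  Cmod (cint h a b) <= M * Rabs (b - a).
Proof.
intros Hh HM. destruct (Rle_dec a b) as [Hab|Hab].
- rewrite Rabs_pos_eq by lra.
  rewrite Rmin_left, Rmax_right in HM by lra. now apply cint_bound.
- rewrite cint_swap, Cmod_opp, Rabs_left1 by (lra || now apply path_continuous_swap).
  rewrite Rmin_right, Rmax_left in HM by lra.
  replace (- (b - a)) with (a - b) by ring.
  apply cint_bound; [lra| |exact HM].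
  now apply path_continuous_swap.
Qed.

Lemma cint_ext h k a b :
  (forall t, Rmin a b <= t <= Rmax a b -> h t = k t) -> cint h a b = cint k a b.
Proof. intros H. apply (RInt_ext (V := C_R_CompleteNormedModule)). intros t Ht. apply H. lra. Qed.

Lemma cint_const (c : C) a b : cint (fun _ => c) a b = (c * RtoC (b - a))%C.
Proof.
apply cint_unique.
replace (c * RtoC (b - a))%C with (scal (V := C_R_NormedModule) (b - a) c).
- apply (is_RInt_const (V := C_R_NormedModule)).
- unfold scal; simpl. unfold prod_scal, scal; simpl. unfold mult; simpl.
  apply injective_projections; simpl; ring.
Qed.

Definition C_continuous_at (g : C -> C) (z : C) : Prop :=
  forall eps, 0 < eps -> exists delta, 0 < delta /\ forall z' : C,
    Cmod (z' - z) < delta -> Cmod (g z' - g z) <= eps.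

Lemma ex_derive_C_continuous g z :
  ex_derive (K := C_AbsRing) (V := C_NormedModule) g z -> C_continuous_at g z.
Proof.
intros [l H] eps Heps. rewrite is_derive_C_eps in H.
destruct (H 1 Rlt_0_1) as [d [Hd H']].
set (K := Cmod l + 1). assert (0 < K) by (pose proof (Cmod_ge_0 l); unfold K; lra).
exists (Rmin d (eps / K)). split.
{ apply Rmin_pos; [lra|apply Rdiv_lt_0_compat; lra]. }
intros z' Hz'. specialize (H' z' (Rlt_le_trans _ _ _ Hz' (Rmin_l _ _))).
replace (g z' - g z)%C with ((g z' - g z - l * (z' - z)) + l * (z' - z))%C by ring.
eapply Rle_trans; [apply Cmod_triangle|]. rewrite Cmod_mult.
apply Rle_trans with (K * (eps / K)); [|right; field; lra].
pose proof (Rmin_r d (eps / K)). pose proof (Cmod_ge_0 (z' - z)%C).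
apply Rle_trans with (K * Cmod (z' - z)%C).
- unfold K. lra.
- apply Rmult_le_compat_l; lra.
Qed.

Lemma C_continuous_comp_path g (p : R -> C) t :
  C_continuous_at g (p t) -> continuous (U := C_UniformSpace) p t ->
  continuous (U := C_UniformSpace) (fun s => g (p s)) t.
Proof.
rewrite !continuous_path_eps. intros Hg Hp eps Heps.
destruct (Hg eps Heps) as [d [Hd H1]].
destruct (Hp (d / 2)) as [d' [Hd' H2]]; [lra|].
exists d'. split; [exact Hd'|]. intros s Hs. apply H1.
specialize (H2 s Hs). lra.
Qed.

Lemma is_derive_path_continuous (p : R -> C) t l :
  is_derive (V := C_R_NormedModule) p t l -> continuous (U := C_UniformSpace) p t.
Proof. intros H. apply (ex_derive_continuous (V := C_R_NormedModule)). now exists l. Qed.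

Lemma is_derive_horizontal (c x : R) :
  is_derive (V := C_R_NormedModule) (fun s : R => (s, c) : C) x (RtoC 1).
Proof.
apply is_derive_path_eps. intros eps Heps. exists 1. split; [lra|]. intros s _.
replace (_ - _ - _)%C with (RtoC 0) by (apply injective_projections; simpl; ring).
rewrite Cmod_0. pose proof (Rabs_pos (s - x)). nra.
Qed.

Lemma is_derive_vertical (b y : R) :
  is_derive (V := C_R_NormedModule) (fun s : R => (b, s) : C) y Ci.
Proof.
apply is_derive_path_eps. intros eps Heps. exists 1. split; [lra|]. intros s _.
replace (_ - _ - _)%C with (RtoC 0) by (apply injective_projections; simpl; ring).
rewrite Cmod_0. pose proof (Rabs_pos (s - y)). nra.
Qed.

Lemma cint_horizontal_continuous g c a b :
  (forall x, Rmin a b <= x <= Rmax a b -> C_continuous_at g (x, c)) ->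
  path_continuous (fun x => g (x, c)) a b.
Proof.
intros H t Ht. apply (C_continuous_comp_path g (fun s => (s, c))); [now apply H|].
eapply is_derive_path_continuous, is_derive_horizontal.
Qed.

Lemma cint_vertical_continuous g x c d :
  (forall y, Rmin c d <= y <= Rmax c d -> C_continuous_at g (x, y)) ->
  path_continuous (fun y => g (x, y)) c d.
Proof.
intros H t Ht. apply (C_continuous_comp_path g (fun s => (x, s))); [now apply H|].
eapply is_derive_path_continuous, is_derive_vertical.
Qed.

(** The contour integral around the boundary, counterclockwise: the horizontal sides carry [dx], the
    vertical ones [i dy]. *)
Definition rect_integral (g : C -> C) (a b c d : R) : C :=
  (cint (fun x => g (x, c)) a b - cint (fun x => g (x, d)) a b
   + Ci * (cint (fun y => g (b, y)) c d - cint (fun y => g (a, y)) c d))%C.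

(** [C] is integrated as a real vector space, where a complex factor is not a scalar; the two
    components are therefore integrated separately. *)
Lemma cint_scal (k : C) h a b : path_continuous h a b ->
  cint (fun t => k * h t)%C a b = (k * cint h a b)%C.
Proof.
intros H. apply cint_unique.
assert (I := cint_correct h a b H).
apply is_RInt_fct_extend_fst in I as I1. apply is_RInt_fct_extend_snd in I as I2.
apply (is_RInt_fct_extend_pair (U := R_NormedModule) (V := R_NormedModule)).
- apply (is_RInt_ext (fun t => minus (scal (fst k) (fst (h t))) (scal (snd k) (snd (h t))))).
  + intros; reflexivity.
  + apply (is_RInt_minus (V := R_NormedModule)); apply (is_RInt_scal (V := R_NormedModule)); assumption.
- apply (is_RInt_ext (fun t => plus (scal (fst k) (snd (h t))) (scal (snd k) (fst (h t))))).
  + intros; reflexivity.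
  + apply (is_RInt_plus (V := R_NormedModule)); apply (is_RInt_scal (V := R_NormedModule)); assumption.
Qed.

(** Each side contributes a difference of values of [P] at two corners, and the four corners
    cancel. *)
Lemma rect_integral_primitive (P g : C -> C) a b c d :
  (forall x y, Rmin a b <= x <= Rmax a b -> Rmin c d <= y <= Rmax c d ->
     is_derive (K := C_AbsRing) (V := C_NormedModule) P (x, y) (g (x, y)) /\
     C_continuous_at g (x, y)) ->
  rect_integral g a b c d = RtoC 0.
Proof.
intros H.
pose proof (Rmin_l a b). pose proof (Rmin_r a b). pose proof (Rmax_l a b). pose proof (Rmax_r a b).
pose proof (Rmin_l c d). pose proof (Rmin_r c d). pose proof (Rmax_l c d). pose proof (Rmax_r c d).
assert (Hh : forall y, Rmin c d <= y <= Rmax c d ->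
  cint (fun x => g (x, y)) a b = (P (b, y) - P (a, y))%C).
{ intros y Hy. apply cint_FTC with (P := fun x => P (x, y)).
  - intros t Ht. rewrite <- (Cmult_1_r (g (t, y))).
    apply (is_derive_path_comp P _ (fun s => (s, y))); [now apply H|apply is_derive_horizontal].
  - apply cint_horizontal_continuous. intros; now apply H. }
assert (Hv : forall x, Rmin a b <= x <= Rmax a b ->
  (Ci * cint (fun y => g (x, y)) c d)%C = (P (x, d) - P (x, c))%C).
{ intros x Hx.
  assert (Hc : path_continuous (fun y => g (x, y)) c d).
  { apply cint_vertical_continuous. intros; now apply H. }
  rewrite <- cint_scal by assumption.
  apply cint_FTC with (P := fun y => P (x, y)).
  - intros t Ht. rewrite Cmult_comm.
    apply (is_derive_path_comp P _ (fun s => (x, s))); [now apply H|apply is_derive_vertical].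
  - intros t Ht. apply (C_continuous_comp_path (fun z => Ci * z)%C (fun y => g (x, y))).
    + intros eps Heps. exists eps. split; [exact Heps|]. intros z' Hz'.
      replace (Ci * z' - Ci * g (x, t))%C with (Ci * (z' - g (x, t)))%C by ring.
      rewrite Cmod_mult, Cmod_Ci. lra.
    + now apply Hc. }
unfold rect_integral. rewrite !Hh by lra.
match goal with |- (?u + Ci * (?v - ?w))%C = _ =>
  replace (u + Ci * (v - w))%C with (u + (Ci * v - Ci * w))%C by ring end.
rewrite !Hv by lra. ring.
Qed.

(** * Goursat's theorem on rectangles *)

Definition C_continuous_on_rect (g : C -> C) (a b c d : R) : Prop :=
  forall x y, a <= x <= b -> c <= y <= d -> C_continuous_at g (x, y).

Lemma rect_horizontal g a b c d a' b' y :
  C_continuous_on_rect g a b c d -> a <= a' -> a' <= b' -> b' <= b -> c <= y <= d ->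
  path_continuous (fun x => g (x, y)) a' b'.
Proof.
intros H Ha Hab Hb Hy. apply cint_horizontal_continuous. intros x Hx.
rewrite Rmin_left, Rmax_right in Hx by lra. apply H; lra.
Qed.

Lemma rect_vertical g a b c d c' d' x :
  C_continuous_on_rect g a b c d -> c <= c' -> c' <= d' -> d' <= d -> a <= x <= b ->
  path_continuous (fun y => g (x, y)) c' d'.
Proof.
intros H Hc Hcd Hd Hx. apply cint_vertical_continuous. intros y Hy.
rewrite Rmin_left, Rmax_right in Hy by lra. apply H; lra.
Qed.

Lemma rect_integral_split_h g a e b c d :
  a <= e -> e <= b -> c <= d -> C_continuous_on_rect g a b c d ->
  rect_integral g a b c d = (rect_integral g a e c d + rect_integral g e b c d)%C.
Proof.
intros H1 H2 H3 H. unfold rect_integral.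
rewrite <- (cint_Chasles (fun x => g (x, c)) a e b), <- (cint_Chasles (fun x => g (x, d)) a e b)
  by (apply (rect_horizontal g a b c d); (assumption || lra)).
ring.
Qed.

Lemma rect_integral_split_v g a b c e d :
  a <= b -> c <= e -> e <= d -> C_continuous_on_rect g a b c d ->
  rect_integral g a b c d = (rect_integral g a b c e + rect_integral g a b e d)%C.
Proof.
intros H1 H2 H3 H. unfold rect_integral.
rewrite <- (cint_Chasles (fun y => g (a, y)) c e d), <- (cint_Chasles (fun y => g (b, y)) c e d)
  by (apply (rect_vertical g a b c d); (assumption || lra)).
ring.
Qed.

Lemma rect_integral_minus g k a b c d : a <= b -> c <= d ->
  C_continuous_on_rect g a b c d -> C_continuous_on_rect k a b c d ->
  rect_integral (fun z => g z - k z)%C a b c d =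
  (rect_integral g a b c d - rect_integral k a b c d)%C.
Proof.
intros H1 H2 Hg Hk. unfold rect_integral.
rewrite (cint_minus (fun x => g (x, c)) (fun x => k (x, c))),
  (cint_minus (fun x => g (x, d)) (fun x => k (x, d))),
  (cint_minus (fun y => g (a, y)) (fun y => k (a, y))),
  (cint_minus (fun y => g (b, y)) (fun y => k (b, y))).
1: ring.
all: first [ apply (rect_horizontal _ a b c d); (assumption || lra)
           | apply (rect_vertical _ a b c d); (assumption || lra) ].
Qed.

Lemma rect_integral_bound g a b c d M : a <= b -> c <= d ->
  C_continuous_on_rect g a b c d ->
  (forall x y, a <= x <= b -> c <= y <= d -> Cmod (g (x, y)) <= M) ->
  Cmod (rect_integral g a b c d) <= 2 * M * ((b - a) + (d - c)).
Proof.
intros H1 H2 Hg HM. unfold rect_integral.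
assert (B1 := cint_bound (fun x => g (x, c)) a b M H1).
assert (B2 := cint_bound (fun x => g (x, d)) a b M H1).
assert (B3 := cint_bound (fun y => g (a, y)) c d M H2).
assert (B4 := cint_bound (fun y => g (b, y)) c d M H2).
assert (B1' := B1 ltac:(apply (rect_horizontal _ a b c d); (assumption || lra)) ltac:(intros; apply HM; lra)).
assert (B2' := B2 ltac:(apply (rect_horizontal _ a b c d); (assumption || lra)) ltac:(intros; apply HM; lra)).
assert (B3' := B3 ltac:(apply (rect_vertical _ a b c d); (assumption || lra)) ltac:(intros; apply HM; lra)).
assert (B4' := B4 ltac:(apply (rect_vertical _ a b c d); (assumption || lra)) ltac:(intros; apply HM; lra)).
eapply Rle_trans; [apply Cmod_triangle|]. rewrite Cmod_mult, Cmod_Ci.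
assert (T : forall u v : C, Cmod (u - v) <= Cmod u + Cmod v).
{ intros u v. unfold Cminus. eapply Rle_trans; [apply Cmod_triangle|].
  rewrite Cmod_opp. lra. }
pose proof (T (cint (fun x => g (x, c)) a b) (cint (fun x => g (x, d)) a b)).
pose proof (T (cint (fun y => g (b, y)) c d) (cint (fun y => g (a, y)) c d)).
lra.
Qed.

Lemma Cmod_le_abs_sum (x y u v : R) :
  Cmod ((x, y) - (u, v))%C <= Rabs (x - u) + Rabs (y - v).
Proof.
replace ((x, y) - (u, v))%C with (RtoC (x - u) + Ci * RtoC (y - v))%C
  by (apply injective_projections; simpl; ring).
eapply Rle_trans; [apply Cmod_triangle|]. rewrite Cmod_mult, Cmod_Ci, !Cmod_R. lra.
Qed.

Lemma is_derive_affine (p l z0 z : C) :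
  is_derive (K := C_AbsRing) (V := C_NormedModule)
    (fun z => p * z + l * ((z - z0) * (z - z0)) / 2)%C z (p + l * (z - z0))%C.
Proof.
apply is_derive_C_eps. intros eps Heps.
set (K := Cmod l + 1). assert (0 < K) by (pose proof (Cmod_ge_0 l); unfold K; lra).
exists (eps / K). split; [apply Rdiv_lt_0_compat; lra|]. intros z' Hz'.
replace (_ - _ - _)%C with (l / 2 * (z' - z) * (z' - z))%C.
2:{ field. }
rewrite !Cmod_mult. apply Rmult_le_compat_r; [apply Cmod_ge_0|].
unfold Cdiv. rewrite Cmod_mult.
assert (Cmod (/ 2) <= 1) as Hh.
{ rewrite <- RtoC_inv by lra. rewrite Cmod_R, Rabs_pos_eq; lra. }
apply Rle_trans with (K * (eps / K)); [|right; field; lra].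
pose proof (Cmod_ge_0 l). pose proof (Cmod_ge_0 (/ 2)%C). pose proof (Cmod_ge_0 (z' - z)%C).
apply Rmult_le_compat; [nra|lra|unfold K; nra|lra].
Qed.

Section Goursat.
Variable g : C -> C.
Variables (a w c h : R).
Hypothesis Hw : 0 <= w.
Hypothesis Hh : 0 <= h.
Hypothesis Hg : forall x y, a <= x <= a + w -> c <= y <= c + h ->
  ex_derive (K := C_AbsRing) (V := C_NormedModule) g (x, y).

Let wn n := w / 2 ^ n.
Let hn n := h / 2 ^ n.
Let rect n (p : R * R) :=
  rect_integral g (fst p) (fst p + wn n) (snd p) (snd p + hn n).
Let inside n (p : R * R) :=
  a <= fst p /\ fst p + wn n <= a + w /\ c <= snd p /\ snd p + hn n <= c + h.

Lemma goursat_size n : wn n = 2 * wn (S n) /\ hn n = 2 * hn (S n) /\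
  0 <= wn (S n) /\ 0 <= hn (S n).
Proof.
assert (0 < 2 ^ n) by (apply pow_lt; lra).
unfold wn, hn. simpl pow. split; [field; lra|split; [field; lra|]].
split; apply Rmult_le_pos; try lra; left; apply Rinv_0_lt_compat; lra.
Qed.

Lemma goursat_continuous n p : inside n p ->
  C_continuous_on_rect g (fst p) (fst p + wn n) (snd p) (snd p + hn n).
Proof.
intros [H1 [H2 [H3 H4]]] x y Hx Hy. apply ex_derive_C_continuous, Hg; lra.
Qed.

(** The boundary integrals of the four quarters add up to that of the rectangle, so not all four can
    be smaller than a quarter of it. *)
Lemma goursat_quarter n p m : inside n p -> m <= Cmod (rect n p) ->
  exists q, inside (S n) q /\ m / 4 <= Cmod (rect (S n) q) /\
    fst p <= fst q /\ fst q + wn (S n) <= fst p + wn n /\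
    snd p <= snd q /\ snd q + hn (S n) <= snd p + hn n.
Proof.
intros Hin Hm. assert (Hc := goursat_continuous n p Hin).
destruct (goursat_size n) as [W [V [W0 V0]]].
destruct p as [x y]. unfold rect, inside in *. simpl fst in *. simpl snd in *.
set (u := wn (S n)) in *. set (v := hn (S n)) in *.
rewrite (rect_integral_split_h g x (x + u)) in Hm by (assumption || lra).
rewrite (rect_integral_split_v g x (x + u) y (y + v)),
  (rect_integral_split_v g (x + u) _ y (y + v)) in Hm;
  try lra; try (intros s t Hs Ht; apply Hc; lra).
assert (T1 := Cmod_triangle
  (rect_integral g x (x + u) y (y + v) + rect_integral g x (x + u) (y + v) (y + hn n))
  (rect_integral g (x + u) (x + wn n) y (y + v) + rect_integral g (x + u) (x + wn n) (y + v) (y + hn n))).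
assert (T2 := Cmod_triangle (rect_integral g x (x + u) y (y + v))
  (rect_integral g x (x + u) (y + v) (y + hn n))).
assert (T3 := Cmod_triangle (rect_integral g (x + u) (x + wn n) y (y + v))
  (rect_integral g (x + u) (x + wn n) (y + v) (y + hn n))).
replace (x + wn n) with (x + u + u) in * by lra.
replace (y + hn n) with (y + v + v) in * by lra.
destruct (Rle_dec (m / 4) (Cmod (rect_integral g x (x + u) y (y + v)))) as [D|D].
{ exists (x, y); simpl; repeat split; lra. }
destruct (Rle_dec (m / 4) (Cmod (rect_integral g x (x + u) (y + v) (y + v + v)))) as [D'|D'].
{ exists (x, y + v); simpl; repeat split; lra. }
destruct (Rle_dec (m / 4) (Cmod (rect_integral g (x + u) (x + u + u) y (y + v)))) as [D''|D''].
{ exists (x + u, y); simpl; repeat split; lra. }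
exists (x + u, y + v); simpl; repeat split; lra.
Qed.

(** If the integral had modulus [m > 0], nested quarters would keep at least [m / 4 ^ n] while
    shrinking to a point. There [g] differs from its affine part, which has a primitive, by an
    amount small against the diameter, and diameter times perimeter is also of order [/ 4 ^ n]. *)
Lemma goursat_rect : rect_integral g a (a + w) c (c + h) = RtoC 0.
Proof.
apply Cmod_eq_0. set (m := Cmod _).
destruct (Req_dec m 0) as [E|E]; [exact E|exfalso].
assert (Hm : 0 < m) by (pose proof (Cmod_ge_0 (rect_integral g a (a + w) c (c + h))); unfold m in *; lra).
assert (Hseq : exists p : nat -> R * R, forall n,
  (inside n (p n) /\ m / 4 ^ n <= Cmod (rect n (p n))) /\
  fst (p n) <= fst (p (S n)) /\ fst (p (S n)) + wn (S n) <= fst (p n) + wn n /\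
  snd (p n) <= snd (p (S n)) /\ snd (p (S n)) + hn (S n) <= snd (p n) + hn n).
(* The subtype carries the lower bound on the integral along the recursion, so that a choice
   function for [step] can be iterated. *)
{ set (S0 := {np : nat * (R * R) | inside (fst np) (snd np) /\ m / 4 ^ (fst np) <= Cmod (rect (fst np) (snd np))}).
  assert (step : forall s : S0, exists s' : S0,
    fst (proj1_sig s') = S (fst (proj1_sig s)) /\
    let p := snd (proj1_sig s) in let q := snd (proj1_sig s') in
    let n := fst (proj1_sig s) in
    fst p <= fst q /\ fst q + wn (S n) <= fst p + wn n /\
    snd p <= snd q /\ snd q + hn (S n) <= snd p + hn n).
  { intros [[n p] [Hin Hmn]]. simpl in *.
    destruct (goursat_quarter n p _ Hin Hmn) as [q [Hq1 [Hq2 Hq3]]].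
    assert (Hq : inside (S n) q /\ m / 4 ^ (S n) <= Cmod (rect (S n) q)).
    { split; [exact Hq1|]. replace (m / 4 ^ S n) with (m / 4 ^ n / 4); [exact Hq2|].
      assert (0 < 4 ^ n) by (apply pow_lt; lra). simpl. field. lra. }
    exists (exist _ (S n, q) Hq). simpl. auto. }
  assert (H0 : inside 0 (a, c) /\ m / 4 ^ 0 <= Cmod (rect 0 (a, c))).
  { unfold inside, rect, wn, hn. simpl. rewrite !Rdiv_1_r.
    repeat split; try lra. right; reflexivity. }
  destruct (functional_choice _ step) as [F HF].
  set (s := fix s n := match n with O => exist _ (O, (a, c)) H0 : S0 | S k => F (s k) end).
  assert (Hn : forall n, fst (proj1_sig (s n)) = n).
  { induction n; [reflexivity|]. simpl. rewrite (proj1 (HF (s n))). now rewrite IHn. }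
  exists (fun n => snd (proj1_sig (s n))). intros n. split.
  - pose proof (proj2_sig (s n)) as Q. simpl in Q. rewrite Hn in Q. exact Q.
  - pose proof (proj2 (HF (s n))) as Q. simpl in Q. rewrite Hn in Q. exact Q. }
destruct Hseq as [p Hp].
assert (Hmono : forall n k, fst (p n) <= fst (p (n + k)%nat) /\
  fst (p (n + k)%nat) + wn (n + k) <= fst (p n) + wn n /\
  snd (p n) <= snd (p (n + k)%nat) /\
  snd (p (n + k)%nat) + hn (n + k) <= snd (p n) + hn n).
{ intros n k. induction k; [rewrite Nat.add_0_r; lra|].
  rewrite Nat.add_succ_r. destruct (Hp (n + k)%nat) as [_ Q]. lra. }
assert (Hpos : forall n, 0 <= wn n /\ 0 <= hn n).
{ intros n. destruct (goursat_size n). lra. }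
assert (Hlim : forall q s : nat -> R, (forall n, 0 <= s n) ->
   (forall n k, q n <= q (n + k)%nat /\ q (n + k)%nat + s (n + k)%nat <= q n + s n) ->
   exists l, forall n, q n <= l <= q n + s n).
{ intros q s Hs Hq.
  destruct (completeness (fun x => exists n, x = q n)) as [l [Hl1 Hl2]].
  - exists (q O + s O). intros x [n ->]. specialize (Hq O n). specialize (Hs n). simpl in Hq. lra.
  - exists (q O), O. reflexivity.
  - exists l. intros n. split; [apply Hl1; eauto|]. apply Hl2. intros x [k ->].
    destruct (Nat.le_ge_cases n k) as [L|L].
    + destruct (Hq n (k - n)%nat) as [_ Q].
      replace (n + (k - n))%nat with k in Q by lia. specialize (Hs k). lra.
    + destruct (Hq k (n - k)%nat) as [Q _].
      replace (k + (n - k))%nat with n in Q by lia. specialize (Hs n). lra. }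
destruct (Hlim (fun n => fst (p n)) wn) as [X HX]; [apply Hpos|intros; split; apply Hmono|].
destruct (Hlim (fun n => snd (p n)) hn) as [Y HY]; [apply Hpos|intros; split; apply Hmono|].
assert (HD : ex_derive (K := C_AbsRing) (V := C_NormedModule) g (X, Y)).
{ destruct (Hp O) as [[[I1 [I2 [I3 I4]]] _] _]. specialize (HX O). specialize (HY O). apply Hg; lra. }
destruct HD as [l Hl]. rewrite is_derive_C_eps in Hl.
set (S := w + h + 1). assert (HS : 0 < S) by (unfold S; lra).
(* With this precision the bound at stage [n] is at most [m / 2 / 4 ^ n]. [S] exceeds [w + h] by 1
   to stay positive for a degenerate rectangle. *)
destruct (Hl (m / (4 * S * S))) as [delta [Hdelta Hd]].
{ apply Rdiv_lt_0_compat; nra. }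
assert (Hn : exists n, (w + h) / 2 ^ n < delta).
{ destruct (Pow_x_infinity 2 ltac:(rewrite Rabs_pos_eq; lra) (S / delta)) as [n Hn].
  exists n. specialize (Hn n (Nat.le_refl n)).
  assert (0 < 2 ^ n) by (apply pow_lt; lra). rewrite Rabs_pos_eq in Hn by lra.
  apply Rmult_lt_reg_r with (2 ^ n); [lra|].
  replace ((w + h) / 2 ^ n * 2 ^ n) with (w + h) by (field; lra).
  apply Rge_le, (Rmult_le_compat_r delta) in Hn; [|lra].
  replace (S / delta * delta) with S in Hn by (field; lra). unfold S in Hn. lra. }
destruct Hn as [n Hn].
destruct (Hp n) as [[Hin Hbig] _]. specialize (HX n). specialize (HY n).
assert (Hc := goursat_continuous n (p n) Hin).
destruct (Hpos n) as [Hwn Hhn].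
assert (Hsum : wn n + hn n = (w + h) / 2 ^ n) by (unfold wn, hn; field; apply pow_nonzero; lra).
(* The affine part of [g] at the limit point; its boundary integral vanishes, so only [g - k] has to
   be estimated. *)
set (k := fun z : C => (g (X, Y) + l * (z - (X, Y)))%C).
assert (Hk : C_continuous_on_rect k (fst (p n)) (fst (p n) + wn n) (snd (p n)) (snd (p n) + hn n)).
{ intros x y _ _. set (K := Cmod l + 1).
  assert (0 < K) by (pose proof (Cmod_ge_0 l); unfold K; lra).
  intros eps Heps. exists (eps / K). split; [apply Rdiv_lt_0_compat; lra|].
  intros z' Hz'. unfold k.
  replace (_ - _)%C with (l * (z' - (x, y)))%C by ring. rewrite Cmod_mult.
  apply Rle_trans with (K * (eps / K)); [|right; field; lra].
  apply Rmult_le_compat; try apply Cmod_ge_0; [unfold K; lra|lra]. }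
assert (E0 : rect_integral k (fst (p n)) (fst (p n) + wn n) (snd (p n)) (snd (p n) + hn n) = RtoC 0).
{ apply (rect_integral_primitive (fun z => g (X, Y) * z + l * ((z - (X, Y)) * (z - (X, Y))) / 2)%C).
  intros x y Hx Hy. rewrite Rmin_left, Rmax_right in Hx, Hy by lra.
  split; [apply is_derive_affine|now apply Hk]. }
assert (B : Cmod (rect_integral (fun z => g z - k z)%C (fst (p n)) (fst (p n) + wn n)
    (snd (p n)) (snd (p n) + hn n)) <=
  2 * (m / (4 * S * S) * (wn n + hn n)) * ((fst (p n) + wn n - fst (p n)) + (snd (p n) + hn n - snd (p n)))).
{ apply rect_integral_bound; try lra.
  - intros x y Hx Hy eps Heps.
    destruct (Hc x y Hx Hy (eps / 2) ltac:(lra)) as [d1 [Hd1 H1]].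
    destruct (Hk x y Hx Hy (eps / 2) ltac:(lra)) as [d2 [Hd2 H2]].
    exists (Rmin d1 d2). split; [now apply Rmin_pos|]. intros z' Hz'.
    specialize (H1 z' (Rlt_le_trans _ _ _ Hz' (Rmin_l _ _))).
    specialize (H2 z' (Rlt_le_trans _ _ _ Hz' (Rmin_r _ _))).
    replace (g z' - k z' - (g (x, y) - k (x, y)))%C with
      ((g z' - g (x, y)) + - (k z' - k (x, y)))%C by ring.
    eapply Rle_trans; [apply Cmod_triangle|]. rewrite Cmod_opp. lra.
  - intros x y Hx Hy.
    assert (Hz : Cmod ((x, y) - (X, Y))%C <= wn n + hn n).
    { eapply Rle_trans; [apply Cmod_le_abs_sum|].
      apply Rplus_le_compat; apply Rabs_le; lra. }
    replace (g (x, y) - k (x, y))%C with (g (x, y) - g (X, Y) - l * ((x, y) - (X, Y)))%C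
      by (unfold k; ring).
    eapply Rle_trans; [apply Hd; lra|].
    apply Rmult_le_compat_l; [left; apply Rdiv_lt_0_compat; nra|exact Hz]. }
rewrite rect_integral_minus, E0 in B by (assumption || lra).
unfold Cminus in B. rewrite Copp_0, Cplus_0_r in B.
fold (rect n (p n)) in B.
assert (H4 : m / 4 ^ n <= 2 * (m / (4 * S * S) * (wn n + hn n)) * (wn n + hn n)) by lra.
rewrite Hsum in H4.
assert (P2 : 0 < 2 ^ n) by (apply pow_lt; lra).
assert (P4 : 4 ^ n = 2 ^ n * 2 ^ n) by (rewrite <- Rpow_mult_distr; f_equal; lra).
rewrite P4 in H4.
apply (Rmult_le_compat_r (2 ^ n * 2 ^ n)) in H4; [|nra].
replace (m / (2 ^ n * 2 ^ n) * (2 ^ n * 2 ^ n)) with m in H4 by (field; lra).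
replace (2 * (m / (4 * S * S) * ((w + h) / 2 ^ n)) * ((w + h) / 2 ^ n) * (2 ^ n * 2 ^ n))
  with (m / 2 * ((w + h) * (w + h) / (S * S))) in H4 by (field; lra).
assert ((w + h) * (w + h) / (S * S) <= 1).
{ apply Rmult_le_reg_r with (S * S); [nra|].
  replace ((w + h) * (w + h) / (S * S) * (S * S)) with ((w + h) * (w + h)) by (field; lra).
  unfold S. nra. }
nra.
Qed.
End Goursat.

(** * Primitives in the upper half-plane *)

Definition holomorphic_on_H (g : C -> C) : Prop :=
  forall tau, upper_half_plane tau ->
    ex_derive (K := C_AbsRing) (V := C_NormedModule) g tau.

Lemma horizontal_continuous_H g a b y : holomorphic_on_H g -> 0 < y ->
  path_continuous (fun x => g (x, y)) a b.
Proof.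
intros Hg Hy. apply cint_horizontal_continuous.
intros. now apply ex_derive_C_continuous, Hg.
Qed.

Lemma vertical_continuous_H g c d x : holomorphic_on_H g -> 0 < c -> 0 < d ->
  path_continuous (fun y => g (x, y)) c d.
Proof.
intros Hg Hc Hd. apply cint_vertical_continuous.
intros y Hy. apply ex_derive_C_continuous, Hg. unfold upper_half_plane; simpl.
assert (0 < Rmin c d) by (apply Rmin_pos; lra). lra.
Qed.

(** The boundary integral changes sign when the ends of either side are exchanged, which reduces the
    claim to ordered ends. *)
Lemma goursat_H g a b c d : holomorphic_on_H g -> 0 < c -> 0 < d ->
  rect_integral g a b c d = RtoC 0.
Proof.
intros Hg.
assert (G : forall a b c d, a <= b -> c <= d -> 0 < c -> rect_integral g a b c d = RtoC 0).
{ intros x x' y y' Hx Hy Hy0.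
  replace x' with (x + (x' - x)) by ring. replace y' with (y + (y' - y)) by ring.
  apply goursat_rect; try lra. intros s t Hs Ht. apply Hg. unfold upper_half_plane; simpl. lra. }
assert (Sh : forall a b c d, 0 < c -> 0 < d -> rect_integral g b a c d = (- rect_integral g a b c d)%C).
{ intros x x' y y' Hy Hy'. unfold rect_integral.
  rewrite (cint_swap (fun s => g (s, y)) x x'), (cint_swap (fun s => g (s, y')) x x')
    by (now apply horizontal_continuous_H). ring. }
assert (Sv : forall a b c d, 0 < c -> 0 < d -> rect_integral g a b d c = (- rect_integral g a b c d)%C).
{ intros x x' y y' Hy Hy'. unfold rect_integral.
  rewrite (cint_swap (fun t => g (x, t)) y y'), (cint_swap (fun t => g (x', t)) y y')
    by (now apply vertical_continuous_H). ring. }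
intros Hc Hd.
destruct (Rle_dec a b) as [H1|H1]; destruct (Rle_dec c d) as [H2|H2].
- apply G; lra.
- rewrite Sv, G by lra. ring.
- rewrite Sh, G by lra. ring.
- rewrite Sv, Sh, G by lra. ring.
Qed.

(* The primitive integrates [g] along an L-shaped path from [i]; closedness of
   rectangles makes both L-shaped paths agree, which gives both partial
   derivatives. *)
Lemma holomorphic_primitive g : holomorphic_on_H g ->
  exists P : C -> C, forall tau, upper_half_plane tau ->
    is_derive (K := C_AbsRing) (V := C_NormedModule) P tau (g tau).
Proof.
intros Hg.
set (P := fun z : C => (cint (fun s => g (s, 1)) 0 (fst z)
            + Ci * cint (fun t => g (fst z, t)) 1 (snd z))%C).
exists P. intros [x y] Hy. unfold upper_half_plane in Hy; simpl in Hy.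
apply is_derive_C_eps. intros eps Heps.
destruct (ex_derive_C_continuous g (x, y) (Hg (x, y) Hy) (eps / 2) ltac:(lra)) as [d0 [Hd0 Hc]].
exists (Rmin (d0 / 2) y). split; [apply Rmin_pos; lra|].
intros [x' y'] Hz.
assert (Hz1 := Rlt_le_trans _ _ _ Hz (Rmin_l _ _)).
assert (Hz2 := Rlt_le_trans _ _ _ Hz (Rmin_r _ _)).
pose proof (Rmax_Cmod ((x', y') - (x, y))%C) as HM. simpl in HM.
pose proof (Rmax_l (Rabs (x' + - x)) (Rabs (y' + - y))).
pose proof (Rmax_r (Rabs (x' + - x)) (Rabs (y' + - y))).
set (r := Cmod ((x', y') - (x, y))%C) in *.
assert (Ax : Rabs (x' - x) <= r) by (unfold Rminus; lra).
assert (Ay : Rabs (y' - y) <= r) by (unfold Rminus; lra).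
assert (Hy' : 0 < y') by (apply Rabs_le_between in Ay; lra).
assert (EP : (P (x', y') - P (x, y))%C =
  (cint (fun s => g (s, y)) x x' + Ci * cint (fun t => g (x', t)) y y')%C).
{ unfold P; simpl.
  rewrite <- (cint_Chasles (fun t => g (x', t)) 1 y y') by (apply vertical_continuous_H; (assumption || lra)).
  rewrite <- (cint_Chasles (fun s => g (s, 1)) 0 x x') by (apply horizontal_continuous_H; (assumption || lra)).
  assert (R0 := goursat_H g x x' 1 y Hg Rlt_0_1 Hy). unfold rect_integral in R0.
  apply (f_equal (fun u => (u + cint (fun s => g (s, y)) x x')%C)) in R0.
  rewrite Cplus_0_l in R0. rewrite <- R0. ring. }
rewrite EP.
assert (Hloc : forall u : C, Rabs (fst u - x) <= r -> Rabs (snd u - y) <= r ->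
  Cmod (g u - g (x, y)) <= eps / 2).
{ intros [u1 u2] Hu1 Hu2. apply Hc. simpl in *.
  eapply Rle_lt_trans; [apply Cmod_le_abs_sum|]. lra. }
assert (Hbx : forall s, Rmin x x' <= s <= Rmax x x' -> Rabs (s - x) <= r).
{ intros s Hs. eapply Rle_trans; [|exact Ax].
  revert Hs. unfold Rmin, Rmax. destruct (Rle_dec x x'); intros; unfold Rabs; repeat destruct Rcase_abs; lra. }
assert (Hby : forall s, Rmin y y' <= s <= Rmax y y' -> Rabs (s - y) <= r).
{ intros s Hs. eapply Rle_trans; [|exact Ay].
  revert Hs. unfold Rmin, Rmax. destruct (Rle_dec y y'); intros; unfold Rabs; repeat destruct Rcase_abs; lra. }
assert (Kc : forall a b, path_continuous (fun _ => g (x, y)) a b).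
{ intros a b t _. apply continuous_const. }
assert (B1 : Cmod (cint (fun s => g (s, y) - g (x, y))%C x x') <= eps / 2 * Rabs (x' - x)).
{ apply cint_bound_abs.
  - apply (cint_horizontal_continuous (fun z => g z - g (x, y))%C). intros s _ e He.
    destruct (ex_derive_C_continuous g (s, y) (Hg (s, y) Hy) e He) as [dd [Hdd Hcc]].
    exists dd. split; [exact Hdd|]. intros z' Hz'.
    replace (g z' - g (x, y) - (g (s, y) - g (x, y)))%C with (g z' - g (s, y))%C by ring. now apply Hcc.
  - intros s Hs. apply Hloc; [now apply Hbx|]. simpl.
    rewrite Rminus_diag, Rabs_R0. apply Cmod_ge_0. }
assert (B2 : Cmod (cint (fun t => g (x', t) - g (x, y))%C y y') <= eps / 2 * Rabs (y' - y)).
{ apply cint_bound_abs.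
  - apply (cint_vertical_continuous (fun z => g z - g (x, y))%C). intros s Hs e He.
    assert (0 < s). { assert (0 < Rmin y y') by (now apply Rmin_pos). lra. }
    destruct (ex_derive_C_continuous g (x', s) (Hg (x', s) H1) e He) as [dd [Hdd Hcc]].
    exists dd. split; [exact Hdd|]. intros z' Hz'.
    replace (g z' - g (x, y) - (g (x', s) - g (x, y)))%C with (g z' - g (x', s))%C by ring. now apply Hcc.
  - intros s Hs. apply Hloc; [exact Ax|now apply Hby]. }
rewrite cint_minus, cint_const in B1 by (apply Kc || now apply horizontal_continuous_H).
rewrite cint_minus, cint_const in B2 by (apply Kc || now apply vertical_continuous_H).
match goal with |- Cmod ?u <= _ => replace u with
  ((cint (fun s => g (s, y)) x x' - g (x, y) * RtoC (x' - x))
   + Ci * (cint (fun t => g (x', t)) y y' - g (x, y) * RtoC (y' - y)))%C end.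
2:{ replace ((x', y') - (x, y))%C with (RtoC (x' - x) + Ci * RtoC (y' - y))%C
      by (apply injective_projections; simpl; ring). ring. }
eapply Rle_trans; [apply Cmod_triangle|]. rewrite Cmod_mult, Cmod_Ci.
assert (eps / 2 * Rabs (x' - x) <= eps / 2 * r) by (apply Rmult_le_compat_l; lra).
assert (eps / 2 * Rabs (y' - y) <= eps / 2 * r) by (apply Rmult_le_compat_l; lra).
lra.
Qed.

Lemma path_integral_primitive (P g : C -> C) (p dp : R -> C) a b :
  (forall tau, upper_half_plane tau ->
     is_derive (K := C_AbsRing) (V := C_NormedModule) P tau (g tau)) ->
  (forall t, Rmin a b <= t <= Rmax a b -> upper_half_plane (p t) /\
     is_derive (V := C_R_NormedModule) p t (dp t)) ->
  path_continuous (fun t => g (p t) * dp t)%C a b ->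
  cint (fun t => g (p t) * dp t)%C a b = (P (p b) - P (p a))%C.
Proof.
intros HP Hp Hc. apply (cint_FTC (fun t => P (p t))); [|exact Hc].
intros t Ht. destruct (Hp t Ht) as [H1 H2]. apply is_derive_path_comp; auto.
Qed.

(** * Words in T and V *)

(* Letters are booleans: [false] is T and [true] is V. *)
Definition letter_mat (L : bool) : mat2 := if L then matV else matT.
Definition word_mat (W : list bool) : mat2 := fold_right mmul mone (map letter_mat W).
Definition letter_act (L : bool) (z : R) : R := if L then z / (z + 1) else z + 1.
Definition word_act (W : list bool) (z : R) : R := fold_right letter_act z W.

Lemma letter_act_pos L z : 0 < z -> 0 < letter_act L z.
Proof. intros H. destruct L; simpl; [apply Rdiv_lt_0_compat|]; lra. Qed.

Lemma word_act_pos W z : 0 < z -> 0 < word_act W z.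
Proof. intros H. induction W; simpl; auto using letter_act_pos. Qed.

Lemma word_act_app W W' z : word_act (W ++ W') z = word_act W (word_act W' z).
Proof. apply fold_right_app. Qed.

Lemma H_neq_real (tau : C) (x : R) : upper_half_plane tau -> (tau - x)%C <> 0.
Proof.
intros H E. apply (f_equal Im) in E. destruct tau as [a b].
unfold upper_half_plane in H. simpl in *. lra.
Qed.

Lemma H_plus_real (tau : C) (x : R) : upper_half_plane tau -> upper_half_plane (tau + x)%C.
Proof. destruct tau. unfold upper_half_plane; simpl. lra. Qed.

Lemma moebius_T (tau : C) : moebius matT tau = (tau + 1)%C.
Proof. unfold moebius, ZtoC; simpl. field. Qed.

Lemma moebius_V (tau : C) : moebius matV tau = (tau / (tau + 1))%C.
Proof.
unfold moebius, ZtoC; simpl.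
replace (1 * tau + 0)%C with tau by ring. replace (1 * tau + 1)%C with (tau + 1)%C by ring. reflexivity.
Qed.

Lemma moebius_H L tau : upper_half_plane tau -> upper_half_plane (moebius (letter_mat L) tau).
Proof.
intros H. destruct L; unfold letter_mat.
- rewrite moebius_V. destruct tau as [a b]. unfold upper_half_plane in *. simpl in *.
  assert (P : 0 < (a + 1) * (a + 1) + (b + 0) * (b + 0)).
  { pose proof (Rle_0_sqr (a + 1)). pose proof (Rmult_lt_0_compat b b H H). unfold Rsqr in *. lra. }
  match goal with |- 0 < ?u => replace u with (b / ((a + 1) * (a + 1) + (b + 0) * (b + 0))) by (field; intros E; lra) end.
  now apply Rdiv_lt_0_compat.
- rewrite moebius_T. now apply H_plus_real.
Qed.

Lemma moebius_denominator A tau : mdet A = 1%Z -> upper_half_plane tau ->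
  (ZtoC (mc A) * tau + ZtoC (md A))%C <> 0.
Proof.
destruct A as [a b c d]. unfold mdet, upper_half_plane, ZtoC. simpl. intros H Ht E.
destruct tau as [x y]. apply (f_equal (fun z => (Re z, Im z))) in E.
injection E as E1 E2. simpl in *.
assert (Hc : IZR c = 0) by nra. rewrite Hc in E1.
assert (Hd : IZR d = 0) by lra.
apply eq_IZR_R0 in Hc, Hd. subst. lia.
Qed.

Lemma mdet_mmul A B : mdet (mmul A B) = (mdet A * mdet B)%Z.
Proof. unfold mdet, mmul; simpl. ring. Qed.

Lemma mdet_letter L : mdet (letter_mat L) = 1%Z.
Proof. now destruct L. Qed.

Lemma mdet_word W : mdet (word_mat W) = 1%Z.
Proof.
induction W as [|L W IH]; [reflexivity|].
unfold word_mat in *; simpl. now rewrite mdet_mmul, mdet_letter, IH.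
Qed.

Lemma moebius_mmul A B tau : mdet A = 1%Z -> mdet B = 1%Z -> upper_half_plane tau ->
  upper_half_plane (moebius B tau) ->
  moebius (mmul A B) tau = moebius A (moebius B tau).
Proof.
intros HA HB Ht Ht'.
assert (H1 := moebius_denominator B tau HB Ht).
assert (H2 := moebius_denominator A _ HA Ht').
assert (H3 : mdet (mmul A B) = 1%Z) by (rewrite mdet_mmul, HA, HB; reflexivity).
assert (H4 := moebius_denominator _ tau H3 Ht).
destruct A as [a b c d], B as [a' b' c' d']. unfold moebius in *. simpl in *.
unfold ZtoC in *. rewrite !plus_IZR, !mult_IZR, !RtoC_plus, !RtoC_mult in *.
assert (H5 : (IZR c * (IZR a' * tau + IZR b') + IZR d * (IZR c' * tau + IZR d'))%C <> 0).
{ intros E. apply H4. rewrite <- E. ring. }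
field. repeat split; try assumption.
Qed.

Lemma word_mat_H W tau : upper_half_plane tau ->
  upper_half_plane (moebius (word_mat W) tau) /\
  forall L, moebius (word_mat (L :: W)) tau = moebius (letter_mat L) (moebius (word_mat W) tau).
Proof.
intros H. assert (HW : upper_half_plane (moebius (word_mat W) tau)).
{ induction W as [|L W IH].
  - unfold moebius, word_mat, ZtoC; simpl.
    replace ((1 * tau + 0) / (0 * tau + 1))%C with tau by field. exact H.
  - unfold word_mat; simpl. rewrite moebius_mmul; auto using mdet_letter.
    + now apply moebius_H.
    + apply mdet_word. }
split; [exact HW|]. intros L. unfold word_mat at 1; simpl.
apply moebius_mmul; auto using mdet_letter. apply mdet_word.
Qed.

Lemma moebius_mone tau : moebius mone tau = tau.
Proof. unfold moebius, ZtoC; simpl. field. Qed.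

Definition fixed_point_form (f : C -> C) (w x : R) (tau : C) : C :=
  (f tau * (1 / (tau - w) - 1 / (tau - x)))%C.

Lemma is_derive_C_inv (w : R) tau : upper_half_plane tau ->
  is_derive (K := C_AbsRing) (V := C_NormedModule) (fun z => 1 / (z - w))%C tau
    (- (1 / ((tau - w) * (tau - w))))%C.
Proof.
intros H. apply is_derive_C_eps. intros eps Heps.
assert (H0 := H_neq_real tau w H). set (u := (tau - w)%C) in *.
assert (Hu : 0 < Cmod u) by now apply Cmod_gt_0.
set (m := Cmod u) in *.
exists (Rmin (m / 2) (eps * (m * m * m) / 2)). split.
{ apply Rmin_pos; [lra|]. assert (0 < m * m * m) by (repeat apply Rmult_lt_0_compat; lra). nra. }
intros z' Hz'.
assert (Hz1 := Rlt_le_trans _ _ _ Hz' (Rmin_l _ _)).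
assert (Hz2 := Rlt_le_trans _ _ _ Hz' (Rmin_r _ _)).
set (h := (z' - tau)%C) in *.
assert (Hv : m / 2 <= Cmod (u + h)).
{ assert (T := Cmod_triangle (u + h) (- h)). rewrite Cmod_opp in T.
  replace (u + h + - h)%C with u in T by ring. fold m in T. lra. }
assert (Hv0 : (u + h)%C <> 0). { intros E. rewrite E, Cmod_0 in Hv. lra. }
replace (z' - w)%C with (u + h)%C by (unfold u, h; ring).
replace (1 / (u + h) - 1 / u - - (1 / (u * u)) * h)%C with (h * / (u + h) * / u * / u * h)%C
  by (field; auto).
rewrite !Cmod_mult, !Cmod_inv by assumption. fold m.
apply Rmult_le_compat_r; [apply Cmod_ge_0|].
assert (Hm3 : 0 < m * m * m) by (repeat apply Rmult_lt_0_compat; lra).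
apply Rmult_le_reg_r with (m * m * Cmod (u + h)); [apply Rmult_lt_0_compat; [nra|lra]|].
replace (Cmod h * / Cmod (u + h) * / m * / m * (m * m * Cmod (u + h))) with (Cmod h) by (field; lra).
apply Rle_trans with (eps * (m * m * (m / 2))); [lra|].
apply Rmult_le_compat_l; [lra|]. apply Rmult_le_compat_l; [nra|lra].
Qed.

(** The product rule and the rule for composition take one of the two presentations of [C] as a
    module over itself, the remaining lemmas the other. *)
Lemma is_derive_C_AbsRing (g : C -> C) z l :
  is_derive (K := C_AbsRing) (V := C_NormedModule) g z l <->
  is_derive (K := C_AbsRing) (V := AbsRing_NormedModule C_AbsRing) g z l.
Proof.
split; intros [_ H]; (split; [apply is_linear_scal_l|]); intros x Hx.
- exact (H x Hx).
- exact (H x Hx).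
Qed.

Lemma holomorphic_mult (f g : C -> C) : holomorphic_on_H f -> holomorphic_on_H g ->
  holomorphic_on_H (fun z => f z * g z)%C.
Proof.
intros Hf Hg tau H. destruct (Hf tau H) as [l Hl]. destruct (Hg tau H) as [k Hk].
exists (l * g tau + f tau * k)%C.
apply is_derive_C_AbsRing.
eapply (filterdiff_ext_lin (V := AbsRing_NormedModule C_AbsRing)).
- exact (filterdiff_mult_fct (K := C_AbsRing) (U := AbsRing_NormedModule C_AbsRing) f g tau
    (fun y => scal y l) (fun y => scal y k) Cmult_comm
    (proj1 (is_derive_C_AbsRing f tau l) Hl) (proj1 (is_derive_C_AbsRing g tau k) Hk)).
- intros y. unfold scal, plus, mult; simpl. unfold scal, mult; simpl. ring.
Qed.

Lemma holomorphic_fixed_point_form f w x : holomorphic_on_H f ->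
  holomorphic_on_H (fixed_point_form f w x).
Proof.
intros Hf. apply holomorphic_mult; [exact Hf|]. intros tau H.
eexists. apply (is_derive_minus (K := C_AbsRing) (V := C_NormedModule)); now apply is_derive_C_inv.
Qed.

Definition primitive_on_H (P g : C -> C) : Prop :=
  forall tau, upper_half_plane tau ->
    is_derive (K := C_AbsRing) (V := C_NormedModule) P tau (g tau).

Lemma segment_in_H a b t : upper_half_plane a -> upper_half_plane b -> 0 <= t <= 1 ->
  upper_half_plane (a + t * (b - a))%C.
Proof. destruct a, b. unfold upper_half_plane; simpl. intros. nra. Qed.

Lemma is_derive_segment (a b : C) (t : R) :
  is_derive (V := C_R_NormedModule) (fun s : R => a + s * (b - a))%C t (b - a)%C.
Proof.
apply is_derive_path_eps. intros eps Heps. exists 1. split; [lra|]. intros s _.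
replace (_ - _ - _)%C with (RtoC 0) by (rewrite RtoC_minus; ring).
rewrite Cmod_0. pose proof (Rabs_pos (s - t)). nra.
Qed.

Lemma path_continuous_mult_const (h : R -> C) (k : C) a b :
  path_continuous h a b -> path_continuous (fun t => h t * k)%C a b.
Proof.
intros H t Ht. specialize (H t Ht). rewrite continuous_path_eps in *. intros eps Heps.
set (K := Cmod k + 1). assert (0 < K) by (pose proof (Cmod_ge_0 k); unfold K; lra).
destruct (H (eps / K)) as [d [Hd Hc]]; [apply Rdiv_lt_0_compat; lra|].
exists d. split; [exact Hd|]. intros s Hs.
replace (h s * k - h t * k)%C with ((h s - h t) * k)%C by ring. rewrite Cmod_mult.
apply Rle_trans with (eps / K * K); [|right; field; lra].
apply Rmult_le_compat; try apply Cmod_ge_0; [now apply Hc|unfold K; lra].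
Qed.

Lemma segment_integral_primitive P g a b :
  holomorphic_on_H g -> primitive_on_H P g -> upper_half_plane a -> upper_half_plane b ->
  segment_integral g a b = (P b - P a)%C.
Proof.
intros Hg HP Ha Hb.
assert (E := path_integral_primitive P g (fun t => a + t * (b - a))%C (fun _ => b - a)%C 0 1 HP).
rewrite Rmin_left, Rmax_right in E by lra.
unfold segment_integral. unfold cint in E. rewrite E.
- f_equal; [|f_equal]; f_equal; ring.
- intros t Ht. split; [now apply segment_in_H|apply is_derive_segment].
- apply path_continuous_mult_const. intros t Ht.
  rewrite Rmin_left, Rmax_right in Ht by lra.
  apply (C_continuous_comp_path g (fun t => a + t * (b - a))%C).
  + apply ex_derive_C_continuous, Hg. now apply segment_in_H.
  + eapply is_derive_path_continuous, is_derive_segment.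
Qed.

Lemma primitive_unique P1 P2 g a b :
  holomorphic_on_H g -> primitive_on_H P1 g -> primitive_on_H P2 g ->
  upper_half_plane a -> upper_half_plane b ->
  (P1 b - P1 a)%C = (P2 b - P2 a)%C.
Proof.
intros. rewrite <- (segment_integral_primitive P1 g), <- (segment_integral_primitive P2 g); auto.
Qed.

Lemma locally_H tau : upper_half_plane tau ->
  locally (T := AbsRing_UniformSpace C_AbsRing) tau upper_half_plane.
Proof.
intros H. exists (mkposreal _ H). intros z Hz. change (Cmod (z - tau)%C < Im tau) in Hz.
pose proof (Rmax_Cmod (z - tau)%C) as M.
pose proof (Rmax_r (Rabs (fst (z - tau)%C)) (Rabs (snd (z - tau)%C))) as M2.
unfold upper_half_plane. destruct z, tau. simpl in *.
assert (A : Rabs (r0 + - r2) < r2) by lra. apply Rabs_lt_between in A. lra.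
Qed.

(** Pulling the form back by a letter [L] moves both poles by the inverse of [L]. The inverse of T
    or V acts on a negative number [- y] as the letter itself acts on [y], so a letter leaves the
    future [x] and enters the past [y]. *)
Lemma primitive_comp_letter f P L x y :
  (forall A tau, mdet A = 1%Z -> upper_half_plane tau -> f (moebius A tau) = f tau) ->
  0 < x -> 0 < y ->
  primitive_on_H P (fixed_point_form f (- y) (letter_act L x)) ->
  primitive_on_H (fun z => P (moebius (letter_mat L) z))
    (fixed_point_form f (- letter_act L y) x).
Proof.
intros Hf Hx Hy HP tau Ht.
set (d := if L then (1 / ((tau + 1) * (tau + 1)))%C else RtoC 1).
assert (H1 : (tau + 1)%C <> 0).
{ intros E. apply (H_neq_real tau (- (1)) Ht). rewrite RtoC_opp, <- E. ring. }
assert (D : is_derive (K := C_AbsRing) (V := C_NormedModule) (moebius (letter_mat L)) tau d).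
{ unfold d. destruct L.
  - apply (is_derive_ext_loc (K := C_AbsRing) (V := C_NormedModule) (fun z => 1 - 1 / (z - (- (1))%R))%C).
    + eapply filter_imp; [|exact (locally_H tau Ht)]. intros z Hz. unfold letter_mat. rewrite moebius_V.
      assert ((z + 1)%C <> 0).
      { intros E. apply (H_neq_real z (- (1)) Hz). rewrite RtoC_opp, <- E. ring. }
      rewrite RtoC_opp. match goal with |- ?u = ?v => change (@eq C u v) end.
      field. assumption.
    + assert (E := is_derive_minus (K := C_AbsRing) (V := C_NormedModule) _ _ tau _ _
        (is_derive_const (K := C_AbsRing) (RtoC 1 : C_NormedModule) tau) (is_derive_C_inv (- (1)) tau Ht)).
      replace (1 / ((tau + 1) * (tau + 1)))%C with
        (minus (G := C_NormedModule) zero (- (1 / ((tau - (- (1))%R) * (tau - (- (1))%R))))%C).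
      * exact E.
      * unfold minus, plus, opp, zero; simpl. rewrite RtoC_opp.
        replace (tau - - (1))%C with (tau + 1)%C by ring. ring.
  - apply is_derive_C_eps. intros eps Heps. exists 1. split; [lra|]. intros z' _.
    unfold letter_mat. rewrite !moebius_T.
    replace (_ - _ - _)%C with (RtoC 0) by ring. rewrite Cmod_0.
    pose proof (Cmod_ge_0 (z' - tau)%C). nra. }
assert (Ht' := moebius_H L tau Ht).
assert (E := is_derive_comp (K := C_AbsRing) (V := C_NormedModule) P (moebius (letter_mat L)) tau _ d
  (HP _ Ht') (proj1 (is_derive_C_AbsRing _ _ _) D)).
assert (V : scal (V := C_NormedModule) d
   (fixed_point_form f (- y) (letter_act L x) (moebius (letter_mat L) tau))
  = fixed_point_form f (- letter_act L y) x tau); [|rewrite V in E; exact E].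
unfold fixed_point_form. rewrite Hf by (assumption || apply mdet_letter).
unfold scal; simpl. unfold mult; simpl.
match goal with |- (d * (f tau * ?u))%C = (f tau * ?v)%C => cut ((d * u)%C = v) end.
{ intros <-. ring. }
assert (N1 := H_neq_real tau x Ht). assert (N2 := H_neq_real tau (- letter_act L y) Ht).
assert (N3 := H_neq_real _ (letter_act L x) Ht'). assert (N4 := H_neq_real _ (- y) Ht').
unfold d, letter_mat, letter_act in *. destruct L.
- rewrite moebius_V in *.
  assert (Y1 : RtoC (y + 1) <> 0) by (intros Y; apply RtoC_inj in Y; lra).
  assert (X1 : RtoC (x + 1) <> 0) by (intros X; apply RtoC_inj in X; lra).
  rewrite RtoC_opp, !RtoC_div, !RtoC_plus in * by lra.
  assert (N2' : (tau * (y + 1) - - y)%C <> 0).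
  { intros Z. apply N2. replace (tau - - (y / (y + 1)))%C with ((tau * (y + 1) - - y) / (y + 1))%C by (field; assumption).
    rewrite Z. field. assumption. }
  assert (N4' : (tau + y * (tau + 1))%C <> 0).
  { intros Z. apply N2'. rewrite <- Z. ring. }
  assert (N3' : (tau * (x + 1) - x * (tau + 1))%C <> 0).
  { intros Z. apply N1. rewrite <- Z. ring. }
  rewrite RtoC_opp, RtoC_div, RtoC_plus by lra. field. repeat split; assumption.
- rewrite moebius_T, !RtoC_opp, !RtoC_plus.
  replace (tau + 1 - - y)%C with (tau - - (y + 1))%C by ring.
  replace (tau + 1 - (x + 1))%C with (tau - x)%C by ring.
  ring.
Qed.

(** * Integrals along arcs of the unit circle *)

Lemma is_derive_path_pair (f g : R -> R) (t a b : R) :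
  is_derive f t a -> is_derive g t b ->
  is_derive (V := C_R_NormedModule) (fun s => (f s, g s) : C) t ((a, b) : C).
Proof.
intros [_ Hf] [_ Hg]. apply is_derive_path_eps. intros eps Heps.
assert (He : 0 < eps / 2) by lra.
destruct (Hf t (fun P HP => HP) (mkposreal _ He)) as [d1 H1].
destruct (Hg t (fun P HP => HP) (mkposreal _ He)) as [d2 H2].
exists (Rmin d1 d2). split; [apply Rmin_pos; apply cond_pos|]. intros s Hs.
assert (A1 := H1 s (Rlt_le_trans _ _ _ Hs (Rmin_l _ _))).
assert (A2 := H2 s (Rlt_le_trans _ _ _ Hs (Rmin_r _ _))).
change (Rabs ((f s - f t) - (s - t) * a) <= eps / 2 * Rabs (s - t)) in A1.
change (Rabs ((g s - g t) - (s - t) * b) <= eps / 2 * Rabs (s - t)) in A2.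
replace ((f s, g s) - (f t, g t) - (a, b) * RtoC (s - t))%C with
  ((f s, g s) - (f t + (s - t) * a, g t + (s - t) * b)%R)%C
  by (apply injective_projections; simpl; ring).
eapply Rle_trans; [apply Cmod_le_abs_sum|].
replace (f s - (f t + (s - t) * a)) with (f s - f t - (s - t) * a) by ring.
replace (g s - (g t + (s - t) * b)) with (g s - g t - (s - t) * b) by ring. lra.
Qed.

Definition circle (t : R) : C := (cos t, sin t).

Lemma circle_H t : 0 < t < PI -> upper_half_plane (circle t).
Proof. intros H. now apply sin_gt_0. Qed.

Lemma is_derive_circle t :
  is_derive (V := C_R_NormedModule) circle t (Ci * circle t)%C.
Proof.
replace (Ci * circle t)%C with ((- sin t, cos t) : C)
  by (unfold Ci, circle, Cmult; simpl; f_equal; ring).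
apply is_derive_path_pair; auto_derive; auto; ring.
Qed.

Lemma arc_in_H t : PI / 3 <= t <= 2 * PI / 3 -> upper_half_plane (circle t).
Proof. intros H. apply circle_H. pose proof PI_RGT_0. lra. Qed.

Lemma sqrt3_sqr : sqrt 3 * sqrt 3 = 3.
Proof. apply sqrt_sqrt. lra. Qed.

Lemma circle_letter L : moebius (letter_mat L) (circle (2 * PI / 3)) = circle (PI / 3).
Proof.
unfold circle. replace (2 * PI / 3) with (2 * (PI / 3)) by field.
rewrite cos_2PI3, sin_2PI3, cos_PI3, sin_PI3.
pose proof sqrt3_sqr as H. unfold letter_mat. destruct L.
- rewrite moebius_V.
  replace (((-1 / 2)%R, (sqrt 3 / 2)%R) + 1)%C with ((1 / 2, sqrt 3 / 2) : C)
    by (apply injective_projections; simpl; field).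
  assert (N : ((1 / 2, sqrt 3 / 2) : C) <> 0).
  { intros E. apply (f_equal fst) in E. simpl in E. lra. }
  set (v := (1 / 2, sqrt 3 / 2) : C) in *.
  replace (((-1 / 2)%R, (sqrt 3 / 2)%R) : C) with (v * v)%C
    by (apply injective_projections; simpl; lra).
  field. exact N.
- rewrite moebius_T. apply injective_projections; simpl; field.
Qed.

(** The poles are the repelling point [- y] and the attracting point [x]. The arc is run through
    from [2 pi / 3] down to [pi / 3], the direction in which a letter moves its left end. *)
Definition arc_integral (f : C -> C) (y x : R) : C :=
  cint (fun t => fixed_point_form f (- y) x (circle t) * (Ci * circle t))%C
    (2 * PI / 3) (PI / 3).

Lemma path_continuous_mult (h k : R -> C) a b :
  path_continuous h a b -> path_continuous k a b ->
  path_continuous (fun t => h t * k t)%C a b.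
Proof.
intros Hh Hk t Ht.
assert (A := Hh t Ht). assert (B := Hk t Ht).
rewrite continuous_path_eps in *. intros eps Heps.
set (K := Cmod (k t) + 1). assert (0 < K) by (pose proof (Cmod_ge_0 (k t)); unfold K; lra).
set (M := Cmod (h t) + 1). assert (0 < M) by (pose proof (Cmod_ge_0 (h t)); unfold M; lra).
destruct (A (eps / (2 * K))) as [d1 [Hd1 H1]]; [apply Rdiv_lt_0_compat; lra|].
destruct (B (Rmin 1 (eps / (2 * M)))) as [d2 [Hd2 H2]].
{ apply Rmin_pos; [lra|apply Rdiv_lt_0_compat; lra]. }
exists (Rmin d1 d2). split; [now apply Rmin_pos|]. intros s Hs.
specialize (H1 s (Rlt_le_trans _ _ _ Hs (Rmin_l _ _))).
specialize (H2 s (Rlt_le_trans _ _ _ Hs (Rmin_r _ _))).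
assert (Hks : Cmod (k s) <= K).
{ replace (k s) with ((k s - k t) + k t)%C by ring. eapply Rle_trans; [apply Cmod_triangle|].
  pose proof (Rmin_l 1 (eps / (2 * M))). unfold K. lra. }
replace (h s * k s - h t * k t)%C with ((h s - h t) * k s + h t * (k s - k t))%C by ring.
eapply Rle_trans; [apply Cmod_triangle|]. rewrite !Cmod_mult.
assert (Cmod (h s - h t) * Cmod (k s) <= eps / 2).
{ apply Rle_trans with (eps / (2 * K) * K); [|right; field; lra].
  apply Rmult_le_compat; auto using Cmod_ge_0. }
assert (Cmod (h t) * Cmod (k s - k t) <= eps / 2).
{ apply Rle_trans with (M * (eps / (2 * M))); [|right; field; lra].
  apply Rmult_le_compat; auto using Cmod_ge_0; [unfold M; lra|].
  eapply Rle_trans; [exact H2|apply Rmin_r]. }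
lra.
Qed.

Lemma arc_path_continuous g a b : holomorphic_on_H g ->
  (forall t, Rmin a b <= t <= Rmax a b -> 0 < t < PI) ->
  path_continuous (fun t => g (circle t) * (Ci * circle t))%C a b.
Proof.
intros Hg H. apply path_continuous_mult; intros t Ht.
- apply C_continuous_comp_path.
  + now apply ex_derive_C_continuous, Hg, circle_H, H.
  + eapply is_derive_path_continuous, is_derive_circle.
- apply (C_continuous_comp_path (fun z => Ci * z)%C).
  + intros eps Heps. exists eps. split; [exact Heps|]. intros z Hz.
    replace (Ci * z - Ci * circle t)%C with (Ci * (z - circle t))%C by ring.
    rewrite Cmod_mult, Cmod_Ci. lra.
  + eapply is_derive_path_continuous, is_derive_circle.
Qed.

Lemma arc_bounds t : Rmin (2 * PI / 3) (PI / 3) <= t <= Rmax (2 * PI / 3) (PI / 3) ->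
  PI / 3 <= t <= 2 * PI / 3.
Proof. pose proof PI_RGT_0. rewrite Rmin_right, Rmax_left; lra. Qed.

Lemma arc_integral_primitive g P : holomorphic_on_H g -> primitive_on_H P g ->
  cint (fun t => g (circle t) * (Ci * circle t))%C (2 * PI / 3) (PI / 3) =
  (P (circle (PI / 3)) - P (circle (2 * PI / 3)))%C.
Proof.
intros Hg HP. apply (path_integral_primitive P g circle (fun t => Ci * circle t)%C).
- exact HP.
- intros t Ht. apply arc_bounds in Ht. split; [now apply arc_in_H|apply is_derive_circle].
- apply arc_path_continuous; [exact Hg|]. intros t Ht. apply arc_bounds in Ht.
  pose proof PI_RGT_0. lra.
Qed.

(** One arc for every letter; passing a letter strips it from the future and applies it to the
    past. *)
Fixpoint arc_sum (f : C -> C) (W : list bool) (y x : R) : C :=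
  match W with
  | [] => 0
  | L :: W' => (arc_integral f y (word_act W x) + arc_sum f W' (letter_act L y) x)%C
  end.

Section CycleIntegral.
Variable f : C -> C.
Hypothesis f_holo : holomorphic_on_H f.
Hypothesis f_inv : forall A tau, mdet A = 1%Z -> upper_half_plane tau ->
  f (moebius A tau) = f tau.

Let rho2 := circle (2 * PI / 3).

Lemma rho2_H : upper_half_plane rho2.
Proof. apply arc_in_H. pose proof PI_RGT_0. lra. Qed.

(** For a first letter [L] the increment of [P] from [rho2] to its image splits at [L rho2]. The
    part up to [L rho2] is the arc; the rest is the increment of [P] composed with [L], a primitive
    for the shifted poles, over the remaining word. The first conclusion identifies the poles after
    all letters have been passed. *)
Lemma word_primitive W : forall P y x, 0 < y -> 0 < x ->
  primitive_on_H P (fixed_point_form f (- y) (word_act W x)) ->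
  primitive_on_H (fun z => P (moebius (word_mat W) z))
    (fixed_point_form f (- word_act (rev W) y) x) /\
  (P (moebius (word_mat W) rho2) - P rho2)%C = arc_sum f W y x.
Proof.
induction W as [|L W IH]; intros P y x Hy Hx HP.
- split.
  + intros tau Ht. apply (is_derive_ext (K := C_AbsRing) (V := C_NormedModule) P).
    * intros z. unfold word_mat; simpl. now rewrite moebius_mone.
    * now apply HP.
  + unfold word_mat; simpl. rewrite moebius_mone. ring.
- simpl in HP. assert (Hx' := word_act_pos W x Hx).
  assert (HP' := primitive_comp_letter f P L _ y f_inv Hx' Hy HP).
  destruct (IH _ _ _ (letter_act_pos L y Hy) Hx HP') as [IH1 IH2].
  split.
  + intros tau Ht. simpl rev. rewrite word_act_app. simpl word_act at 2.
    apply (is_derive_ext_loc (K := C_AbsRing) (V := C_NormedModule)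
      (fun z => P (moebius (letter_mat L) (moebius (word_mat W) z)))).
    * eapply filter_imp; [|exact (locally_H tau Ht)]. intros z Hz.
      now rewrite (proj2 (word_mat_H W z Hz)).
    * now apply IH1.
  + simpl arc_sum. rewrite <- IH2, (proj2 (word_mat_H W rho2 rho2_H)).
    unfold arc_integral.
    rewrite (arc_integral_primitive _ P); [|now apply holomorphic_fixed_point_form|exact HP].
    unfold rho2 at 4. rewrite circle_letter. unfold rho2. ring.
Qed.

Lemma word_integral W tau0 y x : 0 < y -> 0 < x -> word_act W x = x ->
  word_act (rev W) y = y -> upper_half_plane tau0 ->
  segment_integral (fixed_point_form f (- y) x) tau0 (moebius (word_mat W) tau0) =
  arc_sum f W y x.
Proof.
intros Hy Hx Ex Ey Ht.
assert (Hg := holomorphic_fixed_point_form f (- y) x f_holo).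
destruct (holomorphic_primitive _ Hg) as [P HP].
rewrite (segment_integral_primitive P) by (auto; now apply word_mat_H).
assert (HP' : primitive_on_H P (fixed_point_form f (- y) (word_act W x))) by now rewrite Ex.
destruct (word_primitive W P y x Hy Hx HP') as [H1 H2]. rewrite Ey in H1.
rewrite <- H2.
(* With both poles fixed by the word, [P] composed with the word is again a primitive of the same
   form, so its increment from [tau0] to its image does not depend on [tau0]. *)
assert (E := primitive_unique _ P _ rho2 tau0 Hg H1 HP rho2_H Ht). cbv beta in E.
match goal with |- ?u = ?v => replace u with ((P (moebius (word_mat W) tau0) - P (moebius (word_mat W) rho2))
  + (P (moebius (word_mat W) rho2) - P tau0))%C by ring end.
rewrite E. ring.
Qed.
End CycleIntegral.

(** * The real part of an arc integral as a kernel on the positive half-line *)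

Definition kernel (k x : R) : R := (x + / x) / ((x + / x) ^ 2 - k).

Definition arc_weight (f : C -> C) (t : R) : R := Re (f (circle t)) * sin t.

Definition arc_kernel (f : C -> C) (x : R) : R :=
  RInt (fun t => arc_weight f t * kernel (4 * cos t ^ 2) x) (PI / 3) (2 * PI / 3).

Lemma arc_cos t : PI / 3 <= t <= 2 * PI / 3 -> 0 <= 4 * cos t ^ 2 <= 1.
Proof.
intros H. pose proof PI_RGT_0.
assert (- (1 / 2) <= cos t <= 1 / 2); [|nra].
split.
- rewrite <- cos_PI3, <- Rtrigo_facts.cos_pi_minus. apply cos_decr_1; lra.
- rewrite <- cos_PI3. apply cos_decr_1; lra.
Qed.

Lemma plus_inv_ge_2 x : 0 < x -> 2 <= x + / x.
Proof.
intros H. apply Rmult_le_reg_r with x; [exact H|].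
replace ((x + / x) * x) with (x * x + 1) by (field; lra).
pose proof (Rle_0_sqr (x - 1)). unfold Rsqr in *. lra.
Qed.

Lemma kernel_denominator k x : 0 <= k <= 1 -> 0 < x -> 3 <= (x + / x) ^ 2 - k.
Proof. intros Hk Hx. pose proof (plus_inv_ge_2 x Hx) as H.
pose proof (Rmult_le_compat 2 _ 2 _ ltac:(lra) ltac:(lra) H H). simpl. lra. Qed.

Section ArcKernel.
Variable f : C -> C.
Hypothesis f_holo : holomorphic_on_H f.
Hypothesis f_inv : forall A tau, mdet A = 1%Z -> upper_half_plane tau ->
  f (moebius A tau) = f tau.
Hypothesis f_real : forall t, PI / 3 <= t <= 2 * PI / 3 -> Im (f (circle t)) = 0.

Lemma continuous_Re_arc t : PI / 3 <= t <= 2 * PI / 3 ->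
  continuous (fun s => Re (f (circle s))) t.
Proof.
intros Ht. apply (continuous_comp (fun s => f (circle s)) (fst : C_UniformSpace -> R_UniformSpace)).
- apply C_continuous_comp_path.
  + now apply ex_derive_C_continuous, f_holo, arc_in_H.
  + eapply is_derive_path_continuous, is_derive_circle.
- apply (continuous_fst (U := R_UniformSpace) (V := R_UniformSpace)).
Qed.

Lemma ex_RInt_arc (u : R -> R) :
  (forall t, PI / 3 <= t <= 2 * PI / 3 -> ex_derive u t) ->
  ex_RInt (fun t => Re (f (circle t)) * u t) (PI / 3) (2 * PI / 3).
Proof.
intros Hu. apply (ex_RInt_continuous (V := R_CompleteNormedModule)). intros t Ht.
pose proof PI_RGT_0. rewrite Rmin_left, Rmax_right in Ht by lra.
apply (continuous_mult (K := R_AbsRing)); [now apply continuous_Re_arc|].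
apply (ex_derive_continuous (V := R_NormedModule)). now apply Hu.
Qed.

(** The modular involution sending [tau] to [- 1 / tau] reflects the unit circle in the imaginary
    axis. *)
Lemma circle_reflection t : upper_half_plane (circle t) ->
  f (circle (PI - t)) = f (circle t).
Proof.
intros Ht. rewrite <- (f_inv (Mat 0 (-1) 1 0) (circle t)) by (reflexivity || exact Ht).
f_equal. unfold moebius, ZtoC, circle; simpl.
rewrite Rtrigo_facts.cos_pi_minus, Rtrigo_facts.sin_pi_minus.
change (cos t, sin t) with (circle t).
assert (N : circle t <> 0).
{ intros E. apply (H_neq_real (circle t) 0 Ht). rewrite E. ring. }
set (e := ((- cos t)%R, sin t) : C).
replace (0 * circle t + -1)%C with (e * circle t)%C.
- field. intros E. apply N. rewrite <- E. ring.
- pose proof (sin2_cos2 t) as S. unfold Rsqr in S.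
  apply injective_projections; simpl; lra.
Qed.

(** The squared distance from [x] to the point of the circle, [(x - c) ^ 2 + s ^ 2]. *)
Lemma circle_denominator x c s : s * s + c * c = 1 -> 0 < s -> 0 < 1 + x * x - 2 * x * c.
Proof.
intros H Hs. pose proof (Rle_0_sqr (x - c)). pose proof (Rmult_lt_0_compat s s Hs Hs).
unfold Rsqr in *. lra.
Qed.

(** The pole [x] gives the denominator with [c], the pole [- y] the one with [- c]. The overall
    minus sign is absorbed by the direction of the arc. *)
Lemma Re_arc_form (s c x y r : R) : s * s + c * c = 1 -> 0 < s ->
  Re ((r, 0) * (1 / ((c, s) - RtoC (- y)) - 1 / ((c, s) - RtoC x)) * (Ci * (c, s)))%C =
  - (r * (x * s / (1 + x * x - 2 * x * c)) + r * (y * s / (1 + y * y - 2 * y * - c))).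
Proof.
intros H Hs.
assert (Px := circle_denominator x c s H Hs).
assert (Py := circle_denominator y (- c) s ltac:(lra) Hs).
assert (Q : forall w, (c + - w) * ((c + - w) * 1) + (s + - 0) * ((s + - 0) * 1) = 1 + w * w - 2 * w * c).
{ intros w. lra. }
simpl. rewrite !Q.
replace (1 + - y * - y - 2 * - y * c) with (1 + y * y - 2 * y * - c) by ring.
set (X := 1 + x * x - 2 * x * c) in *. set (Y := 1 + y * y - 2 * y * - c) in *.
field. lra.
Qed.

(** With [s = x + / x] the integrands are [sin t / (s - 2 cos t)] and [sin t / (s + 2 cos t)] times
    [f]. The reflection of the arc exchanges them, so the two integrals agree, and their mean has
    the kernel [s / (s ^ 2 - 4 cos t ^ 2)]. *)
Lemma arc_kernel_half x : 0 < x ->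
  arc_kernel f x =
  RInt (fun t => Re (f (circle t)) * (x * sin t / (1 + x * x - 2 * x * cos t))) (PI / 3) (2 * PI / 3) /\
  arc_kernel f x =
  RInt (fun t => Re (f (circle t)) * (x * sin t / (1 + x * x - 2 * x * - cos t))) (PI / 3) (2 * PI / 3).
Proof.
intros Hx. pose proof PI_RGT_0 as HPI.
assert (D : forall t, PI / 3 <= t <= 2 * PI / 3 ->
  0 < 1 + x * x - 2 * x * cos t /\ 0 < 1 + x * x - 2 * x * - cos t /\ 0 < sin t).
{ intros t Ht. assert (S := sin2_cos2 t). unfold Rsqr in S.
  assert (0 < sin t) by (apply sin_gt_0; lra).
  repeat split; [| |assumption]; apply circle_denominator with (sin t); lra. }
assert (I1 : ex_RInt (fun t => Re (f (circle t)) * (x * sin t / (1 + x * x - 2 * x * cos t))) (PI / 3) (2 * PI / 3)).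
{ apply ex_RInt_arc. intros t Ht. destruct (D t Ht) as [D1 [D2 D3]]. auto_derive. lra. }
assert (I2 : ex_RInt (fun t => Re (f (circle t)) * (x * sin t / (1 + x * x - 2 * x * - cos t))) (PI / 3) (2 * PI / 3)).
{ apply ex_RInt_arc. intros t Ht. destruct (D t Ht) as [D1 [D2 D3]]. auto_derive. lra. }
assert (E : RInt (fun t => Re (f (circle t)) * (x * sin t / (1 + x * x - 2 * x * cos t))) (PI / 3) (2 * PI / 3) =
  RInt (fun t => Re (f (circle t)) * (x * sin t / (1 + x * x - 2 * x * - cos t))) (PI / 3) (2 * PI / 3)).
{ assert (C := RInt_comp_lin (fun t => Re (f (circle t)) * (x * sin t / (1 + x * x - 2 * x * cos t)))
    (-1) PI (PI / 3) (2 * PI / 3)).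
  replace (-1 * (PI / 3) + PI) with (2 * PI / 3) in C by field.
  replace (-1 * (2 * PI / 3) + PI) with (PI / 3) in C by field.
  specialize (C (ex_RInt_swap _ _ _ I1)).
  rewrite <- (opp_RInt_swap _ (PI / 3) (2 * PI / 3)) in C by exact I1.
  rewrite RInt_ext with (g := fun t => opp (Re (f (circle t)) * (x * sin t / (1 + x * x - 2 * x * - cos t)))) in C.
  - rewrite (RInt_opp (V := R_CompleteNormedModule)) in C by exact I2.
    unfold opp in C; simpl in C. lra.
  - intros t Ht. rewrite Rmin_left, Rmax_right in Ht by lra.
    replace (-1 * t + PI) with (PI - t) by ring.
    rewrite circle_reflection by (apply arc_in_H; lra).
    rewrite Rtrigo_facts.cos_pi_minus, Rtrigo_facts.sin_pi_minus.
    unfold scal, opp; simpl. unfold mult; simpl. ring. }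
assert (S : 2 * arc_kernel f x =
  RInt (fun t => Re (f (circle t)) * (x * sin t / (1 + x * x - 2 * x * cos t))) (PI / 3) (2 * PI / 3) +
  RInt (fun t => Re (f (circle t)) * (x * sin t / (1 + x * x - 2 * x * - cos t))) (PI / 3) (2 * PI / 3)).
{ rewrite <- (RInt_plus (V := R_CompleteNormedModule)) by assumption.
  unfold arc_kernel. rewrite <- (RInt_scal (V := R_CompleteNormedModule)).
  - apply (RInt_ext (V := R_CompleteNormedModule)). intros t Ht.
    rewrite Rmin_left, Rmax_right in Ht by lra.
    destruct (D t ltac:(lra)) as [D1 [D2 D3]].
    assert (K := kernel_denominator (4 * cos t ^ 2) x (arc_cos t ltac:(lra)) Hx).
    unfold arc_weight, kernel, scal, plus; simpl. unfold mult; simpl.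
    assert (P := Rmult_lt_0_compat _ _ D1 D2).
    field. repeat split; lra.
  - apply (ex_RInt_ext (V := R_NormedModule) (fun t => Re (f (circle t)) * (sin t * kernel (4 * cos t ^ 2) x))).
    { intros t _. unfold arc_weight. symmetry. apply Rmult_assoc. }
    apply ex_RInt_arc. intros t Ht.
    assert (K := kernel_denominator (4 * cos t ^ 2) x (arc_cos t Ht) Hx).
    unfold kernel. auto_derive. repeat split; lra. }
split; lra.
Qed.

(** Future and past enter through the two different denominators, but by [arc_kernel_half] both
    integrate to the same function. *)
Lemma Re_arc_integral x y : 0 < x -> 0 < y ->
  Re (arc_integral f y x) = arc_kernel f x + arc_kernel f y.
Proof.
intros Hx Hy. pose proof PI_RGT_0 as HPI.
unfold arc_integral.
assert (Hc : path_continuous (fun t => fixed_point_form f (- y) x (circle t) * (Ci * circle t))%C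
  (PI / 3) (2 * PI / 3)).
{ apply arc_path_continuous; [now apply holomorphic_fixed_point_form|].
  intros t Ht. rewrite Rmin_left, Rmax_right in Ht; lra. }
rewrite cint_swap by exact Hc.
assert (I := is_RInt_fct_extend_fst _ _ _ _ (cint_correct _ _ _ Hc)).
match goal with |- Re (- ?z)%C = _ => change (Re (- z)%C) with (- Re z);
  replace (Re z) with (RInt (fun t => Re (fixed_point_form f (- y) x (circle t) * (Ci * circle t))%C)
    (PI / 3) (2 * PI / 3)) by exact (is_RInt_unique _ _ _ _ I) end.
rewrite (proj1 (arc_kernel_half x Hx)), (proj2 (arc_kernel_half y Hy)).
assert (D : forall z t, PI / 3 <= t <= 2 * PI / 3 ->
  0 < 1 + z * z - 2 * z * cos t /\ 0 < 1 + z * z - 2 * z * - cos t /\ 0 < sin t).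
{ intros z t Ht. assert (S := sin2_cos2 t). unfold Rsqr in S.
  assert (0 < sin t) by (apply sin_gt_0; lra).
  repeat split; [| |assumption]; apply circle_denominator with (sin t); lra. }
rewrite <- (RInt_plus (V := R_CompleteNormedModule)).
2:{ apply ex_RInt_arc. intros t Ht. destruct (D x t Ht) as [D1 [D2 D3]]. auto_derive. lra. }
2:{ apply ex_RInt_arc. intros t Ht. destruct (D y t Ht) as [D1 [D2 D3]]. auto_derive. lra. }
rewrite <- (RInt_opp (V := R_CompleteNormedModule)).
2:{ eexists. exact I. }
apply (RInt_ext (V := R_CompleteNormedModule)). intros t Ht.
rewrite Rmin_left, Rmax_right in Ht by lra.
assert (Hf := f_real t ltac:(lra)).
destruct (D x t ltac:(lra)) as [D1 [D2 D3]].
assert (E := Re_arc_form (sin t) (cos t) x y (Re (f (circle t)))).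
assert (S := sin2_cos2 t). unfold Rsqr in S. specialize (E S D3).
assert (Hf' : f (circle t) = (Re (f (circle t)), 0))
  by (rewrite <- Hf; destruct (f (circle t)); reflexivity).
assert (E' : Re (fixed_point_form f (- y) x (circle t) * (Ci * circle t))%C = - (
  Re (f (circle t)) * (x * sin t / (1 + x * x - 2 * x * cos t)) +
  Re (f (circle t)) * (y * sin t / (1 + y * y - 2 * y * - cos t)))).
{ rewrite <- E. unfold fixed_point_form. rewrite Hf' at 1. reflexivity. }
match goal with |- opp ?u = plus ?v ?w => change (- u = v + w) end.
rewrite E'. ring.
Qed.
End ArcKernel.

(** * Fixed points and cycle integrals of words *)

Fixpoint word_sum (F : R -> R) (W : list bool) (z : R) : R :=
  match W with
  | [] => 0
  | L :: W' => F (word_act W z) + word_sum F W' z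
  end.

Lemma word_sum_app F W W' z :
  word_sum F (W ++ W') z = word_sum F W (word_act W' z) + word_sum F W' z.
Proof.
induction W as [|L W IH]; simpl; [ring|].
rewrite IH, word_act_app. ring.
Qed.

Fixpoint word_backward_sum (F : R -> R) (W : list bool) (y : R) : R :=
  match W with
  | [] => 0
  | L :: W' => F y + word_backward_sum F W' (letter_act L y)
  end.

(** The backward sum contains the starting point [y] and omits the final one, the sum over [rev W]
    does the opposite; for a fixed point of [rev W] they coincide. *)
Lemma word_backward_sum_rev F W y :
  word_backward_sum F W y + F (word_act (rev W) y) = word_sum F (rev W) y + F y.
Proof.
revert y. induction W as [|L W IH]; intros y; simpl; [ring|].
rewrite word_sum_app, word_act_app. simpl. specialize (IH (letter_act L y)). lra.
Qed.

Lemma Re_arc_sum f W y x : holomorphic_on_H f ->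
  (forall A tau, mdet A = 1%Z -> upper_half_plane tau -> f (moebius A tau) = f tau) ->
  (forall t, PI / 3 <= t <= 2 * PI / 3 -> Im (f (circle t)) = 0) ->
  0 < x -> 0 < y ->
  Re (arc_sum f W y x) = word_sum (arc_kernel f) W x + word_backward_sum (arc_kernel f) W y.
Proof.
intros Hf Hinv Hreal Hx. revert y. induction W as [|L W IH]; intros y Hy;
  cbn [arc_sum word_sum word_backward_sum]; [simpl; ring|].
specialize (IH _ (letter_act_pos L y Hy)).
match goal with |- Re (?u + ?v)%C = _ => change (Re (u + v)%C) with (Re u + Re v) end.
rewrite IH, Re_arc_integral; auto using word_act_pos. ring.
Qed.

Lemma word_mat_nonneg W : let A := word_mat W in
  (1 <= ma A /\ 0 <= mb A /\ 0 <= mc A /\ 1 <= md A)%Z.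
Proof.
induction W as [|L W IH]; [simpl; lia|].
change (word_mat (L :: W)) with (mmul (letter_mat L) (word_mat W)).
destruct L; unfold letter_mat, mmul, matT, matV; cbn [ma mb mc md] in *; lia.
Qed.

Lemma word_act_mat W z : 0 < z -> let A := word_mat W in
  word_act W z = (IZR (ma A) * z + IZR (mb A)) / (IZR (mc A) * z + IZR (md A)).
Proof.
intros Hz. induction W as [|L W IH]; [simpl; field|].
cbn zeta in *. change (word_act (L :: W) z) with (letter_act L (word_act W z)).
change (word_mat (L :: W)) with (mmul (letter_mat L) (word_mat W)). rewrite IH.
destruct (word_mat_nonneg W) as [Pa [Pb [Pc Pd]]]. set (A := word_mat W) in *.
apply IZR_le in Pa, Pb, Pc, Pd.
assert (0 < IZR (mc A) * z + IZR (md A)) by (assert (0 <= IZR (mc A) * z) by (apply Rmult_le_pos; lra); lra).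
assert (0 < IZR (ma A) * z + IZR (mb A)) by (assert (0 < IZR (ma A) * z) by (apply Rmult_lt_0_compat; lra); lra).
destruct L; unfold letter_mat, mmul, matT, matV; cbn [ma mb mc md letter_act];
  rewrite !plus_IZR, !mult_IZR; field; repeat split; lra.
Qed.

(** Exchanging the two diagonal entries is an anti-automorphism of matrices which fixes T and V, so
    it reverses words. Consequently a positive fixed point [y] of [rev W] makes [- y] the other
    fixed point of [W]. *)
Lemma word_act_rev_mat W y : 0 < y -> let A := word_mat W in
  word_act (rev W) y = (IZR (md A) * y + IZR (mb A)) / (IZR (mc A) * y + IZR (ma A)).
Proof.
revert y. induction W as [|L W IH]; intros y Hy; [simpl; field|].
cbn zeta in *. change (rev (L :: W)) with (rev W ++ [L]). rewrite word_act_app.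
change (word_act [L] y) with (letter_act L y). rewrite (IH _ (letter_act_pos L y Hy)).
change (word_mat (L :: W)) with (mmul (letter_mat L) (word_mat W)).
destruct (word_mat_nonneg W) as [Pa [Pb [Pc Pd]]]. set (A := word_mat W) in *.
apply IZR_le in Pa, Pb, Pc, Pd.
assert (0 <= IZR (mc A) * y) by (apply Rmult_le_pos; lra).
assert (0 <= IZR (ma A) * y) by (apply Rmult_le_pos; lra).
assert (0 <= IZR (md A) * y) by (apply Rmult_le_pos; lra).
destruct L; unfold letter_mat, mmul, matT, matV; cbn [ma mb mc md letter_act];
  rewrite !plus_IZR, !mult_IZR; field; repeat split; lra.
Qed.

Section Hyperbolic.
Variables a b c d : R.
Hypothesis Ha : 1 <= a.
Hypothesis Hb : 0 < b.
Hypothesis Hc : 0 < c.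
Hypothesis Hd : 1 <= d.
Hypothesis Hdet : a * d - b * c = 1.

Lemma positive_fixed_point_quadratic z : 0 < z ->
  ((a * z + b) / (c * z + d) = z <-> c * z * z + (d - a) * z - b = 0).
Proof.
intros Hz. assert (0 < c * z) by now apply Rmult_lt_0_compat. split; intros E.
- apply (f_equal (fun u => u * (c * z + d))) in E.
  replace ((a * z + b) / (c * z + d) * (c * z + d)) with (a * z + b) in E by (field; lra). lra.
- apply Rmult_eq_reg_r with (c * z + d); [|lra].
  replace ((a * z + b) / (c * z + d) * (c * z + d)) with (a * z + b) by (field; lra). lra.
Qed.

Lemma positive_fixed_point_exists : exists z, 0 < z /\ (a * z + b) / (c * z + d) = z.
Proof.
set (D := (a - d) * (a - d) + 4 * (b * c)).
assert (Hbc : 0 < b * c) by now apply Rmult_lt_0_compat.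
assert (HD : 0 <= D) by (unfold D; pose proof (Rle_0_sqr (a - d)); unfold Rsqr in *; lra).
pose proof (sqrt_sqrt D HD) as S. pose proof (sqrt_pos D) as S0.
assert (Hpos : 0 < (a - d) + sqrt D).
{ destruct (Rlt_dec 0 ((a - d) + sqrt D)) as [|N]; [assumption|exfalso].
  assert (sqrt D * sqrt D <= (d - a) * (d - a)) by (apply Rmult_le_compat; lra).
  unfold D in *. lra. }
exists (((a - d) + sqrt D) / (2 * c)).
assert (0 < ((a - d) + sqrt D) / (2 * c)) by (apply Rdiv_lt_0_compat; lra).
split; [assumption|]. apply positive_fixed_point_quadratic; [assumption|].
apply Rmult_eq_reg_r with (4 * c); [|lra].
replace ((c * ((a - d + sqrt D) / (2 * c)) * ((a - d + sqrt D) / (2 * c)) +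
  (d - a) * ((a - d + sqrt D) / (2 * c)) - b) * (4 * c))
  with (sqrt D * sqrt D - (a - d) * (a - d) - 4 * (b * c)) by (field; lra).
rewrite S. unfold D. ring.
Qed.

Variables x y : R.
Hypothesis Hx : 0 < x.
Hypothesis Hy : 0 < y.
Hypothesis Ex : c * x * x + (d - a) * x - b = 0.
Hypothesis Ey : c * y * y + (a - d) * y - b = 0.

Lemma fixed_points_sum : c * (x - y) = a - d.
Proof.
apply Rmult_eq_reg_r with (x + y); [|lra].
replace (c * (x - y) * (x + y)) with (c * x * x - c * y * y) by ring. lra.
Qed.

Lemma fixed_points_product : c * (x * y) = b.
Proof.
assert (S := fixed_points_sum).
assert (c * x * x - x * (c * (x - y)) - b = 0) by (rewrite S; lra). lra.
Qed.

(** The factors are the eigenvalues belonging to the eigenvectors [(x, 1)] and [(- y, 1)]. *)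
Lemma hyperbolic_multiplier : (c * x + d) * (d - c * y) = 1.
Proof.
assert (S := fixed_points_sum). assert (P := fixed_points_product).
replace ((c * x + d) * (d - c * y)) with (d * (c * (x - y)) + d * d - c * (c * (x * y))) by ring.
rewrite S, P. lra.
Qed.

Lemma multiplier_bounds : 1 < c * x + d /\ 0 < d - c * y < 1.
Proof.
assert (1 < c * x + d) by (pose proof (Rmult_lt_0_compat c x Hc Hx); lra).
assert (E := hyperbolic_multiplier).
assert (d - c * y = / (c * x + d)).
{ apply Rmult_eq_reg_l with (c * x + d); [|lra]. rewrite E. field. lra. }
split; [assumption|]. rewrite H0. split; [apply Rinv_0_lt_compat; lra|].
rewrite <- Rinv_1. apply Rinv_lt_contravar; lra.
Qed.

Lemma quadratic_roots z : c * z * z + (d - a) * z - b = 0 -> z = x \/ z = - y.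
Proof.
intros E. assert (S := fixed_points_sum). assert (P := fixed_points_product).
assert (Q : c * ((z - x) * (z + y)) = 0).
{ replace (c * ((z - x) * (z + y))) with (c * z * z - z * (c * (x - y)) - c * (x * y)) by ring.
  rewrite S, P. lra. }
apply Rmult_integral in Q. destruct Q as [Q|Q]; [lra|].
apply Rmult_integral in Q. lra.
Qed.
End Hyperbolic.

Lemma is_derive_moebiusR A z : IZR (mc A) * z + IZR (md A) <> 0 -> mdet A = 1%Z ->
  Derive (moebiusR A) z = / ((IZR (mc A) * z + IZR (md A)) * (IZR (mc A) * z + IZR (md A))).
Proof.
intros N Hdet. apply is_derive_unique. unfold moebiusR. auto_derive; [exact N|].
unfold mdet in Hdet. apply (f_equal IZR) in Hdet. rewrite minus_IZR, !mult_IZR in Hdet.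
apply Rmult_eq_reg_r with ((IZR (mc A) * z + IZR (md A)) * (IZR (mc A) * z + IZR (md A))).
2:{ now apply Rmult_integral_contrapositive_currified. }
transitivity (IZR (ma A) * IZR (md A) - IZR (mb A) * IZR (mc A)); [field; exact N|].
rewrite Hdet. field. exact N.
Qed.

Section FixedForm.
Variable A : mat2.
Hypothesis Ha : (1 <= ma A)%Z.
Hypothesis Hb : (0 < mb A)%Z.
Hypothesis Hc : (0 < mc A)%Z.
Hypothesis Hd : (1 <= md A)%Z.
Hypothesis Hdet : mdet A = 1%Z.
Variables x y : R.
Hypothesis Hx : 0 < x.
Hypothesis Hy : 0 < y.
Let a := IZR (ma A).
Let b := IZR (mb A).
Let c := IZR (mc A).
Let d := IZR (md A).
Hypothesis Ex : c * x * x + (d - a) * x - b = 0.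
Hypothesis Ey : c * y * y + (a - d) * y - b = 0.

Lemma real_entries : 1 <= a /\ 0 < b /\ 0 < c /\ 1 <= d /\ a * d - b * c = 1.
Proof.
unfold a, b, c, d. rewrite <- !mult_IZR, <- minus_IZR.
unfold mdet in Hdet. rewrite Hdet.
repeat split; [apply (IZR_le 1)|apply (IZR_lt 0)|apply (IZR_lt 0)|apply (IZR_le 1)]; assumption.
Qed.

Lemma multipliers : 1 < c * x + d /\ 0 < d - c * y < 1.
Proof.
destruct real_entries as [H1 [H2 [H3 [H4 H5]]]].
now apply (multiplier_bounds a b c d).
Qed.

Lemma attracting_positive : attracting_fixed_point A x.
Proof.
destruct multipliers as [M _]. split.
- destruct real_entries as [H1 [H2 [H3 [H4 H5]]]].
  now apply (positive_fixed_point_quadratic a b c d).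
- rewrite is_derive_moebiusR by (fold c d; (lra || exact Hdet)). fold c d.
  assert (1 < (c * x + d) * (c * x + d)).
  { pose proof (Rmult_gt_0_lt_compat 1 (c * x + d) 1 (c * x + d)). lra. }
  rewrite Rabs_pos_eq by (left; apply Rinv_0_lt_compat; lra).
  rewrite <- Rinv_1. apply Rinv_lt_contravar; lra.
Qed.

Lemma repelling_negative : repelling_fixed_point A (- y).
Proof.
destruct multipliers as [_ M]. split.
- unfold moebiusR. fold a b c d.
  apply Rmult_eq_reg_r with (c * - y + d); [|lra].
  replace ((a * - y + b) / (c * - y + d) * (c * - y + d)) with (a * - y + b) by (field; lra). lra.
- rewrite is_derive_moebiusR by (fold c d; (lra || exact Hdet)). fold c d.
  replace (c * - y + d) with (d - c * y) by ring.
  assert (0 < (d - c * y) * (d - c * y) < 1).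
  { split; [apply Rmult_lt_0_compat; lra|].
    pose proof (Rmult_le_compat (d - c * y) 1 (d - c * y) (d - c * y)). lra. }
  rewrite Rabs_pos_eq by (left; apply Rinv_0_lt_compat; lra).
  rewrite <- Rinv_1 at 1. apply Rinv_lt_contravar; lra.
Qed.

Lemma fixed_point_cases z : moebiusR A z = z -> z = x \/ z = - y.
Proof.
intros E. destruct real_entries as [H1 [H2 [H3 [H4 H5]]]].
apply (quadratic_roots a b c d); auto.
unfold moebiusR in E. fold a b c d in E.
destruct (Req_dec (c * z + d) 0) as [Z|Z].
- exfalso. unfold Rdiv in E. rewrite Z, Rinv_0, Rmult_0_r in E. subst z. lra.
- apply (f_equal (fun u => u * (c * z + d))) in E.
  replace ((a * z + b) / (c * z + d) * (c * z + d)) with (a * z + b) in E by (field; lra). lra.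
Qed.

Lemma repelling_fixed_point_unique z : repelling_fixed_point A z -> z = - y.
Proof.
intros [E D]. destruct (fixed_point_cases z E) as [->|]; [|assumption].
destruct attracting_positive as [_ D']. lra.
Qed.

Lemma attracting_fixed_point_unique z : attracting_fixed_point A z -> z = x.
Proof.
intros [E D]. destruct (fixed_point_cases z E) as [ | -> ]; [assumption|].
destruct repelling_negative as [_ D']. lra.
Qed.

Lemma form_eval_real (p q r : Z) (z : R) :
  form_eval (p, q, r) z 1 = RtoC (IZR p * z * z + IZR q * z + IZR r).
Proof. unfold form_eval, ZtoC. rewrite !RtoC_plus, !RtoC_mult. ring. Qed.

Lemma fixed_form_exists : exists Q, is_fixed_form A Q.
Proof.
set (g := Z.gcd (Z.gcd (mc A) (md A - ma A)) (mb A)).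
assert (Hg : (0 < g)%Z).
{ assert (0 <= g)%Z by apply Z.gcd_nonneg. assert (g <> 0)%Z; [|lia].
  unfold g. intros E. apply Z.gcd_eq_0_r in E. lia. }
assert (D1 : (g | mc A)%Z).
{ eapply Z.divide_trans; [apply Z.gcd_divide_l|apply Z.gcd_divide_l]. }
assert (D2 : (g | md A - ma A)%Z).
{ eapply Z.divide_trans; [apply Z.gcd_divide_l|apply Z.gcd_divide_r]. }
assert (D3 : (g | mb A)%Z) by apply Z.gcd_divide_r.
destruct D1 as [p Hp], D2 as [q Hq], D3 as [r Hr].
assert (Hgcd : Z.gcd (Z.gcd p q) r = 1%Z).
{ assert (E : (g * Z.gcd (Z.gcd p q) r = g * 1)%Z).
  { unfold g at 2. rewrite Hp, Hq, Hr, !Z.gcd_mul_mono_r_nonneg by lia. ring. }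
  nia. }
assert (Hp0 : (0 < p)%Z) by nia.
(* The fixed point equation divided by its content, with negative leading coefficient because the
   repelling point [- y] lies below the attracting point [x]. *)
exists (- p, - q, r)%Z. split; [now rewrite Z.gcd_opp_l, Z.gcd_opp_r|].
exists (- y), x. split; [exact repelling_negative|]. split; [exact attracting_positive|].
assert (HgR := IZR_lt _ _ Hg).
apply (f_equal IZR) in Hp, Hq, Hr. rewrite minus_IZR in Hq. rewrite mult_IZR in *.
fold c in Hp. fold a d in Hq. fold b in Hr.
rewrite Hp, Hr in Ex, Ey.
rewrite !form_eval_real, !opp_IZR. repeat split.
- f_equal. apply Rmult_eq_reg_r with (IZR g); [|lra].
  replace ((- IZR p * - y * - y + - IZR q * - y + IZR r) * IZR g) with
    (- (IZR p * IZR g * y * y - IZR q * IZR g * y - IZR r * IZR g)) by ring.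
  rewrite <- Hq. lra.
- f_equal. apply Rmult_eq_reg_r with (IZR g); [|lra].
  replace ((- IZR p * x * x + - IZR q * x + IZR r) * IZR g) with
    (- (IZR p * IZR g * x * x + IZR q * IZR g * x - IZR r * IZR g)) by ring.
  rewrite <- Hq. lra.
- apply IZR_lt in Hp0. rewrite !sign_eq_m1; lra.
Qed.

(** The two roots and the sign of the leading coefficient determine the chosen form up to a positive
    factor, and this factor cancels between [sqrt D] and the form. *)
Lemma fixed_form_integrand tau : upper_half_plane tau ->
  (RtoC (sqrt (IZR (form_disc (fixed_form A)))) / form_eval (fixed_form A) tau 1)%C =
  (1 / (tau - RtoC (- y)) - 1 / (tau - RtoC x))%C.
Proof.
intros Ht. assert (H := epsilon_spec (inhabits (0, 0, 0)%Z) _ fixed_form_exists).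
fold (fixed_form A) in H. destruct (fixed_form A) as [[p q] r].
destruct H as [_ [w [w' [H1 [H2 [H3 [H4 H5]]]]]]].
apply repelling_fixed_point_unique in H1. apply attracting_fixed_point_unique in H2. subst w w'.
rewrite form_eval_real in H3, H4. apply RtoC_inj in H3, H4.
assert (Hp : IZR p < 0).
{ rewrite (sign_eq_m1 (- y - x)) in H5 by lra.
  destruct (Rtotal_order (IZR p) 0) as [|[E|G]]; [assumption| |].
  - rewrite E, sign_0 in H5. lra.
  - rewrite sign_eq_1 in H5; lra. }
assert (Hq : IZR q = - IZR p * (x - y)).
{ apply Rmult_eq_reg_r with (x + y); [|lra]. lra. }
assert (Hr : IZR r = - (IZR p * (x * y))).
{ rewrite Hq in H4. lra. }
assert (ED : sqrt (IZR (form_disc (p, q, r))) = - IZR p * (x + y)).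
{ unfold form_disc. rewrite minus_IZR, !mult_IZR, Hq, Hr.
  match goal with |- sqrt ?u = _ => replace u with ((- IZR p * (x + y)) * (- IZR p * (x + y))) by ring end.
  apply sqrt_square. apply Rmult_le_pos; lra. }
rewrite ED. unfold form_eval, ZtoC. rewrite Hq, Hr.
assert (N1 := H_neq_real tau x Ht). assert (N2 := H_neq_real tau (- y) Ht).
assert (Np : RtoC (IZR p) <> 0) by (intros E; apply RtoC_inj in E; lra).
repeat rewrite ?RtoC_mult, ?RtoC_plus, ?RtoC_minus, ?RtoC_opp in *.
replace (IZR p * (tau * tau) + - IZR p * (x - y) * (tau * 1) + - (IZR p * (x * y)) * (1 * 1))%C
  with (IZR p * ((tau - x) * (tau - - y)))%C by ring.
field. repeat split; assumption.
Qed.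
End FixedForm.

(** Diagonal entries at least 1 with sum above 2 have a product of at least 2, and determinant 1
    then makes the product of the other two entries positive. *)
Lemma hyperbolic_word_entries W : hyperbolic (word_mat W) ->
  let A := word_mat W in (1 <= ma A /\ 0 < mb A /\ 0 < mc A /\ 1 <= md A)%Z.
Proof.
intros H. destruct (word_mat_nonneg W) as [P1 [P2 [P3 P4]]]. cbn zeta.
assert (D := mdet_word W). unfold mdet, hyperbolic, mtr in *.
set (A := word_mat W) in *. rewrite Z.abs_eq in H by lia.
assert (2 <= ma A * md A)%Z by nia.
assert (0 < mb A * mc A)%Z by lia. nia.
Qed.

Lemma word_fixed_points W : hyperbolic (word_mat W) ->
  exists x, 0 < x /\ word_act W x = x.
Proof.
intros H. destruct (hyperbolic_word_entries W H) as [P1 [P2 [P3 P4]]].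
destruct (positive_fixed_point_exists (IZR (ma (word_mat W))) (IZR (mb (word_mat W)))
  (IZR (mc (word_mat W))) (IZR (md (word_mat W)))
  (IZR_lt _ _ P2) (IZR_lt _ _ P3) (IZR_le _ _ P4)) as [x [Hx E]].
exists x. split; [exact Hx|]. now rewrite word_act_mat.
Qed.

(** The roots of the fixed point equation have opposite signs; eliminating the linear term between
    the two equations shows it. *)
Lemma word_fixed_point_unique W x x' : hyperbolic (word_mat W) ->
  0 < x -> 0 < x' -> word_act W x = x -> word_act W x' = x' -> x = x'.
Proof.
intros H Hx Hx' E E'. destruct (hyperbolic_word_entries W H) as [P1 [P2 [P3 P4]]].
rewrite word_act_mat in E, E' by assumption.
apply IZR_le in P1, P4. apply IZR_lt in P2, P3.
apply positive_fixed_point_quadratic in E, E'; try assumption.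
assert (Q : (x - x') * (IZR (mc (word_mat W)) * x * x' + IZR (mb (word_mat W))) = 0).
{ set (c := IZR (mc (word_mat W))) in *. set (b := IZR (mb (word_mat W))) in *.
  set (e := IZR (md (word_mat W)) - IZR (ma (word_mat W))) in *.
  replace ((x - x') * (c * x * x' + b)) with
    (x' * (c * x * x + e * x - b) - x * (c * x' * x' + e * x' - b)) by ring.
  rewrite E, E'. ring. }
apply Rmult_integral in Q. destruct Q as [Q|Q]; [lra|].
assert (0 < IZR (mc (word_mat W)) * x * x') by (repeat apply Rmult_lt_0_compat; assumption). lra.
Qed.

Lemma hyperbolic_rev W : hyperbolic (word_mat W) -> exists y, 0 < y /\ word_act (rev W) y = y.
Proof.
intros H. destruct (hyperbolic_word_entries W H) as [P1 [P2 [P3 P4]]].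
destruct (positive_fixed_point_exists (IZR (md (word_mat W))) (IZR (mb (word_mat W)))
  (IZR (mc (word_mat W))) (IZR (ma (word_mat W)))
  (IZR_lt _ _ P2) (IZR_lt _ _ P3) (IZR_le _ _ P1)) as [y [Hy E]].
exists y. split; [exact Hy|]. now rewrite word_act_rev_mat.
Qed.

Lemma Re_cycle_integral f W tau0 x y : holomorphic_on_H f ->
  (forall A tau, mdet A = 1%Z -> upper_half_plane tau -> f (moebius A tau) = f tau) ->
  (forall t, PI / 3 <= t <= 2 * PI / 3 -> Im (f (circle t)) = 0) ->
  upper_half_plane tau0 -> hyperbolic (word_mat W) ->
  0 < x -> 0 < y -> word_act W x = x -> word_act (rev W) y = y ->
  Re (cycle_integral f tau0 (word_mat W)) =
  word_sum (arc_kernel f) W x + word_sum (arc_kernel f) (rev W) y.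
Proof.
intros Hf Hinv Hreal Ht Hh Hx Hy Ex Ey.
unfold cycle_integral. destruct excluded_middle_informative as [_|N]; [|contradiction].
assert (HA := hyperbolic_word_entries W Hh). cbn zeta in HA. destruct HA as [P1 [P2 [P3 P4]]].
assert (Q1 := Ex). assert (Q2 := Ey).
rewrite word_act_mat in Q1 by exact Hx. rewrite word_act_rev_mat in Q2 by exact Hy.
assert (R1 := IZR_le _ _ P1). assert (R2 := IZR_lt _ _ P2).
assert (R3 := IZR_lt _ _ P3). assert (R4 := IZR_le _ _ P4).
apply positive_fixed_point_quadratic in Q1, Q2; try assumption.
assert (Ht' := proj1 (word_mat_H W tau0 Ht)).
replace (segment_integral _ _ _) with
  (segment_integral (fixed_point_form f (- y) x) tau0 (moebius (word_mat W) tau0)).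
- rewrite (word_integral f Hf Hinv) by assumption.
  rewrite Re_arc_sum by assumption.
  assert (B := word_backward_sum_rev (arc_kernel f) W y). rewrite Ey in B. lra.
- apply (RInt_ext (V := C_R_CompleteNormedModule)). intros t Hts.
  rewrite Rmin_left, Rmax_right in Hts by lra. f_equal.
  set (z := (tau0 + t * (moebius (word_mat W) tau0 - tau0))%C).
  assert (Hz : upper_half_plane z) by (apply segment_in_H; (assumption || lra)).
  unfold fixed_point_form.
  rewrite <- (fixed_form_integrand (word_mat W) P1 P2 P3 P4 (mdet_word W) x y Hx Hy Q1 Q2 z Hz).
  unfold Cdiv. ring.
Qed.

(** * A modular function vanishing on the arc vanishes *)

(** The function [exp (i k z)]. The value [k = 2 pi] gives [nome], the value [- 2 pi] its
    inverse. *)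
Definition cexp (k : R) (z : C) : C :=
  (RtoC (exp (- (k * Im z))) * circle (k * Re z))%C.

Lemma is_derive_real_eps (g : R -> R) (t l : R) : is_derive g t l ->
  forall eps, 0 < eps -> exists delta, 0 < delta /\ forall s,
    Rabs (s - t) < delta -> Rabs (g s - g t - l * (s - t)) <= eps * Rabs (s - t).
Proof.
intros [_ H] eps Heps.
destruct (H t (fun P HP => HP) (mkposreal _ Heps)) as [d Hd].
exists d. split; [apply cond_pos|]. intros s Hs. specialize (Hd s Hs).
change (Rabs ((g s - g t) - (s - t) * l) <= eps * Rabs (s - t)) in Hd.
now rewrite (Rmult_comm l).
Qed.

Lemma Cmod_circle t : Cmod (circle t) = 1.
Proof.
unfold Cmod, circle; simpl. pose proof (sin2_cos2 t) as S. unfold Rsqr in S.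
transitivity (sqrt 1); [f_equal; lra|apply sqrt_1].
Qed.

Lemma Rabs_Re_Im_le z : Rabs (Re z) <= Cmod z /\ Rabs (Im z) <= Cmod z.
Proof.
pose proof (Rmax_Cmod z). pose proof (Rmax_l (Rabs (fst z)) (Rabs (snd z))).
pose proof (Rmax_r (Rabs (fst z)) (Rabs (snd z))). unfold Re, Im. lra.
Qed.

(** The function is a product of a factor in [Re z] and a factor in [Im z]. Three error terms take a
    third of [eps] each, and [Ci * Ci = -1] merges the two partial derivatives into one complex
    derivative. *)
Lemma is_derive_cexp k z :
  is_derive (K := C_AbsRing) (V := C_NormedModule) (cexp k) z (Ci * RtoC k * cexp k z)%C.
Proof.
apply is_derive_C_eps. intros eps Heps.
set (a := Re z). set (b := Im z).
set (v := fun s => exp (- (k * s))).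
assert (DU : is_derive (V := C_R_NormedModule) (fun s => circle (k * s)) a (Ci * RtoC k * circle (k * a))%C).
{ apply (filterdiff_ext_lin (V := C_R_NormedModule) _ (fun y : R => scal (V := C_R_NormedModule) y (scal (V := C_R_NormedModule) k (Ci * circle (k * a))%C))).
  - apply (is_derive_comp (V := C_R_NormedModule) circle (fun s => k * s)); [apply is_derive_circle|].
    auto_derive; [trivial|ring].
  - intros y. unfold scal; simpl. unfold prod_scal, scal; simpl. unfold mult; simpl.
    apply injective_projections; simpl; ring. }
assert (DV : is_derive v b (- k * v b)) by (unfold v; auto_derive; [trivial|ring]).
set (V := v b). assert (HV : 0 < V) by apply exp_pos.
set (K := Rabs k + 1). assert (HK : 0 < K) by (pose proof (Rabs_pos k); unfold K; lra).
assert (CV : continuous v b) by (apply (ex_derive_continuous (V := R_NormedModule)); now eexists; exact DV).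
destruct (proj1 (is_derive_path_eps _ _ _) DU (eps / (3 * (V + 1)))) as [d1 [Hd1 H1]].
{ apply Rdiv_lt_0_compat; lra. }
destruct (is_derive_real_eps v b _ DV (eps / 3) ltac:(lra)) as [d2 [Hd2 H2]].
assert (He : 0 < Rmin 1 (eps / (3 * K))) by (apply Rmin_pos; [lra|apply Rdiv_lt_0_compat; lra]).
destruct (CV (ball (v b) (mkposreal _ He)) (locally_ball _ _)) as [d3 H3].
exists (Rmin (Rmin d1 d2) d3). split; [repeat apply Rmin_pos; try assumption; apply cond_pos|].
intros z' Hz'. set (h := (z' - z)%C) in *.
assert (Hh1 := Rlt_le_trans _ _ _ Hz' (Rmin_l _ _)).
assert (Hh3 := Rlt_le_trans _ _ _ Hz' (Rmin_r _ _)).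
assert (Hh2 := Rlt_le_trans _ _ _ Hh1 (Rmin_r _ _)).
apply (fun u => Rlt_le_trans _ _ _ u (Rmin_l _ _)) in Hh1.
destruct (Rabs_Re_Im_le h) as [Ra Rb].
set (a' := Re z'). set (b' := Im z').
change (Re h) with (a' - a) in Ra. change (Im h) with (b' - b) in Rb.
specialize (H1 a' ltac:(lra)). specialize (H2 b' ltac:(lra)).
specialize (H3 b' ltac:(change (Rabs (b' - b) < d3); lra)).
change (Rabs (v b' - v b) < Rmin 1 (eps / (3 * K))) in H3.
set (U := circle (k * a)) in *. set (U' := circle (k * a')) in *.
assert (Eh : h = (RtoC (a' - a) + Ci * RtoC (b' - b))%C).
{ unfold h, a, b, a', b'. destruct z, z'. apply injective_projections; simpl; ring. }
replace (cexp k z' - cexp k z - Ci * RtoC k * cexp k z * h)%C with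
  (RtoC (v b') * (U' - U - Ci * RtoC k * U * RtoC (a' - a))
   + (RtoC (v b' - v b) * (Ci * RtoC k * U * RtoC (a' - a))
   + U * RtoC (v b' - v b - - k * v b * (b' - b))))%C.
2:{ rewrite Eh. unfold cexp. fold a b a' b' U U' (v b) (v b').
  change (exp (- (k * b'))) with (v b'). change (exp (- (k * b))) with (v b).
  rewrite !RtoC_minus, !RtoC_mult, !RtoC_opp, RtoC_minus.
  set (B := RtoC b). set (B' := RtoC b'). set (A := RtoC a). set (A' := RtoC a').
  set (X := RtoC (v b)). set (Y := RtoC (v b')). set (kk := RtoC k).
  assert (I2 : (Ci * Ci)%C = (- (1))%C) by (apply injective_projections; simpl; ring).
  transitivity (Y * U' - X * U - Ci * kk * (X * U) * (A' - A) - (Ci * Ci) * (kk * (X * U) * (B' - B)))%C;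
    [rewrite I2; ring|ring]. }
eapply Rle_trans; [apply Cmod_triangle|]. eapply Rle_trans; [apply Rplus_le_compat_l, Cmod_triangle|].
rewrite !Cmod_mult, Cmod_Ci, !Cmod_R. unfold U at 3 4. rewrite !Cmod_circle.
assert (Hv : Rabs (v b') <= V + 1).
{ pose proof (Rmin_l 1 (eps / (3 * K))). fold V in H3. apply Rabs_lt_between in H3.
  rewrite Rabs_pos_eq by (left; apply exp_pos). lra. }
assert (T1 : Rabs (v b') * Cmod (U' - U - Ci * RtoC k * U * RtoC (a' - a))%C <= eps / 3 * Cmod h).
{ apply Rle_trans with ((V + 1) * (eps / (3 * (V + 1)) * Cmod h)); [|right; field; lra].
  apply Rmult_le_compat; [apply Rabs_pos|apply Cmod_ge_0|exact Hv|].
  eapply Rle_trans; [exact H1|]. apply Rmult_le_compat_l; [left; apply Rdiv_lt_0_compat; lra|exact Ra]. }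
assert (T2 : Rabs (v b' - v b) * (1 * Rabs k * 1 * Rabs (a' - a)) <= eps / 3 * Cmod h).
{ apply Rle_trans with (eps / (3 * K) * (K * Cmod h)); [|right; field; lra].
  pose proof (Rmin_r 1 (eps / (3 * K))).
  apply Rmult_le_compat; [apply Rabs_pos| |lra|].
  - repeat apply Rmult_le_pos; try apply Rabs_pos; lra.
  - rewrite Rmult_1_l, Rmult_1_r. apply Rmult_le_compat; try apply Rabs_pos; [unfold K; lra|exact Ra]. }
assert (T3 : Rabs (v b' - v b - - k * v b * (b' - b)) <= eps / 3 * Cmod h).
{ eapply Rle_trans; [exact H2|]. apply Rmult_le_compat_l; [lra|exact Rb]. }
lra.
Qed.

Lemma cexp_opp k z : (cexp (- k) z * cexp k z)%C = 1.
Proof.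
unfold cexp, circle.
replace (- k * Re z) with (- (k * Re z)) by ring. rewrite cos_neg, sin_neg.
replace (RtoC (exp (- (- k * Im z))) * (cos (k * Re z), (- sin (k * Re z))%R)
  * (RtoC (exp (- (k * Im z))) * (cos (k * Re z), sin (k * Re z))))%C with
  (RtoC (exp (- (- k * Im z)) * exp (- (k * Im z)) *
    (sin (k * Re z) * sin (k * Re z) + cos (k * Re z) * cos (k * Re z)))).
- rewrite <- exp_plus. pose proof (sin2_cos2 (k * Re z)) as S. unfold Rsqr in S. rewrite S.
  replace (- (- k * Im z) + - (k * Im z)) with 0 by ring. rewrite exp_0. f_equal. ring.
- apply injective_projections; simpl; ring.
Qed.

Lemma circle_period t : circle (t + 2 * PI) = circle t.
Proof. unfold circle. now rewrite cos_plus, sin_plus, cos_2PI, sin_2PI, !Rmult_1_r, !Rmult_0_r, Rminus_0_r, Rplus_0_r. Qed.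

Lemma cexp_period z : cexp (2 * PI) (z + 1)%C = cexp (2 * PI) z /\
  cexp (- (2 * PI)) (z + 1)%C = cexp (- (2 * PI)) z.
Proof.
unfold cexp.
replace (Im (z + 1)%C) with (Im z) by (unfold Im; simpl; ring).
replace (Re (z + 1)%C) with (Re z + 1) by (unfold Re; simpl; ring).
split; f_equal.
- rewrite <- (circle_period (2 * PI * Re z)). f_equal. ring.
- rewrite <- (circle_period (- (2 * PI) * (Re z + 1))). f_equal. ring.
Qed.

Lemma holomorphic_cexp k : holomorphic_on_H (cexp k).
Proof. intros tau _. eexists. apply is_derive_cexp. Qed.

Lemma holomorphic_pow g n : holomorphic_on_H g -> holomorphic_on_H (fun z => g z ^ n)%C.
Proof.
intros H. induction n as [|n IH].
- intros tau _. simpl. eexists. apply (is_derive_const (K := C_AbsRing) (RtoC 1 : C_NormedModule)).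
- simpl. now apply holomorphic_mult.
Qed.

Lemma is_series_C_eps (a : nat -> C) (l : C) :
  is_series (K := C_AbsRing) (V := C_NormedModule) a l ->
  forall eps, 0 < eps -> exists N, forall n, (N <= n)%nat ->
    Cmod (sum_n (G := C_AbelianMonoid) a n - l) < eps.
Proof.
intros H eps Heps.
destruct (proj1 (filterlim_locally_ball_norm (K := C_AbsRing) (U := C_NormedModule) _ _) H (mkposreal _ Heps)) as [N HN].
exists N. intros n Hn. exact (HN n Hn).
Qed.

Lemma bounded_prefix (a : nat -> R) N : exists K, forall n, (n < N)%nat -> a n <= K.
Proof.
induction N as [|N [K HK]]; [exists 0; lia|].
exists (Rmax K (a N)). intros n Hn. destruct (Nat.eq_dec n N) as [->|]; [apply Rmax_r|].
eapply Rle_trans; [apply HK; lia|apply Rmax_l].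
Qed.

Lemma is_series_terms_bounded (a : nat -> C) (l : C) :
  is_series (K := C_AbsRing) (V := C_NormedModule) a l -> exists K, forall n, Cmod (a n) <= K.
Proof.
intros H. destruct (is_series_C_eps a l H 1 Rlt_0_1) as [N HN].
destruct (bounded_prefix (fun n => Cmod (a n)) (S N)) as [K HK].
exists (Rmax K 2). intros n. destruct (Nat.lt_ge_cases n (S N)) as [L|L].
- eapply Rle_trans; [now apply HK|apply Rmax_l].
- destruct n as [|n]; [lia|].
  assert (A := HN n ltac:(lia)). assert (B := HN (S n) ltac:(lia)).
  rewrite sum_Sn in B. change (plus (sum_n a n) (a (S n))) with (sum_n (G := C_AbelianMonoid) a n + a (S n))%C in B.
  set (s := sum_n (G := C_AbelianMonoid) a n) in *.
  replace (a (S n)) with ((s + a (S n) - l) + - (s - l))%C by ring.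
  eapply Rle_trans; [apply Cmod_triangle|]. rewrite Cmod_opp.
  eapply Rle_trans; [|apply Rmax_r]. lra.
Qed.

Lemma Cmod_pow_n q n : Cmod (pow_n (K := C_Ring) q n) = Cmod q ^ n.
Proof.
induction n as [|n IH]; simpl; [apply Cmod_1|]. unfold mult; simpl.
now rewrite Cmod_mult, IH.
Qed.

(** The terms at [q0] are bounded, so for [Cmod q] at most half of [Cmod q0] the tail after the
    constant term is dominated by a geometric series of ratio at most 1/2. *)
Lemma pseries_near_0 (c : nat -> C) (q0 : C) (l0 : C) : 0 < Cmod q0 ->
  is_pseries (K := C_AbsRing) (V := C_NormedModule) c q0 l0 ->
  exists K, 0 < K /\ forall q l, Cmod q <= Cmod q0 / 2 ->
    is_pseries (K := C_AbsRing) (V := C_NormedModule) c q l -> Cmod (l - c O) <= K * Cmod q.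
Proof.
intros Hq0 H0. destruct (is_series_terms_bounded _ _ H0) as [K0 HK0].
set (K := Rmax 1 K0).
assert (HK : 0 < K) by (pose proof (Rmax_l 1 K0); unfold K; lra).
assert (Hterm : forall n, Cmod q0 ^ n * Cmod (c n) <= K).
{ intros n. eapply Rle_trans; [|apply Rmax_r]. eapply Rle_trans; [|apply (HK0 n)].
  unfold scal; simpl. unfold mult; simpl. rewrite Cmod_mult, Cmod_pow_n. lra. }
exists (K * 2 / Cmod q0). split; [apply Rdiv_lt_0_compat; lra|].
intros q l Hq Hl. set (t := Cmod q / Cmod q0).
assert (Ht : 0 <= t <= 1 / 2).
{ unfold t. pose proof (Cmod_ge_0 q). split; [apply Rmult_le_pos; [assumption|left; now apply Rinv_0_lt_compat]|].
  apply Rmult_le_reg_r with (Cmod q0); [assumption|].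
  replace (Cmod q / Cmod q0 * Cmod q0) with (Cmod q) by (field; lra). lra. }
assert (Hb : forall n, Cmod (scal (pow_n (K := C_Ring) q n) (c n)) <= K * t ^ n).
{ intros n. unfold scal; simpl. unfold mult; simpl. rewrite Cmod_mult, Cmod_pow_n.
  replace (Cmod q) with (t * Cmod q0) by (unfold t; field; lra).
  rewrite Rpow_mult_distr, Rmult_assoc, Rmult_comm.
  apply Rmult_le_compat_r; [apply pow_le; lra|apply Hterm]. }
set (a := fun n => scal (pow_n (K := C_Ring) q n) (c n)) in *.
assert (Hs : forall n, Cmod (sum_n (G := C_AbelianMonoid) a n - c O) <= K * (2 * t) * (1 - (1 / 2) ^ n)).
{ induction n as [|n IH].
  - rewrite sum_O. unfold a. simpl. unfold scal; simpl. unfold mult, one; simpl.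
    replace (1 * c O - c O)%C with (RtoC 0) by ring. rewrite Cmod_0. lra.
  - rewrite sum_Sn. change (plus (sum_n a n) (a (S n))) with (sum_n (G := C_AbelianMonoid) a n + a (S n))%C.
    set (s := sum_n (G := C_AbelianMonoid) a n) in *.
    replace (s + a (S n) - c O)%C with ((s - c O) + a (S n))%C by ring.
    eapply Rle_trans; [apply Cmod_triangle|].
    assert (Hb' : Cmod (a (S n)) <= K * t ^ S n) by exact (Hb (S n)).
    assert (Hp : t ^ n <= (1 / 2) ^ n) by (apply pow_incr; lra).
    assert (K * t ^ (S n) <= K * (2 * t) * ((1 / 2) ^ n / 2)).
    { simpl. replace (K * (2 * t) * ((1 / 2) ^ n / 2)) with (K * (t * (1 / 2) ^ n)) by field.
      apply Rmult_le_compat_l; [lra|]. apply Rmult_le_compat_l; lra. }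
    replace (K * (2 * t) * (1 - (1 / 2) ^ S n)) with
      (K * (2 * t) * (1 - (1 / 2) ^ n) + K * (2 * t) * ((1 / 2) ^ n / 2)) by (simpl; field).
    lra. }
replace (K * 2 / Cmod q0 * Cmod q) with (K * (2 * t)) by (unfold t; field; lra).
apply le_epsilon. intros eps Heps.
destruct (is_series_C_eps a l Hl eps Heps) as [N HN]. specialize (HN N (Nat.le_refl N)). specialize (Hs N).
set (s := sum_n (G := C_AbelianMonoid) a N) in *.
replace (l - c O)%C with ((s - c O) + - (s - l))%C by ring.
eapply Rle_trans; [apply Cmod_triangle|]. rewrite Cmod_opp.
assert (0 <= (1 / 2) ^ N) by (apply pow_le; lra).
assert (0 <= K * (2 * t)) by (apply Rmult_le_pos; lra).
assert (0 <= K * (2 * t) * (1 / 2) ^ N) by (now apply Rmult_le_pos).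
lra.
Qed.

(** Division by [q ^ k], with [r] the inverse of [q]. *)
Lemma pseries_shift (c : nat -> C) (q r l : C) k : (r * q)%C = 1 ->
  is_pseries (K := C_AbsRing) (V := C_NormedModule) c q l ->
  (forall j, (j < k)%nat -> c j = 0) ->
  is_pseries (K := C_AbsRing) (V := C_NormedModule) (fun n => c (n + k)%nat) q (r ^ k * l)%C.
Proof.
intros Hr H. induction k as [|k IH]; intros Hk.
- replace (r ^ 0 * l)%C with l by (simpl; ring).
  apply is_pseries_ext with c; [|exact H]. intros n. now rewrite Nat.add_0_r.
- specialize (IH (fun j Hj => Hk j ltac:(lia))).
  apply (is_pseries_decr_1 (K := C_AbsRing) (V := C_NormedModule) _ _ r) in IH; [|exact Hr].
  simpl in IH. rewrite (Hk k) in IH by lia.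
  replace (r ^ S k * l)%C with (scal (V := C_NormedModule) r (plus (r ^ k * l)%C (opp (RtoC 0)))).
  + apply is_pseries_ext with (2 := IH). intros n. unfold PS_decr_1. f_equal. lia.
  + unfold scal, plus, opp; simpl. unfold mult; simpl. ring.
Qed.

(** Each coefficient [c k] is the limit of the mean of [q ^ (N - k) f] over a period at large
    height. This mean is the increment of a primitive under [tau + 1], which is the same everywhere
    and can be read off on the arc, since the arc joins [e^(2 pi i / 3)] to its translate by 1. *)
Lemma arc_vanishing f : weakly_holomorphic_modular_function f ->
  (forall t, PI / 3 <= t <= 2 * PI / 3 -> f (circle t) = 0) ->
  forall tau, upper_half_plane tau -> f tau = 0.
Proof.
intros [Hf [Hinv [N [c Hc]]]] Harc.
set (r := cexp (- (2 * PI))). set (q := cexp (2 * PI)).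
assert (Hrq : forall z, (r z * q z)%C = 1) by (intros z; apply cexp_opp).
assert (Hq0 : forall z, q z <> 0).
{ intros z E. specialize (Hrq z). rewrite E, Cmult_0_r in Hrq. apply RtoC_inj in Hrq. lra. }
assert (Hcz : forall k j, (j < k)%nat -> c j = 0).
{ induction k as [|k IH]; [lia|]. intros j Hj.
  destruct (Nat.eq_dec j k) as [->|]; [|apply IH; lia].
  (* The earlier coefficients vanish by induction, so the expansion of [h] in [q] starts with
     [c k]. *)
  set (h := fun z => (r z ^ k * (q z ^ N * f z))%C).
  assert (Hh : holomorphic_on_H h).
  { apply holomorphic_mult; [apply holomorphic_pow, holomorphic_cexp|].
    apply holomorphic_mult; [apply holomorphic_pow, holomorphic_cexp|exact Hf]. }
  destruct (holomorphic_primitive h Hh) as [P HP].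
  pose proof PI_RGT_0 as HPI.
  assert (Hper : forall z, upper_half_plane z -> h (z + 1)%C = h z).
  { intros z Hz. unfold h, r, q. destruct (cexp_period z) as [-> ->].
    rewrite <- moebius_T. rewrite Hinv; auto. }
  assert (E0 : (P (circle (PI / 3)) - P (circle (2 * PI / 3)))%C = 0).
  { rewrite <- (arc_integral_primitive h P Hh HP).
    rewrite (cint_ext _ (fun _ => RtoC 0)).
    - rewrite cint_const. ring.
    - intros t Ht. apply arc_bounds in Ht. unfold h. rewrite (Harc t Ht). ring. }
  assert (HP1 : primitive_on_H (fun z => P (z + 1)%C) h).
  { intros z Hz. rewrite <- (Hper z Hz).
    assert (D := HP (z + 1)%C (H_plus_real z 1 Hz)). rewrite is_derive_C_eps in D |- *.
    intros eps Heps. destruct (D eps Heps) as [d [Hd H1]]. exists d. split; [exact Hd|].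
    intros z' Hz'. specialize (H1 (z' + 1)%C).
    replace (z' + 1 - (z + 1))%C with (z' - z)%C in H1 by ring. now apply H1. }
  (* The translate of [P] is another primitive of the periodic [h], so the increment is constant,
     and on the arc it is 0. *)
  assert (Hconst : forall z, upper_half_plane z -> (P (z + 1) - P z)%C = 0).
  { intros z Hz.
    assert (E := primitive_unique _ P h (circle (2 * PI / 3)) z Hh HP1 HP (rho2_H) Hz). cbv beta in E.
    rewrite <- (moebius_T (circle (2 * PI / 3))) in E.
    change matT with (letter_mat false) in E. rewrite circle_letter in E.
    rewrite <- E0.
    replace (P (z + 1) - P z)%C with ((P (z + 1) - P (circle (PI / 3))) + (P (circle (PI / 3)) - P z))%C by ring.
    rewrite E. ring. }
  assert (Hser : forall z, upper_half_plane z ->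
    is_pseries (K := C_AbsRing) (V := C_NormedModule) (fun n => c (n + k)%nat) (q z) (h z)).
  { intros z Hz. apply pseries_shift; [apply Hrq|exact (Hc z Hz)|]. intros j Hj'. apply IH. lia. }
  assert (Hi : upper_half_plane (0, 1)) by (unfold upper_half_plane; simpl; lra).
  destruct (pseries_near_0 (fun n => c (n + k)%nat) (q (0, 1)) (h (0, 1))) as [K [HK Hbound]].
  { apply Cmod_gt_0, Hq0. }
  { now apply Hser. }
  cbv beta in Hbound. change (c (0 + k)%nat) with (c k) in Hbound.
  assert (Hqm : forall x y, Cmod (q (x, y)) = exp (- (2 * PI * y))).
  { intros x y. unfold q, cexp. rewrite Cmod_mult, Cmod_circle, Cmod_R, Rmult_1_r.
    apply Rabs_pos_eq. left. apply exp_pos. }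
  apply Cmod_eq_0. apply Rle_antisym; [|apply Cmod_ge_0].
  apply le_epsilon. intros eps Heps. rewrite Rplus_0_l.
  (* height y such that K |q| <= eps and |q| <= |q(i)|/2 *)
  set (m := Rmin (exp (- (2 * PI * 1)) / 2) (eps / K)).
  assert (Hm : 0 < m).
  { apply Rmin_pos; [pose proof (exp_pos (- (2 * PI * 1))); lra|now apply Rdiv_lt_0_compat]. }
  set (y := Rmax 1 (- ln m / (2 * PI))).
  assert (Hy1 : 1 <= y) by apply Rmax_l.
  assert (Hym : exp (- (2 * PI * y)) <= m).
  { rewrite <- (exp_ln m Hm). assert (A : - ln m / (2 * PI) <= y) by apply Rmax_r.
    assert (- (2 * PI * y) <= ln m).
    { apply (Rmult_le_compat_l (2 * PI)) in A; [|lra].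
      replace (2 * PI * (- ln m / (2 * PI))) with (- ln m) in A by (field; lra). lra. }
    destruct H as [H|H]; [left; now apply exp_increasing|rewrite H; lra]. }
  assert (Hy : 0 < y) by lra.
  assert (Hclose : forall x, Cmod (h (x, y) - c k) <= eps).
  { intros x. eapply Rle_trans; [apply (Hbound (q (x, y)))|].
    - rewrite !Hqm. eapply Rle_trans; [exact Hym|apply Rmin_l].
    - apply Hser. exact Hy.
    - rewrite Hqm. apply Rle_trans with (K * (eps / K)); [|right; field; lra].
      apply Rmult_le_compat_l; [lra|]. eapply Rle_trans; [exact Hym|apply Rmin_r]. }
  assert (Hint : cint (fun x => h (x, y)) 0 1 = 0).
  { assert (E := path_integral_primitive P h (fun x => (x, y)) (fun _ => RtoC 1) 0 1 HP).
    rewrite (cint_ext _ (fun t => h (t, y) * 1)%C) by (intros; ring).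
    rewrite E.
    - assert (E1 := Hconst (0, y) Hy).
      replace ((0, y) + 1)%C with ((1, y) : C) in E1 by (apply injective_projections; simpl; ring). exact E1.
    - intros t _. split; [exact Hy|apply is_derive_horizontal].
    - apply path_continuous_mult_const. now apply horizontal_continuous_H. }
  assert (Kc : path_continuous (fun _ => c k) 0 1) by (intros t _; apply continuous_const).
  assert (Kh : path_continuous (fun x => h (x, y)) 0 1) by (now apply horizontal_continuous_H).
  assert (B : Cmod (cint (fun x => h (x, y) - c k)%C 0 1) <= eps * (1 - 0)).
  { apply cint_bound; [lra| |intros; apply Hclose].
    intros t Ht. apply (continuous_minus (V := C_R_NormedModule) (fun x => h (x, y))); [now apply Kh|now apply Kc]. }
  rewrite cint_minus, Hint in B by assumption.
  rewrite cint_const in B.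
  replace (0 - c k * RtoC (1 - 0))%C with (- c k)%C in B by (rewrite Rminus_0_r; ring).
  rewrite Cmod_opp in B. lra. }
intros tau Ht. specialize (Hc tau Ht).
assert (E : (q tau ^ N * f tau)%C = 0).
{ apply Cmod_eq_0. apply Rle_antisym; [|apply Cmod_ge_0].
  apply le_epsilon. intros eps Heps. rewrite Rplus_0_l.
  destruct (is_series_C_eps _ _ Hc eps Heps) as [n Hn]. specialize (Hn n (Nat.le_refl n)).
  assert (Z : forall m, sum_n (G := C_AbelianMonoid) (fun j => scal (V := C_NormedModule) (pow_n (K := C_Ring) (nome tau) j) (c j)) m = RtoC 0).
  { assert (Zt : forall j, scal (V := C_NormedModule) (pow_n (K := C_Ring) (nome tau) j) (c j) = RtoC 0).
    { intros j. rewrite (Hcz (S j) j) by lia. apply (scal_zero_r (V := C_NormedModule)). }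
    induction m as [|m IH]; [rewrite sum_O; apply Zt|].
    rewrite sum_Sn, IH, Zt. unfold plus; simpl. ring. }
  rewrite Z in Hn.
  replace (0 - nome tau ^ N * f tau)%C with (- (nome tau ^ N * f tau))%C in Hn by ring.
  rewrite Cmod_opp in Hn. left. exact Hn. }
replace (f tau) with (r tau ^ N * (q tau ^ N * f tau))%C.
- rewrite E. ring.
- transitivity ((r tau * q tau) ^ N * f tau)%C; [rewrite Cpow_mult_l; ring|].
  rewrite Hrq, Cpow_1_l. ring.
Qed.

(** * The twist inequalities for the kernel *)

(* Blocks are booleans: [false] is TV and [true] is TTVV. *)
Definition block_word (b : bool) : list bool :=
  if b then [false; false; true; true] else [false; true].

Definition block_act (b : bool) (z : R) : R := word_act (block_word b) z.
Definition block_sum (F : R -> R) (b : bool) (z : R) : R := word_sum F (block_word b) z.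

Lemma block_act_eq b z : 0 < z ->
  block_act b z = if b then (5 * z + 2) / (2 * z + 1) else (2 * z + 1) / (z + 1).
Proof. intros H. destruct b; unfold block_act; simpl; field; lra. Qed.

(** Both blocks map [[8/5, 5/2]] into itself. [tk_upper] is stated with the displacement
    [z - block_act b z], so that its right side telescopes along a word to [M] times the total
    displacement. In [tk_twist] the term with [M] makes room for everything preceding the block TV.
    [tk_lipschitz] serves the points outside that interval, and [tk_slope] the last slope before
    1/2. The inequalities are homogeneous in [F], [M], [B], [eta] taken together, so mixtures of
    positive total weight inherit them. *)
Record twist_kernel (F : R -> R) (M B eta : R) : Prop := {
  tk_pos : forall x, 0 < x -> 0 < F x;
  tk_bound : forall x, 0 < x -> F x <= B;
  tk_inv : forall x, 0 < x -> F (/ x) = F x;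
  tk_lipschitz : forall u v, / 3 <= u -> u <= v ->
    - (B * (v - u)) <= F v - F u <= B * (v - u);
  tk_constants : 0 <= M /\ 0 <= B /\ 0 < eta;
  tk_incr : forall b z1 z2, 8 / 5 <= z1 -> z1 <= z2 -> z2 <= 5 / 2 ->
    block_sum F b z1 <= block_sum F b z2;
  tk_upper : forall b z1 z2, 8 / 5 <= z1 -> z1 <= z2 -> z2 <= 5 / 2 ->
    block_sum F b z2 - block_sum F b z1 <=
    M * ((z2 - z1) - (block_act b z2 - block_act b z1));
  tk_twist : forall z1 z2, 8 / 5 <= z1 -> z1 <= z2 -> z2 <= 5 / 2 ->
    block_sum F false z2 - block_sum F false z1 + M * (block_act false z2 - block_act false z1) <=
    block_sum F true z2 - block_sum F true z1;
  tk_slope : 3 / 2 * block_sum F true (29 / 12) + M * (29 / 12 - 747 / 313) + eta <=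
    block_sum F false (50 / 21) + block_sum F true (121 / 71) }.

Definition kernel_slope (k x : R) : R :=
  ((x + / x) ^ 2 + k) / ((x + / x) ^ 2 - k) ^ 2 * (1 - / x ^ 2).

Lemma is_derive_kernel k x : 0 <= k <= 1 -> 0 < x ->
  is_derive (kernel k) x (- kernel_slope k x).
Proof.
intros Hk Hx. assert (D := kernel_denominator k x Hk Hx).
unfold kernel. auto_derive.
- repeat split; simpl in *; lra.
- unfold kernel_slope. simpl in *. field. split; [lra|].
  intros E. assert (x * x > 0) by nra.
  replace ((x + / x) * ((x + / x) * 1) - k) with (((x * x + 1) * (x * x + 1) - k * (x * x)) / (x * x)) in D by (field; lra).
  rewrite E in D. unfold Rdiv in D. lra.
Qed.

(** Minus the derivative of [s / (s ^ 2 - k)] with respect to [s], at [S = s ^ 2]. *)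
Definition slope_factor (k S : R) : R := (S + k) / (S - k) ^ 2.

Lemma slope_factor_decr k S S' : 0 <= k <= 1 -> 4 <= S -> S <= S' ->
  slope_factor k S' <= slope_factor k S.
Proof.
intros Hk HS HS'. unfold slope_factor, Rdiv.
assert (P : 0 < S - k) by lra. assert (P' : 0 < S' - k) by lra.
replace ((S + k) * / (S - k) ^ 2) with (/ (S - k) + 2 * k * (/ (S - k) * / (S - k))) by (field; lra).
replace ((S' + k) * / (S' - k) ^ 2) with (/ (S' - k) + 2 * k * (/ (S' - k) * / (S' - k))) by (field; lra).
assert (I : / (S' - k) <= / (S - k)) by (apply Rinv_le_contravar; lra).
assert (I0 : 0 < / (S' - k)) by now apply Rinv_0_lt_compat.
assert (/ (S' - k) * / (S' - k) <= / (S - k) * / (S - k)) by (apply Rmult_le_compat; lra).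
apply Rplus_le_compat; [lra|]. apply Rmult_le_compat_l; lra.
Qed.

(** The first two terms of the expansion in powers of [k], whose coefficients
    [(2 n + 1) / S ^ (n + 1)] are all positive. *)
Lemma slope_factor_lower k S : 0 <= k <= 1 -> 4 <= S -> / S + 3 * k * (/ S * / S) <= slope_factor k S.
Proof.
intros Hk HS. unfold slope_factor.
apply Rmult_le_reg_r with ((S - k) ^ 2 * (S * S)).
{ apply Rmult_lt_0_compat; [apply pow_lt; lra|apply Rmult_lt_0_compat; lra]. }
replace ((S + k) / (S - k) ^ 2 * ((S - k) ^ 2 * (S * S))) with ((S + k) * (S * S)) by (field; lra).
replace ((/ S + 3 * k * (/ S * / S)) * ((S - k) ^ 2 * (S * S))) with ((S + 3 * k) * (S - k) ^ 2) by (field; lra).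
assert (0 <= k * k) by (apply Rmult_le_pos; lra).
assert (0 <= k * k * (5 * S - 3 * k)) by (apply Rmult_le_pos; lra).
simpl. lra.
Qed.

(** Convexity in [k]: the right side is the chord between [k = 0] and [k = 1]. *)
Lemma slope_factor_upper k S : 0 <= k <= 1 -> 4 <= S ->
  slope_factor k S <= / S + k * ((S + 1) / (S - 1) ^ 2 - / S).
Proof.
intros Hk HS. unfold slope_factor.
assert (P : 0 < S - k) by lra.
assert (E : (S + k) / (S - k) ^ 2 - / S = k * ((3 * S - k) / ((S - k) ^ 2 * S))) by (field; lra).
assert (E1 : (S + 1) / (S - 1) ^ 2 - / S = (3 * S - 1) / ((S - 1) ^ 2 * S)) by (field; lra).
enough ((3 * S - k) / ((S - k) ^ 2 * S) <= (3 * S - 1) / ((S - 1) ^ 2 * S)).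
{ rewrite E1. apply (Rmult_le_compat_l k) in H; lra. }
apply Rmult_le_reg_r with ((S - k) ^ 2 * (S - 1) ^ 2 * S).
{ repeat apply Rmult_lt_0_compat; try apply pow_lt; lra. }
replace ((3 * S - k) / ((S - k) ^ 2 * S) * ((S - k) ^ 2 * (S - 1) ^ 2 * S)) with ((3 * S - k) * (S - 1) ^ 2) by (field; lra).
replace ((3 * S - 1) / ((S - 1) ^ 2 * S) * ((S - k) ^ 2 * (S - 1) ^ 2 * S)) with ((3 * S - 1) * (S - k) ^ 2) by (field; lra).
assert (0 <= (1 - k) * (5 * S * S - 3 * S * (1 + k) + k)).
{ apply Rmult_le_pos; [lra|].
  assert (0 <= (S - 4) * S) by (apply Rmult_le_pos; lra).
  assert (0 <= (1 - k) * S) by (apply Rmult_le_pos; lra). nra. }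
simpl. lra.
Qed.

(** For arguments above 1 the factor in [x + / x] decreases and the factor [1 - / x ^ 2] increases,
    so each is bounded at an opposite end. *)
Lemma kernel_slope_bounds k p q x : 0 <= k <= 1 -> 1 <= p -> p <= x -> x <= q ->
  slope_factor k ((q + / q) ^ 2) * (1 - / p ^ 2) <= kernel_slope k x <=
  slope_factor k ((p + / p) ^ 2) * (1 - / q ^ 2).
Proof.
intros Hk Hp Hx Hq.
assert (mono : forall u v, 1 <= u -> u <= v -> u + / u <= v + / v).
{ intros u v Hu Hv. apply Rmult_le_reg_r with (u * v); [apply Rmult_lt_0_compat; lra|].
  replace ((u + / u) * (u * v)) with (u * u * v + v) by (field; lra).
  replace ((v + / v) * (u * v)) with (u * v * v + u) by (field; lra).
  assert (0 <= (v - u) * (u * v - 1)) by (apply Rmult_le_pos; [lra|]; pose proof (Rmult_le_compat 1 u 1 v); lra).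
  lra. }
assert (sq : forall u v, 2 <= u -> u <= v -> 4 <= u ^ 2 /\ u ^ 2 <= v ^ 2).
{ intros u v Hu Hv. split; [|apply pow_incr; lra]. replace 4 with (2 ^ 2) by ring. apply pow_incr; lra. }
assert (G : forall u, 1 <= u -> 2 <= u + / u) by (intros; apply plus_inv_ge_2; lra).
destruct (sq (p + / p) (x + / x)) as [S1 S2]; [apply G; lra|apply mono; lra|].
destruct (sq (x + / x) (q + / q)) as [S3 S4]; [apply G; lra|apply mono; lra|].
assert (F1 := slope_factor_decr k _ _ Hk S1 S2).
assert (F2 := slope_factor_decr k _ _ Hk S3 S4).
assert (Fpos : 0 <= slope_factor k ((q + / q) ^ 2)).
{ unfold slope_factor. left. apply Rdiv_lt_0_compat; [lra|apply pow_lt; lra]. }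
assert (I : forall u v, 1 <= u -> u <= v -> / v ^ 2 <= / u ^ 2 /\ / u ^ 2 <= 1).
{ intros u v Hu Hv. assert (1 ^ 2 <= u ^ 2) by (apply pow_incr; lra). rewrite pow1 in H.
  split; [apply Rinv_le_contravar; [lra|apply pow_incr; lra]|].
  rewrite <- Rinv_1. apply Rinv_le_contravar; lra. }
destruct (I p x) as [I1 I2]; [lra..|]. destruct (I x q) as [I3 I4]; [lra..|].
change (kernel_slope k x) with (slope_factor k ((x + / x) ^ 2) * (1 - / x ^ 2)).
split; apply Rmult_le_compat; lra.
Qed.

Lemma nondecreasing_on (h dh : R -> R) a b z1 z2 :
  (forall z, a <= z <= b -> is_derive h z (dh z) /\ 0 <= dh z) ->
  a <= z1 -> z1 <= z2 -> z2 <= b -> h z1 <= h z2.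
Proof.
intros H H1 H2 H3.
destruct (MVT_gen h z1 z2 dh) as [c [Hc E]].
- intros z Hz. rewrite Rmin_left, Rmax_right in Hz by lra. apply H; lra.
- intros z Hz. rewrite Rmin_left, Rmax_right in Hz by lra.
  apply continuity_pt_filterlim, (ex_derive_continuous (V := R_NormedModule)).
  eexists. apply H; lra.
- rewrite Rmin_left, Rmax_right in Hc by lra. destruct (H c ltac:(lra)) as [_ D].
  assert (0 <= dh c * (z2 - z1)) by (apply Rmult_le_pos; lra). lra.
Qed.

Section Kernel.
Variable k : R.
Hypothesis Hk : 0 <= k <= 1.

Let phi := kernel k.
Let psi := kernel_slope k.

Lemma kernel_inv x : 0 < x -> phi (/ x) = phi x.
Proof. intros H. unfold phi, kernel. rewrite Rinv_inv. now rewrite (Rplus_comm (/ x)). Qed.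

(** The symmetry under inversion moves every argument above 1, where the kernel is decreasing. *)
Lemma block_sum_false z : 0 < z ->
  block_sum phi false z = phi (1 + / z) + phi (1 + z / (z + 1)).
Proof.
intros H. unfold block_sum; simpl.
rewrite <- (kernel_inv (z / (z + 1))) by (apply Rdiv_lt_0_compat; lra).
replace (/ (z / (z + 1))) with (1 + / z) by (field; lra).
rewrite (Rplus_comm 1 (z / (z + 1))). ring.
Qed.

Lemma block_sum_true z : 0 < z ->
  block_sum phi true z = phi (1 + / z) + phi (2 + / z)
    + phi (1 + z / (2 * z + 1)) + phi (2 + z / (2 * z + 1)).
Proof.
intros H. unfold block_sum; simpl.
rewrite <- (kernel_inv (z / (z + 1))) by (apply Rdiv_lt_0_compat; lra).
replace (/ (z / (z + 1))) with (1 + / z) by (field; lra).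
replace (z / (z + 1) / (z / (z + 1) + 1)) with (z / (2 * z + 1)) by (field; lra).
rewrite <- (kernel_inv (z / (2 * z + 1))) by (apply Rdiv_lt_0_compat; lra).
replace (/ (z / (2 * z + 1))) with (2 + / z) by (field; lra).
replace (z / (2 * z + 1) + 1 + 1) with (2 + z / (2 * z + 1)) by ring.
rewrite (Rplus_comm 1 (z / (2 * z + 1))). ring.
Qed.

Definition block_slope (b : bool) (z : R) : R :=
  if b then (psi (1 + / z) + psi (2 + / z)) / z ^ 2
    - (psi (1 + z / (2 * z + 1)) + psi (2 + z / (2 * z + 1))) / (2 * z + 1) ^ 2
  else psi (1 + / z) / z ^ 2 - psi (1 + z / (z + 1)) / (z + 1) ^ 2.

Lemma is_derive_kernel_comp (h : R -> R) z dh : 0 < h z -> is_derive h z dh ->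
  is_derive (fun z => phi (h z)) z (- (psi (h z) * dh)).
Proof.
intros Hp D. replace (- (psi (h z) * dh)) with (scal dh (- psi (h z)))
  by (unfold scal; simpl; unfold mult; simpl; ring).
apply (is_derive_comp phi h); [|exact D]. now apply is_derive_kernel.
Qed.

Lemma is_derive_block_sum b z : 0 < z ->
  is_derive (block_sum phi b) z (block_slope b z).
Proof.
intros H. assert (I := Rinv_0_lt_compat z H).
assert (J1 : 0 < z / (z + 1)) by (apply Rdiv_lt_0_compat; lra).
assert (J2 : 0 < z / (2 * z + 1)) by (apply Rdiv_lt_0_compat; lra).
assert (E1 : forall c, 0 <= c -> is_derive (fun z => phi (c + / z)) z (- (psi (c + / z) * - / z ^ 2))).
{ intros c Hc. apply (is_derive_kernel_comp (fun z => c + / z)); [lra|]. auto_derive; [lra|field; lra]. }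
assert (E2 : forall c, 0 <= c -> is_derive (fun z => phi (c + z / (2 * z + 1))) z (- (psi (c + z / (2 * z + 1)) * / (2 * z + 1) ^ 2))).
{ intros c Hc. apply (is_derive_kernel_comp (fun z => c + z / (2 * z + 1))); [lra|]. auto_derive; [lra|field; lra]. }
assert (E3 : is_derive (fun z => phi (1 + z / (z + 1))) z (- (psi (1 + z / (z + 1)) * / (z + 1) ^ 2))).
{ apply (is_derive_kernel_comp (fun z => 1 + z / (z + 1))); [lra|]. auto_derive; [lra|field; lra]. }
destruct b.
- apply (is_derive_ext_loc (fun z => phi (1 + / z) + phi (2 + / z) + phi (1 + z / (2 * z + 1)) + phi (2 + z / (2 * z + 1)))).
  { exists (mkposreal _ H). intros u Hu. rewrite block_sum_true; [reflexivity|].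
    change (Rabs (u - z) < z) in Hu. apply Rabs_lt_between in Hu. lra. }
  replace (block_slope true z) with
    (- (psi (1 + / z) * - / z ^ 2) + - (psi (2 + / z) * - / z ^ 2)
     + - (psi (1 + z / (2 * z + 1)) * / (2 * z + 1) ^ 2) + - (psi (2 + z / (2 * z + 1)) * / (2 * z + 1) ^ 2))
    by (unfold block_slope; field; lra).
  assert (P := fun g h dg dh => @is_derive_plus _ R_NormedModule g h z dg dh).
  exact (P _ _ _ _ (P _ _ _ _ (P _ _ _ _ (E1 1 Rle_0_1) (E1 2 ltac:(lra))) (E2 1 Rle_0_1)) (E2 2 ltac:(lra))).
- apply (is_derive_ext_loc (fun z => phi (1 + / z) + phi (1 + z / (z + 1)))).
  { exists (mkposreal _ H). intros u Hu. rewrite block_sum_false; [reflexivity|].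
    change (Rabs (u - z) < z) in Hu. apply Rabs_lt_between in Hu. lra. }
  replace (block_slope false z) with
    (- (psi (1 + / z) * - / z ^ 2) + - (psi (1 + z / (z + 1)) * / (z + 1) ^ 2))
    by (unfold block_slope; field; lra).
  apply (is_derive_plus (V := R_NormedModule)); [apply E1; lra|exact E3].
Qed.

(* Each slope is bounded by values at the ends of the interval swept by its
   argument as [z] runs over [8/5, 5/2], and then by functions affine in [k]. *)
Lemma kernel_slope_affine p q x : 1 <= p -> p <= x -> x <= q ->
  (/ (q + / q) ^ 2 + 3 * k * (/ (q + / q) ^ 2 * / (q + / q) ^ 2)) * (1 - / p ^ 2) <= psi x <=
  (/ (p + / p) ^ 2 + k * (((p + / p) ^ 2 + 1) / ((p + / p) ^ 2 - 1) ^ 2 - / (p + / p) ^ 2)) * (1 - / q ^ 2).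
Proof.
intros H1 H2 H3. destruct (kernel_slope_bounds k p q x Hk H1 H2 H3) as [L U].
assert (G : forall u, 1 <= u -> 4 <= (u + / u) ^ 2).
{ intros u Hu. replace 4 with (2 ^ 2) by ring. apply pow_incr.
  split; [lra|apply plus_inv_ge_2; lra]. }
assert (I : forall u, 1 <= u -> 0 <= 1 - / u ^ 2).
{ intros u Hu. assert (1 ^ 2 <= u ^ 2) by (apply pow_incr; lra). rewrite pow1 in H.
  assert (/ u ^ 2 <= / 1) by (apply Rinv_le_contravar; lra). rewrite Rinv_1 in H0. lra. }
split.
- eapply Rle_trans; [|exact L]. apply Rmult_le_compat_r; [apply I; lra|].
  apply slope_factor_lower; [exact Hk|apply G; lra].
- eapply Rle_trans; [exact U|]. apply Rmult_le_compat_r; [apply I; lra|].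
  apply slope_factor_upper; [exact Hk|apply G; lra].
Qed.

Section Range.
Variable z : R.
Hypothesis Hz : 8 / 5 <= z <= 5 / 2.

Lemma argument_ranges : 7 / 5 <= 1 + / z <= 13 / 8 /\
  21 / 13 <= 1 + z / (z + 1) <= 12 / 7 /\ 29 / 21 <= 1 + z / (2 * z + 1) <= 17 / 12.
Proof.
assert (/ (5 / 2) <= / z <= / (8 / 5)) by (split; apply Rinv_le_contravar; lra).
assert (/ (7 / 2) <= / (z + 1) <= / (13 / 5)) by (split; apply Rinv_le_contravar; lra).
assert (/ 6 <= / (2 * z + 1) <= / (21 / 5)) by (split; apply Rinv_le_contravar; lra).
replace (z / (z + 1)) with (1 - / (z + 1)) by (field; lra).
replace (z / (2 * z + 1)) with (1 / 2 - / 2 * / (2 * z + 1)) by (field; lra).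
lra.
Qed.

Lemma slope_values :
  (24 / 250 <= psi (1 + / z) <= 284 / 1000) /\
  (91 / 1000 + k * 2 / 100 <= psi (2 + / z) <= 16 / 100) /\
  (116 / 1000 + k * 5 / 100 <= psi (1 + z / (z + 1))) /\
  (0 <= psi (1 + z / (2 * z + 1)) <= 114 / 1000 + k * 12 / 100) /\
  (0 <= psi (2 + z / (2 * z + 1)) <= 107 / 1000 + k * 6 / 100).
Proof.
destruct argument_ranges as [R1 [R2 R3]].
assert (S1 := kernel_slope_affine (7 / 5) (13 / 8) (1 + / z)).
assert (S2 := kernel_slope_affine (12 / 5) (21 / 8) (2 + / z)).
assert (S3 := kernel_slope_affine (21 / 13) (12 / 7) (1 + z / (z + 1))).
assert (S4 := kernel_slope_affine (29 / 21) (17 / 12) (1 + z / (2 * z + 1))).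
assert (S5 := kernel_slope_affine (50 / 21) (29 / 12) (2 + z / (2 * z + 1))).
specialize (S1 ltac:(lra) ltac:(lra) ltac:(lra)).
specialize (S2 ltac:(lra) ltac:(lra) ltac:(lra)).
specialize (S3 ltac:(lra) ltac:(lra) ltac:(lra)).
specialize (S4 ltac:(lra) ltac:(lra) ltac:(lra)).
specialize (S5 ltac:(lra) ltac:(lra) ltac:(lra)).
repeat split; lra.
Qed.

(** The ratios of 1, [z], [z + 1] and [2 z + 1] are monotone in [z]; the ends 8/5 and 5/2 give 7/5,
    12/5, 13/21 and so on, which are squared and partly rounded. *)
Lemma square_ratios : 0 < / (z + 1) ^ 2 /\ 0 < / (2 * z + 1) ^ 2 /\
  196 / 100 * / (z + 1) ^ 2 <= / z ^ 2 /\ 576 / 100 * / (2 * z + 1) ^ 2 <= / z ^ 2 /\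
  / (2 * z + 1) ^ 2 <= 384 / 1000 * / (z + 1) ^ 2 /\ / z ^ 2 <= 100 / 256 /\
  / (z + 1) ^ 2 <= 15 / 100 /\ / (2 * z + 1) ^ 2 <= 57 / 1000.
Proof.
assert (R : forall u v c, 0 < u -> 0 < v -> 0 < c -> u <= c * v -> c ^ 2 * 0 <= / u ^ 2 /\ / v ^ 2 <= c ^ 2 * / u ^ 2).
{ intros u v c Hu Hv Hc Huv.
  assert (Hu2 := pow_lt u 2 Hu). assert (Hv2 := pow_lt v 2 Hv). split.
  - rewrite Rmult_0_r. left. now apply Rinv_0_lt_compat.
  - apply Rmult_le_reg_r with (u ^ 2 * v ^ 2); [now apply Rmult_lt_0_compat|].
    replace (/ v ^ 2 * (u ^ 2 * v ^ 2)) with (u ^ 2) by (field; lra).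
    replace (c ^ 2 * / u ^ 2 * (u ^ 2 * v ^ 2)) with ((c * v) ^ 2) by (field; lra).
    apply pow_incr. lra. }
destruct (R z (z + 1) (5 / 7)) as [_ R1]; try lra.
destruct (R z (2 * z + 1) (5 / 12)) as [_ R2]; try lra.
destruct (R (z + 1) (2 * z + 1) (13 / 21)) as [_ R3]; try lra.
destruct (R 1 z (5 / 8)) as [_ R4]; try lra.
destruct (R 1 (z + 1) (5 / 13)) as [_ R5]; try lra.
destruct (R 1 (2 * z + 1) (5 / 21)) as [_ R6]; try lra.
assert (0 < / (z + 1) ^ 2) by (apply Rinv_0_lt_compat, pow_lt; lra).
assert (0 < / (2 * z + 1) ^ 2) by (apply Rinv_0_lt_compat, pow_lt; lra).
repeat split; lra.
Qed.

(** After multiplication by [(z + 1) ^ 2] the claim compares [psi (1 + / z) * (1 + / z) ^ 2] with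
    [psi (1 + z / (z + 1))]. The square turns the factor [1 - / x ^ 2] into [x ^ 2 - 1], at least
    0.96, against at most 0.67 on the other side, while the two slope factors are nearly equal. *)
Lemma block_slope_false_nonneg : 0 <= block_slope false z.
Proof.
destruct argument_ranges as [R1 [R2 R3]].
destruct (kernel_slope_bounds k (7 / 5) (13 / 8) (1 + / z) Hk) as [L _]; try lra.
destruct (kernel_slope_bounds k (21 / 13) (12 / 7) (1 + z / (z + 1)) Hk) as [_ U]; try lra.
fold psi in L, U.
assert (I := Rinv_0_lt_compat z ltac:(lra)).
assert (A1 : slope_factor k ((13 / 8 + / (13 / 8)) ^ 2) * (96 / 100) <= psi (1 + / z) * (1 + / z) ^ 2).
{ set (x := 1 + / z) in *.
  assert (L' : slope_factor k ((13 / 8 + / (13 / 8)) ^ 2) * (1 - / x ^ 2) <= psi x).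
  { apply (kernel_slope_bounds k x (13 / 8) x Hk); lra. }
  assert (X : 0 < x ^ 2) by (apply pow_lt; lra).
  assert (X2 : 196 / 100 <= x ^ 2) by (replace (196 / 100) with ((7 / 5) ^ 2) by field; apply pow_incr; lra).
  apply (Rmult_le_compat_r (x ^ 2)) in L'; [|lra].
  replace (slope_factor k ((13 / 8 + / (13 / 8)) ^ 2) * (1 - / x ^ 2) * x ^ 2) with
    (slope_factor k ((13 / 8 + / (13 / 8)) ^ 2) * (x ^ 2 - 1)) in L' by (field; lra).
  eapply Rle_trans; [|exact L']. apply Rmult_le_compat_l; [|lra].
  unfold slope_factor. left. apply Rdiv_lt_0_compat; [|apply pow_lt]; lra. }
assert (A2 : slope_factor k ((21 / 13 + / (21 / 13)) ^ 2) * (67 / 100) <= slope_factor k ((13 / 8 + / (13 / 8)) ^ 2) * (96 / 100)).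
{ unfold slope_factor.
  set (S := (21 / 13 + / (21 / 13)) ^ 2). set (S' := (13 / 8 + / (13 / 8)) ^ 2).
  assert (HS : 499 / 100 <= S <= 5) by (unfold S; lra). assert (HS' : 5 <= S' <= 502 / 100) by (unfold S'; lra).
  apply Rmult_le_reg_r with ((S - k) ^ 2 * (S' - k) ^ 2).
  { apply Rmult_lt_0_compat; apply pow_lt; lra. }
  replace ((S + k) / (S - k) ^ 2 * (67 / 100) * ((S - k) ^ 2 * (S' - k) ^ 2)) with
    ((S + k) * (67 / 100 * (S' - k) ^ 2)) by (field; lra).
  replace ((S' + k) / (S' - k) ^ 2 * (96 / 100) * ((S - k) ^ 2 * (S' - k) ^ 2)) with
    ((S' + k) * (96 / 100 * (S - k) ^ 2)) by (field; lra).
  assert ((9 / 10 * (S' - k)) ^ 2 <= (S - k) ^ 2) by (apply pow_incr; lra).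
  assert (0 < (S' - k) ^ 2) by (apply pow_lt; lra).
  apply Rmult_le_compat; lra. }
assert (A3 : psi (1 + z / (z + 1)) <= psi (1 + / z) * (1 + / z) ^ 2).
{ eapply Rle_trans; [exact U|]. eapply Rle_trans; [|exact A1]. eapply Rle_trans; [|exact A2].
  apply Rmult_le_compat_l; [|lra].
  unfold slope_factor. left. apply Rdiv_lt_0_compat; [|apply pow_lt]; lra. }
unfold block_slope. destruct square_ratios as [Q _].
replace (psi (1 + / z) / z ^ 2) with (psi (1 + / z) * (1 + / z) ^ 2 * / (z + 1) ^ 2) by (field; lra).
unfold Rdiv at 2. apply (Rmult_le_compat_r (/ (z + 1) ^ 2)) in A3; lra.
Qed.

Lemma block_slope_true_nonneg : 0 <= block_slope true z.
Proof.
destruct slope_values as [[V1 V1'] [[V2 V2'] [V3 [V4 V5]]]].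
destruct square_ratios as [Q1 [Q2 [Q3 [Q4 [Q5 [Q6 [Q7 Q8]]]]]]].
unfold block_slope, Rdiv.
assert ((psi (1 + z * / (2 * z + 1)) + psi (2 + z * / (2 * z + 1))) * / (2 * z + 1) ^ 2 <= 41 / 100 * / (2 * z + 1) ^ 2).
{ apply Rmult_le_compat_r; unfold Rdiv in *; lra. }
assert (18 / 100 * / z ^ 2 <= (psi (1 + / z) + psi (2 + / z)) * / z ^ 2).
{ apply Rmult_le_compat_r; lra. }
lra.
Qed.

(** The value 1/5 of [M] is large enough here and small enough in [block_slope_twist]. *)
Lemma block_slope_upper :
  block_slope false z <= / 5 * (1 - / (z + 1) ^ 2) /\
  block_slope true z <= / 5 * (1 - / (2 * z + 1) ^ 2).
Proof.
destruct slope_values as [[V1 V1'] [[V2 V2'] [V3 [[V4 V4'] [V5 V5']]]]].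
destruct square_ratios as [Q1 [Q2 [Q3 [Q4 [Q5 [Q6 [Q7 Q8]]]]]]].
unfold block_slope, Rdiv in *.
assert (0 <= psi (1 + z * / (z + 1)) * / (z + 1) ^ 2) by (apply Rmult_le_pos; lra).
assert (0 <= (psi (1 + z * / (2 * z + 1)) + psi (2 + z * / (2 * z + 1))) * / (2 * z + 1) ^ 2)
  by (apply Rmult_le_pos; lra).
assert (psi (1 + / z) * / z ^ 2 <= (284 / 1000) * (100 / 256)) by (apply Rmult_le_compat; lra).
assert ((psi (1 + / z) + psi (2 + / z)) * / z ^ 2 <= (444 / 1000) * (100 / 256)) by (apply Rmult_le_compat; lra).
split; lra.
Qed.

(** The term [psi (1 + / z) / z ^ 2] occurs in both slopes and cancels; what remains is compared in
    units of [/ (z + 1) ^ 2]. *)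
Lemma block_slope_twist :
  block_slope false z + / 5 * / (z + 1) ^ 2 <= block_slope true z.
Proof.
destruct slope_values as [[V1 V1'] [[V2 V2'] [V3 [[V4 V4'] [V5 V5']]]]].
destruct square_ratios as [Q1 [Q2 [Q3 [Q4 [Q5 [Q6 [Q7 Q8]]]]]]].
unfold block_slope, Rdiv in *.
set (p := psi (1 + / z)) in *. set (q := psi (2 + / z)) in *.
set (r := psi (1 + z * / (z + 1))) in *.
set (s := psi (1 + z * / (2 * z + 1))) in *. set (t := psi (2 + z * / (2 * z + 1))) in *.
set (u := / (z + 1) ^ 2) in *. set (v := / (2 * z + 1) ^ 2) in *. set (w := / z ^ 2) in *.
assert (q * (196 / 100 * u) <= q * w) by (apply Rmult_le_compat_l; lra).
assert ((s + t) * v <= (s + t) * (384 / 1000 * u)) by (apply Rmult_le_compat_l; lra).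
assert (0 <= u * (196 / 100 * q + r - 384 / 1000 * (s + t) - / 5)) by (apply Rmult_le_pos; lra).
lra.
Qed.
End Range.

Lemma is_derive_block_act b z : 0 < z ->
  is_derive (block_act b) z (if b then / (2 * z + 1) ^ 2 else / (z + 1) ^ 2).
Proof.
intros H.
apply (is_derive_ext_loc (fun z => if b then (5 * z + 2) / (2 * z + 1) else (2 * z + 1) / (z + 1))).
{ exists (mkposreal _ H). intros u Hu. rewrite block_act_eq; [reflexivity|].
  change (Rabs (u - z) < z) in Hu. apply Rabs_lt_between in Hu. lra. }
destruct b; auto_derive; try lra; field; lra.
Qed.

Lemma kernel_pos x : 0 < x -> / (x + / x) <= phi x.
Proof.
intros H. assert (D := kernel_denominator k x Hk H). assert (G := plus_inv_ge_2 x H).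
unfold phi, kernel. set (s := x + / x) in *.
apply Rmult_le_reg_r with (s * (s ^ 2 - k)); [apply Rmult_lt_0_compat; lra|].
replace (/ s * (s * (s ^ 2 - k))) with (s ^ 2 - k) by (field; lra).
replace (s / (s ^ 2 - k) * (s * (s ^ 2 - k))) with (s ^ 2) by (field; lra). lra.
Qed.

Lemma kernel_le_1 x : 0 < x -> phi x <= 1.
Proof.
intros H. assert (D := kernel_denominator k x Hk H). assert (G := plus_inv_ge_2 x H).
unfold phi, kernel. set (s := x + / x) in *.
apply Rmult_le_reg_r with (s ^ 2 - k); [lra|].
replace (s / (s ^ 2 - k) * (s ^ 2 - k)) with s by (field; lra).
assert (0 <= (s - 2) * s) by (apply Rmult_le_pos; lra). simpl. lra.
Qed.

(** From 1/3 on, [x + / x] changes at a rate of at most 8, and the difference quotient in this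
    variable is at most 5/9; their product is below 5. *)
Lemma kernel_lipschitz u v : / 3 <= u -> u <= v ->
  - (5 * (v - u)) <= phi v - phi u <= 5 * (v - u).
Proof.
intros Hu Hv.
assert (Du := kernel_denominator k u Hk ltac:(lra)). assert (Dv := kernel_denominator k v Hk ltac:(lra)).
assert (Gu := plus_inv_ge_2 u ltac:(lra)). assert (Gv := plus_inv_ge_2 v ltac:(lra)).
assert (Es : (v + / v) - (u + / u) = (v - u) * (1 - / u * / v)) by (field; lra).
assert (Iu : 0 < / u <= 3).
{ split; [apply Rinv_0_lt_compat; lra|]. rewrite <- (Rinv_inv 3). apply Rinv_le_contravar; lra. }
assert (Iv : 0 < / v <= 3).
{ split; [apply Rinv_0_lt_compat; lra|]. rewrite <- (Rinv_inv 3). apply Rinv_le_contravar; lra. }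
assert (Iuv : 0 < / u * / v <= 3 * 3) by (split; [now apply Rmult_lt_0_compat|apply Rmult_le_compat; lra]).
unfold phi, kernel. set (s := u + / u) in *. set (t := v + / v) in *.
set (c := (s * t + k) / ((s ^ 2 - k) * (t ^ 2 - k))).
assert (Hc : 0 <= c <= 5 / 9).
{ assert (P : 0 < (s ^ 2 - k) * (t ^ 2 - k)) by (apply Rmult_lt_0_compat; lra).
  assert (P2 : 2 * 2 <= s * t) by (apply Rmult_le_compat; lra).
  split; [apply Rmult_le_pos; [lra|left; now apply Rinv_0_lt_compat]|].
  apply Rmult_le_reg_r with ((s ^ 2 - k) * (t ^ 2 - k)); [exact P|].
  unfold c. replace ((s * t + k) / ((s ^ 2 - k) * (t ^ 2 - k)) * ((s ^ 2 - k) * (t ^ 2 - k)))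
    with (s * t + k) by (field; lra).
  assert (0 <= (s ^ 2 - k - 3) * (t ^ 2 - k - 3)) by (apply Rmult_le_pos; lra).
  pose proof (Rle_0_sqr (s - t)). unfold Rsqr in *. simpl in *. lra. }
replace (t / (t ^ 2 - k) - s / (s ^ 2 - k)) with (- ((t - s) * c)) by (unfold c; field; lra).
rewrite Es.
assert (B : - 5 <= (1 - / u * / v) * c <= 5).
{ assert (- 8 * c <= (1 - / u * / v) * c) by (apply Rmult_le_compat_r; lra).
  assert ((1 - / u * / v) * c <= 1 * c) by (apply Rmult_le_compat_r; lra). lra. }
assert ((v - u) * ((1 - / u * / v) * c) <= (v - u) * 5) by (apply Rmult_le_compat_l; lra).
assert ((v - u) * - 5 <= (v - u) * ((1 - / u * / v) * c)) by (apply Rmult_le_compat_l; lra).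
lra.
Qed.

(** The geometric series in [k / s ^ 2], cut off after [k ^ 2], with the remainder bounded by its
    value at [k = 1]. *)
Lemma kernel_expansion x : 0 < x -> let s := x + / x in
  / s + k * / s ^ 3 + k * k * / s ^ 5 <= phi x <=
  / s + k * / s ^ 3 + k * k * / s ^ 5 + / (s ^ 5 * (s ^ 2 - 1)).
Proof.
intros H. cbn zeta.
assert (D := kernel_denominator k x Hk H). assert (G := plus_inv_ge_2 x H).
assert (D1 := kernel_denominator 1 x ltac:(lra) H).
unfold phi, kernel. set (s := x + / x) in *.
assert (E : s / (s ^ 2 - k) = / s + k * / s ^ 3 + k * k * / s ^ 5 + k * k * k * / (s ^ 5 * (s ^ 2 - k)))
  by (field; lra).
rewrite E.
assert (P : 0 < s ^ 5) by (apply pow_lt; lra).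
assert (K2 : 0 <= k * k <= 1) by (split; [apply Rmult_le_pos|pose proof (Rmult_le_compat k 1 k 1)]; lra).
assert (K3 : 0 <= k * k * k <= 1) by (split; [apply Rmult_le_pos|pose proof (Rmult_le_compat (k * k) 1 k 1)]; lra).
assert (I : 0 < / (s ^ 5 * (s ^ 2 - k)) <= / (s ^ 5 * (s ^ 2 - 1))).
{ split; [apply Rinv_0_lt_compat, Rmult_lt_0_compat; lra|].
  apply Rinv_le_contravar; [apply Rmult_lt_0_compat; lra|]. apply Rmult_le_compat_l; lra. }
assert (0 <= k * k * k * / (s ^ 5 * (s ^ 2 - k))) by (apply Rmult_le_pos; lra).
assert (k * k * k * / (s ^ 5 * (s ^ 2 - k)) <= 1 * / (s ^ 5 * (s ^ 2 - 1))) by (apply Rmult_le_compat; lra).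
lra.
Qed.

Lemma kernel_slope_numeric :
  3 / 2 * block_sum phi true (29 / 12) + / 5 * (29 / 12 - 747 / 313) + / 100 <=
  block_sum phi false (50 / 21) + block_sum phi true (121 / 71).
Proof.
rewrite block_sum_false, !block_sum_true by lra.
assert (L := fun x Hx => proj1 (kernel_expansion x Hx)).
assert (U := fun x Hx => proj2 (kernel_expansion x Hx)). cbn zeta in L, U.
assert (L1 := L (1 + / (50 / 21)) ltac:(lra)).
assert (L2 := L (1 + 50 / 21 / (50 / 21 + 1)) ltac:(lra)).
assert (L3 := L (1 + / (121 / 71)) ltac:(lra)).
assert (L4 := L (2 + / (121 / 71)) ltac:(lra)).
assert (L5 := L (1 + 121 / 71 / (2 * (121 / 71) + 1)) ltac:(lra)).
assert (L6 := L (2 + 121 / 71 / (2 * (121 / 71) + 1)) ltac:(lra)).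
assert (U1 := U (1 + / (29 / 12)) ltac:(lra)).
assert (U2 := U (2 + / (29 / 12)) ltac:(lra)).
assert (U3 := U (1 + 29 / 12 / (2 * (29 / 12) + 1)) ltac:(lra)).
assert (U4 := U (2 + 29 / 12 / (2 * (29 / 12) + 1)) ltac:(lra)).
clear L U.
(* After the expansion both sides are linear in [k] and [k * k], which [lra] treats as two
   unknowns. *)
assert (K2 : 0 <= k * k) by (apply Rmult_le_pos; lra).
lra.
Qed.

Lemma kernel_twist : twist_kernel phi (/ 5) 5 (/ 100).
Proof.
constructor.
- intros x H. eapply Rlt_le_trans; [|now apply kernel_pos].
  apply Rinv_0_lt_compat. assert (G := plus_inv_ge_2 x H). lra.
- intros x H. pose proof (kernel_le_1 x H). lra.
- apply kernel_inv.
- apply kernel_lipschitz.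
- lra.
- intros b z1 z2 H1 H2 H3.
  apply (nondecreasing_on (block_sum phi b) (block_slope b) (8 / 5) (5 / 2)); try assumption.
  intros z Hz. split; [apply is_derive_block_sum; lra|].
  destruct b; [now apply block_slope_true_nonneg|now apply block_slope_false_nonneg].
- intros b z1 z2 H1 H2 H3.
  assert (N := nondecreasing_on (fun z => / 5 * (z - block_act b z) - block_sum phi b z)
    (fun z => / 5 * (1 - (if b then / (2 * z + 1) ^ 2 else / (z + 1) ^ 2)) - block_slope b z)
    (8 / 5) (5 / 2) z1 z2).
  cbv beta in N. lapply N; [intros N'; specialize (N' H1 H2 H3); lra|].
  intros z Hz. split.
  + assert (D1 := is_derive_block_act b z ltac:(lra)). assert (D2 := is_derive_block_sum b z ltac:(lra)).
    apply (is_derive_minus (V := R_NormedModule)); [|exact D2].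
    apply (is_derive_scal (fun z => z - block_act b z)).
    apply (is_derive_minus (V := R_NormedModule) (fun z => z)); [apply (is_derive_id (K := R_AbsRing))|exact D1].
  + destruct (block_slope_upper z Hz). destruct b; lra.
- intros z1 z2 H1 H2 H3.
  assert (N := nondecreasing_on (fun z => block_sum phi true z - block_sum phi false z - / 5 * block_act false z)
    (fun z => block_slope true z - block_slope false z - / 5 * / (z + 1) ^ 2)
    (8 / 5) (5 / 2) z1 z2).
  cbv beta in N. lapply N; [intros N'; specialize (N' H1 H2 H3); lra|].
  intros z Hz. split.
  + assert (D1 := is_derive_block_act false z ltac:(lra)). cbv iota in D1.
    assert (D2 := is_derive_block_sum true z ltac:(lra)). assert (D3 := is_derive_block_sum false z ltac:(lra)).
    apply (is_derive_minus (V := R_NormedModule)).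
    * now apply (is_derive_minus (V := R_NormedModule)).
    * now apply (is_derive_scal (block_act false)).
  + pose proof (block_slope_twist z Hz). lra.
- apply kernel_slope_numeric.
Qed.
End Kernel.

(** * Averaging the kernel inequalities over the arc *)

Definition linear_comb (F : R -> R) (l : list (R * R)) : R :=
  fold_right (fun ax s => fst ax * F (snd ax) + s) 0 l.

Lemma linear_comb_app F l l' : linear_comb F (l ++ l') = linear_comb F l + linear_comb F l'.
Proof. induction l as [|ax l IH]; simpl; [ring|]. rewrite IH. ring. Qed.

Fixpoint word_comb (c : R) (W : list bool) (z : R) : list (R * R) :=
  match W with
  | [] => []
  | L :: W' => (c, word_act W z) :: word_comb c W' z
  end.

Lemma linear_comb_word F c W z : linear_comb F (word_comb c W z) = c * word_sum F W z.
Proof. induction W as [|L W IH]; simpl; [ring|]. rewrite IH. ring. Qed.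

Lemma word_comb_pos c W z ax : 0 < z -> In ax (word_comb c W z) -> 0 < snd ax.
Proof.
intros Hz. induction W as [|L W IH]; simpl; [tauto|]. intros [<-|H]; [|auto].
simpl. now apply letter_act_pos, word_act_pos.
Qed.

Section ArcKernelTwist.
Variable f : C -> C.
Hypothesis f_holo : holomorphic_on_H f.
Hypothesis f_nonneg : forall t, PI / 3 <= t <= 2 * PI / 3 -> 0 <= Re (f (circle t)).

Definition total_weight : R := RInt (arc_weight f) (PI / 3) (2 * PI / 3).

Lemma arc_weight_nonneg t : PI / 3 <= t <= 2 * PI / 3 -> 0 <= arc_weight f t.
Proof.
intros H. pose proof PI_RGT_0. apply Rmult_le_pos; [now apply f_nonneg|].
apply sin_ge_0; lra.
Qed.

Lemma ex_RInt_arc_weight : ex_RInt (arc_weight f) (PI / 3) (2 * PI / 3).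
Proof. apply (ex_RInt_arc f f_holo sin). intros t _. auto_derive. trivial. Qed.

Lemma is_RInt_arc_kernel x : 0 < x ->
  is_RInt (fun t => arc_weight f t * kernel (4 * cos t ^ 2) x) (PI / 3) (2 * PI / 3) (arc_kernel f x).
Proof.
intros Hx. apply (RInt_correct (V := R_CompleteNormedModule)).
apply (ex_RInt_ext (V := R_NormedModule) (fun t => Re (f (circle t)) * (sin t * kernel (4 * cos t ^ 2) x))).
{ intros t _. unfold arc_weight. symmetry. apply Rmult_assoc. }
apply ex_RInt_arc; [exact f_holo|]. intros t Ht.
assert (K := kernel_denominator (4 * cos t ^ 2) x (arc_cos t Ht) Hx).
unfold kernel. auto_derive. repeat split; lra.
Qed.

Lemma is_RInt_linear_comb l : (forall ax, In ax l -> 0 < snd ax) ->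
  is_RInt (fun t => arc_weight f t * linear_comb (kernel (4 * cos t ^ 2)) l) (PI / 3) (2 * PI / 3)
    (linear_comb (arc_kernel f) l).
Proof.
induction l as [|[a x] l IH]; intros H; simpl.
- apply (is_RInt_ext (fun _ => 0)); [intros t _; symmetry; apply Rmult_0_r|].
  assert (I := is_RInt_const (V := R_NormedModule) (PI / 3) (2 * PI / 3) 0).
  unfold scal in I; simpl in I. unfold mult in I; simpl in I. rewrite Rmult_0_r in I. exact I.
- apply (is_RInt_ext (fun t => plus (scal a (arc_weight f t * kernel (4 * cos t ^ 2) x))
    (arc_weight f t * linear_comb (kernel (4 * cos t ^ 2)) l))).
  { intros t _. unfold plus, scal; simpl. unfold mult; simpl.
    match goal with |- ?u = ?v => change (@eq R u v) end. ring. }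
  apply (is_RInt_plus (V := R_NormedModule)).
  + apply (is_RInt_scal (V := R_NormedModule)), is_RInt_arc_kernel.
    exact (H (a, x) (or_introl eq_refl)).
  + apply IH. intros. apply H. now right.
Qed.

(** The arc kernel is a mixture of the kernels with [k = 4 cos t ^ 2] and nonnegative weights, so a
    lower bound uniform in [k] is multiplied by the total weight. *)
Lemma linear_comb_arc_kernel l m : (forall ax, In ax l -> 0 < snd ax) ->
  (forall k, 0 <= k <= 1 -> m <= linear_comb (kernel k) l) ->
  m * total_weight <= linear_comb (arc_kernel f) l.
Proof.
intros Hl Hm. pose proof PI_RGT_0.
assert (I1 : is_RInt (fun t => m * arc_weight f t) (PI / 3) (2 * PI / 3) (m * total_weight)).
{ apply (is_RInt_scal (V := R_NormedModule)), (RInt_correct (V := R_CompleteNormedModule)), ex_RInt_arc_weight. }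
eapply is_RInt_le; [|exact I1|exact (is_RInt_linear_comb l Hl)|]; [lra|].
intros t Ht.
change (m * arc_weight f t <= arc_weight f t * linear_comb (kernel (4 * cos t ^ 2)) l).
rewrite Rmult_comm. apply Rmult_le_compat_l; [apply arc_weight_nonneg; lra|].
apply Hm, arc_cos; lra.
Qed.

Lemma total_weight_pos : (exists t, PI / 3 <= t <= 2 * PI / 3 /\ 0 < Re (f (circle t))) ->
  0 < total_weight.
Proof.
intros [t0 [Ht0 Hf0]]. pose proof PI_RGT_0 as HPI.
assert (Hw : 0 < arc_weight f t0) by (apply Rmult_lt_0_compat; [exact Hf0|apply sin_gt_0; lra]).
assert (Hc : forall t, PI / 3 <= t <= 2 * PI / 3 -> continuous (arc_weight f) t).
{ intros t Ht. apply (continuous_mult (K := R_AbsRing)); [now apply continuous_Re_arc|].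
  apply (ex_derive_continuous (V := R_NormedModule)). auto_derive. trivial. }
destruct (Hc t0 Ht0 (ball (arc_weight f t0) (mkposreal _ Hw)) (locally_ball _ _)) as [d Hd].
assert (Hpos : forall t, Rabs (t - t0) < d -> 0 < arc_weight f t).
{ intros t Ht. specialize (Hd t Ht). change (Rabs (arc_weight f t - arc_weight f t0) < arc_weight f t0) in Hd.
  apply Rabs_lt_between in Hd. lra. }
(* The interval around [t0] is clipped to the arc, since [t0] may be one of its ends. *)
set (c := Rmax (PI / 3) (t0 - d / 2)). set (e := Rmin (2 * PI / 3) (t0 + d / 2)).
assert (Hdp := cond_pos d).
assert (c <= t0 /\ t0 <= e /\ PI / 3 <= c /\ e <= 2 * PI / 3 /\ t0 - d / 2 <= c /\ e <= t0 + d / 2) as [C1 [C2 [C3 [C4 [C5 C6]]]]].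
{ unfold c, e. repeat split; try apply Rmax_l; try apply Rmax_r; try apply Rmin_l; try apply Rmin_r.
  - apply Rmax_lub; lra.
  - apply Rmin_glb; lra. }
assert (Hce : c < e).
{ unfold c, e. apply Rmax_lub_lt; apply Rmin_glb_lt; lra. }
assert (Ex : forall a b, PI / 3 <= a -> a <= b -> b <= 2 * PI / 3 -> ex_RInt (arc_weight f) a b).
{ intros a b H1 H2 H3. apply (ex_RInt_continuous (V := R_CompleteNormedModule)). intros t Ht.
  rewrite Rmin_left, Rmax_right in Ht by lra. apply Hc; lra. }
unfold total_weight.
rewrite <- (RInt_Chasles (arc_weight f) (PI / 3) c) by (apply Ex; lra).
rewrite <- (RInt_Chasles (arc_weight f) c e) by (apply Ex; lra).
assert (G1 : 0 <= RInt (arc_weight f) (PI / 3) c).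
{ apply RInt_ge_0; [lra|apply Ex; lra|]. intros t Ht. apply arc_weight_nonneg; lra. }
assert (G2 : 0 <= RInt (arc_weight f) e (2 * PI / 3)).
{ apply RInt_ge_0; [lra|apply Ex; lra|]. intros t Ht. apply arc_weight_nonneg; lra. }
assert (G3 : 0 < RInt (arc_weight f) c e).
{ apply RInt_gt_0; [lra| |].
  - intros t Ht. apply Hpos. apply Rabs_lt_between. lra.
  - intros t Ht. apply Hc; lra. }
unfold plus; simpl. lra.
Qed.

(** Apart from the symmetry under inversion, each condition is put in the form of a lower bound for
    a finite combination of values, uniform in [k]; values that are bounded above enter with
    negative coefficients. *)
Lemma arc_kernel_twist : 0 < total_weight ->
  twist_kernel (arc_kernel f) (/ 5 * total_weight) (5 * total_weight) (/ 100 * total_weight).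
Proof.
intros HW. set (W := total_weight) in *.
assert (Lin : forall l m, (forall ax, In ax l -> 0 < snd ax) ->
  (forall k, 0 <= k <= 1 -> m <= linear_comb (kernel k) l) ->
  m * W <= linear_comb (arc_kernel f) l) by exact linear_comb_arc_kernel.
assert (T := kernel_twist).
constructor.
- intros x Hx. assert (L := Lin [(1, x)] (/ (x + / x))). simpl in L.
  assert (G := plus_inv_ge_2 x Hx). assert (0 < / (x + / x)) by (apply Rinv_0_lt_compat; lra).
  assert (/ (x + / x) * W <= 1 * arc_kernel f x + 0).
  { apply L; [intros ? [<-|[]]; exact Hx|]. intros k Hk. pose proof (kernel_pos k Hk x Hx). lra. }
  assert (0 < / (x + / x) * W) by now apply Rmult_lt_0_compat. lra.
- intros x Hx. assert (L := Lin [(-1, x)] (-5)). simpl in L.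
  assert (-5 * W <= -1 * arc_kernel f x + 0); [|lra].
  apply L; [intros ? [<-|[]]; exact Hx|]. intros k Hk. pose proof (tk_bound _ _ _ _ (T k Hk) x Hx). lra.
- intros x Hx. unfold arc_kernel. apply (RInt_ext (V := R_CompleteNormedModule)).
  intros t _. unfold kernel. rewrite Rinv_inv. now rewrite (Rplus_comm (/ x)).
- intros u v Hu Hv.
  assert (L := Lin [(1, v); (-1, u)] (- (5 * (v - u)))). assert (L' := Lin [(-1, v); (1, u)] (- (5 * (v - u)))).
  simpl in L, L'.
  assert (- (5 * (v - u)) * W <= 1 * arc_kernel f v + (-1 * arc_kernel f u + 0)).
  { apply L; [intros ? [<-|[<-|[]]]; simpl; lra|].
    intros k Hk. pose proof (tk_lipschitz _ _ _ _ (T k Hk) u v Hu Hv). lra. }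
  assert (- (5 * (v - u)) * W <= -1 * arc_kernel f v + (1 * arc_kernel f u + 0)).
  { apply L'; [intros ? [<-|[<-|[]]]; simpl; lra|].
    intros k Hk. pose proof (tk_lipschitz _ _ _ _ (T k Hk) u v Hu Hv). lra. }
  lra.
- lra.
- intros b z1 z2 H1 H2 H3.
  assert (L := Lin (word_comb (-1) (block_word b) z1 ++ word_comb 1 (block_word b) z2) 0).
  rewrite linear_comb_app, !linear_comb_word in L. fold (block_sum (arc_kernel f) b z1) (block_sum (arc_kernel f) b z2) in L.
  lapply L; [clear L; intros L|].
  + lapply L; [lra|]. intros k Hk. rewrite linear_comb_app, !linear_comb_word.
    pose proof (tk_incr _ _ _ _ (T k Hk) b z1 z2 H1 H2 H3). unfold block_sum in *. lra.
  + intros ax Hax. apply in_app_or in Hax. destruct Hax as [Hax|Hax]; eapply word_comb_pos; try exact Hax; lra.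
- intros b z1 z2 H1 H2 H3.
  assert (L := Lin (word_comb 1 (block_word b) z1 ++ word_comb (-1) (block_word b) z2)
    (- (/ 5 * ((z2 - z1) - (block_act b z2 - block_act b z1))))).
  rewrite linear_comb_app, !linear_comb_word in L. fold (block_sum (arc_kernel f) b z1) (block_sum (arc_kernel f) b z2) in L.
  lapply L; [clear L; intros L|].
  + lapply L; [lra|]. intros k Hk. rewrite linear_comb_app, !linear_comb_word.
    pose proof (tk_upper _ _ _ _ (T k Hk) b z1 z2 H1 H2 H3). unfold block_sum in *. lra.
  + intros ax Hax. apply in_app_or in Hax. destruct Hax as [Hax|Hax]; eapply word_comb_pos; try exact Hax; lra.
- intros z1 z2 H1 H2 H3.
  assert (L := Lin ((word_comb 1 (block_word false) z1 ++ word_comb (-1) (block_word false) z2)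
    ++ (word_comb (-1) (block_word true) z1 ++ word_comb 1 (block_word true) z2))
    (/ 5 * (block_act false z2 - block_act false z1))).
  rewrite !linear_comb_app, !linear_comb_word in L.
  lapply L; [clear L; intros L|].
  + lapply L; [unfold block_sum; lra|]. intros k Hk. rewrite !linear_comb_app, !linear_comb_word.
    pose proof (tk_twist _ _ _ _ (T k Hk) z1 z2 H1 H2 H3). unfold block_sum in *. lra.
  + intros ax Hax. apply in_app_or in Hax. destruct Hax as [Hax|Hax]; apply in_app_or in Hax;
      destruct Hax as [Hax|Hax]; eapply word_comb_pos; try exact Hax; lra.
- assert (L := Lin ((word_comb (- (3 / 2)) (block_word true) (29 / 12) ++ word_comb 1 (block_word false) (50 / 21))
    ++ word_comb 1 (block_word true) (121 / 71)) (/ 5 * (29 / 12 - 747 / 313) + / 100)).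
  rewrite !linear_comb_app, !linear_comb_word in L.
  lapply L; [clear L; intros L|].
  + lapply L; [unfold block_sum; lra|]. intros k Hk. rewrite !linear_comb_app, !linear_comb_word.
    pose proof (tk_slope _ _ _ _ (T k Hk)). unfold block_sum in *. lra.
  + intros ax Hax. apply in_app_or in Hax. destruct Hax as [Hax|Hax]; [apply in_app_or in Hax;
      destruct Hax as [Hax|Hax]|]; eapply word_comb_pos; try exact Hax; lra.
Qed.
End ArcKernelTwist.

(** * Block words and the crossing argument *)

Definition expand (X : list bool) : list bool := flat_map block_word X.
Definition blocks_act (X : list bool) (z : R) : R := word_act (expand X) z.
Definition blocks_sum (F : R -> R) (X : list bool) (z : R) : R := word_sum F (expand X) z.

Lemma expand_app X Y : expand (X ++ Y) = expand X ++ expand Y.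
Proof. apply flat_map_app. Qed.

Lemma blocks_act_app X Y z : blocks_act (X ++ Y) z = blocks_act X (blocks_act Y z).
Proof. unfold blocks_act. now rewrite expand_app, word_act_app. Qed.

Lemma blocks_sum_app F X Y z :
  blocks_sum F (X ++ Y) z = blocks_sum F X (blocks_act Y z) + blocks_sum F Y z.
Proof. unfold blocks_sum. now rewrite expand_app, word_sum_app. Qed.

Lemma blocks_act_one b z : blocks_act [b] z = block_act b z.
Proof. unfold blocks_act, expand; simpl. now rewrite app_nil_r. Qed.

Lemma blocks_sum_one F b z : blocks_sum F [b] z = block_sum F b z.
Proof. unfold blocks_sum, expand; simpl. now rewrite app_nil_r. Qed.

Lemma blocks_act_pos X z : 0 < z -> 0 < blocks_act X z.
Proof. apply word_act_pos. Qed.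

Lemma letter_act_incr L z1 z2 : 0 < z1 -> z1 <= z2 ->
  0 <= letter_act L z2 - letter_act L z1 <= z2 - z1.
Proof.
intros H1 H2. destruct L; simpl; [|lra].
assert (E : z2 / (z2 + 1) - z1 / (z1 + 1) = (z2 - z1) * / ((z1 + 1) * (z2 + 1))) by (field; lra).
rewrite E. assert (P : 1 * 1 <= (z1 + 1) * (z2 + 1)) by (apply Rmult_le_compat; lra).
assert (0 < / ((z1 + 1) * (z2 + 1)) <= 1).
{ split; [apply Rinv_0_lt_compat; lra|]. rewrite <- Rinv_1. apply Rinv_le_contravar; lra. }
split; [apply Rmult_le_pos; lra|].
assert ((z2 - z1) * / ((z1 + 1) * (z2 + 1)) <= (z2 - z1) * 1) by (apply Rmult_le_compat_l; lra). lra.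
Qed.

Lemma word_act_incr W z1 z2 : 0 < z1 -> z1 <= z2 ->
  0 <= word_act W z2 - word_act W z1 <= z2 - z1.
Proof.
intros H1 H2. induction W as [|L W IH]; simpl; [lra|].
pose proof (letter_act_incr L (word_act W z1) (word_act W z2) (word_act_pos W z1 H1)). lra.
Qed.

(** The number 2 separates the images of the two blocks, so futures are ordered as real numbers by
    their first differing block. *)
Lemma block_act_range (b : bool) z : 0 < z ->
  (if b then 2 else 1) < block_act b z < (if b then 5 / 2 else 2).
Proof.
intros H. rewrite block_act_eq by exact H. destruct b.
- split; [apply Rmult_lt_reg_r with (2 * z + 1)|apply Rmult_lt_reg_r with (2 * z + 1)]; try lra;
  replace ((5 * z + 2) / (2 * z + 1) * (2 * z + 1)) with (5 * z + 2) by (field; lra); lra.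
- split; [apply Rmult_lt_reg_r with (z + 1)|apply Rmult_lt_reg_r with (z + 1)]; try lra;
  replace ((2 * z + 1) / (z + 1) * (z + 1)) with (2 * z + 1) by (field; lra); lra.
Qed.

Lemma block_act_lower b z a : 0 < a -> a <= z -> (2 * a + 1) / (a + 1) <= 2 ->
  (2 * a + 1) / (a + 1) <= block_act b z.
Proof.
intros Ha Hz H2. destruct b.
- pose proof (block_act_range true z ltac:(lra)). simpl in *. lra.
- pose proof (word_act_incr (block_word false) a z Ha Hz) as I. fold (block_act false a) (block_act false z) in I.
  rewrite (block_act_eq false a) in I by exact Ha. lra.
Qed.

Lemma block_act_invariant b z : 8 / 5 <= z <= 5 / 2 -> 8 / 5 <= block_act b z <= 5 / 2.
Proof.
intros H. pose proof (block_act_lower b z (8 / 5)). pose proof (block_act_range b z).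
destruct b; lra.
Qed.

Lemma block_act_wide b z : 1 <= z -> 1 <= block_act b z <= 5 / 2.
Proof. intros H. pose proof (block_act_range b z). destruct b; lra. Qed.

Lemma blocks_act_invariant X z : 8 / 5 <= z <= 5 / 2 -> 8 / 5 <= blocks_act X z <= 5 / 2.
Proof.
intros H. induction X as [|b X IH]; [exact H|].
change (b :: X) with ([b] ++ X). rewrite blocks_act_app, blocks_act_one. now apply block_act_invariant.
Qed.

Lemma blocks_act_nonempty X z : X <> [] -> 0 < z -> 1 <= blocks_act X z <= 5 / 2.
Proof.
intros N H. destruct X as [|b X]; [easy|].
change (b :: X) with ([b] ++ X). rewrite blocks_act_app, blocks_act_one.
pose proof (block_act_range b (blocks_act X z) (blocks_act_pos X z H)). destruct b; lra.
Qed.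

Lemma block_act_contracts b z1 z2 : 1 <= z1 -> z1 <= z2 ->
  0 <= block_act b z2 - block_act b z1 <= / 4 * (z2 - z1).
Proof.
intros H1 H2. split; [now apply word_act_incr; lra|].
rewrite !block_act_eq by lra.
assert (G : forall c d, c = 1 -> 1 <= d -> c / ((d * z1 + 1) * (d * z2 + 1)) <= / 4).
{ intros c d -> Hd. unfold Rdiv. rewrite Rmult_1_l. apply Rinv_le_contravar; [lra|].
  assert (1 * 1 <= d * z1) by (apply Rmult_le_compat; lra).
  assert (1 * 1 <= d * z2) by (apply Rmult_le_compat; lra).
  assert (2 * 2 <= (d * z1 + 1) * (d * z2 + 1)) by (apply Rmult_le_compat; lra). lra. }
destruct b.
- replace ((5 * z2 + 2) / (2 * z2 + 1) - (5 * z1 + 2) / (2 * z1 + 1)) with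
    (1 / ((2 * z1 + 1) * (2 * z2 + 1)) * (z2 - z1)) by (field; lra).
  apply Rmult_le_compat_r; [lra|]. apply G; lra.
- replace ((2 * z2 + 1) / (z2 + 1) - (2 * z1 + 1) / (z1 + 1)) with
    (1 / ((1 * z1 + 1) * (1 * z2 + 1)) * (z2 - z1)) by (field; lra).
  apply Rmult_le_compat_r; [lra|]. apply G; lra.
Qed.

Lemma blocks_act_contracts X z1 z2 : 1 <= z1 -> z1 <= z2 ->
  0 <= blocks_act X z2 - blocks_act X z1 <= (/ 4) ^ length X * (z2 - z1).
Proof.
intros H1 H2. split; [apply word_act_incr; lra|].
induction X as [|b X IH]; [simpl; unfold blocks_act; simpl; lra|].
change (b :: X) with ([b] ++ X). rewrite !blocks_act_app, !blocks_act_one.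
assert (1 <= blocks_act X z1).
{ destruct X as [|b' X]; [exact H1|]. apply blocks_act_nonempty; [easy|lra]. }
assert (0 <= blocks_act X z2 - blocks_act X z1) by (apply word_act_incr; lra).
pose proof (block_act_contracts b (blocks_act X z1) (blocks_act X z2)).
simpl length. simpl pow. lra.
Qed.

Lemma block_word_hyperbolic b W : hyperbolic (word_mat (block_word b ++ W)).
Proof.
destruct (word_mat_nonneg W) as [P1 [P2 [P3 P4]]].
assert (E : word_mat (block_word b ++ W) =
  if b then mmul matT (mmul matT (mmul matV (mmul matV (word_mat W))))
  else mmul matT (mmul matV (word_mat W))) by (now destruct b).
rewrite E. unfold hyperbolic, mtr. destruct b; unfold mmul, matT, matV; cbn [ma mb mc md];
  rewrite Z.abs_eq; lia.
Qed.

Lemma expand_hyperbolic X : X <> [] -> hyperbolic (word_mat (expand X)).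
Proof. destruct X as [|b X]; [easy|]. intros _. apply block_word_hyperbolic. Qed.

Definition fixed_point (X : list bool) : R :=
  epsilon (inhabits 0) (fun x => 0 < x /\ blocks_act X x = x).

Lemma fixed_point_spec X : X <> [] -> 0 < fixed_point X /\ blocks_act X (fixed_point X) = fixed_point X.
Proof.
intros H. unfold fixed_point. apply epsilon_spec.
now apply word_fixed_points, expand_hyperbolic.
Qed.

Lemma fixed_point_unique X x : X <> [] -> 0 < x -> blocks_act X x = x -> fixed_point X = x.
Proof.
intros H Hx E. destruct (fixed_point_spec X H).
apply (word_fixed_point_unique (expand X)); auto using expand_hyperbolic.
Qed.

Lemma fixed_point_range X : X <> [] -> 8 / 5 <= fixed_point X <= 5 / 2.
Proof.
intros H. destruct (fixed_point_spec X H) as [P E]. set (x := fixed_point X) in *.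
assert (R1 : 1 <= x <= 5 / 2) by (rewrite <- E; now apply blocks_act_nonempty).
assert (G : forall a, 1 <= a <= 2 -> a <= x -> (2 * a + 1) / (a + 1) <= 2 -> a <= (2 * a + 1) / (a + 1) ->
  (2 * a + 1) / (a + 1) <= x).
{ intros a Ha Hx H2 H3. rewrite <- E.
  assert (Q : forall Y, a <= blocks_act Y x).
  { induction Y as [|b Y IH]; [exact Hx|].
    change (b :: Y) with ([b] ++ Y). rewrite blocks_act_app, blocks_act_one.
    eapply Rle_trans; [exact H3|]. apply block_act_lower; lra. }
  destruct X as [|b X]; [easy|].
  change (b :: X) with ([b] ++ X). rewrite blocks_act_app, blocks_act_one.
  apply block_act_lower; [lra|apply Q|exact H2]. }
(* The block TV sends 1 to 3/2 and 3/2 to 8/5, so two applications of [G] raise the lower bound from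
   1 to 8/5. *)
assert (G1 := G 1 ltac:(lra) ltac:(lra) ltac:(lra) ltac:(lra)).
assert (G2 := G (3 / 2) ltac:(lra) ltac:(lra) ltac:(lra) ltac:(lra)). lra.
Qed.

Lemma fixed_point_rotate X Y : X <> [] -> Y <> [] ->
  blocks_act X (fixed_point (Y ++ X)) = fixed_point (X ++ Y).
Proof.
intros HX HY. symmetry.
assert (N : forall U V : list bool, U <> [] -> U ++ V <> []) by (intros [|u U] V ?; easy).
destruct (fixed_point_spec (Y ++ X)) as [P E]; [auto|].
apply fixed_point_unique; [auto|now apply blocks_act_pos|].
rewrite blocks_act_app. rewrite <- (blocks_act_app Y X). now rewrite E.
Qed.

Fixpoint word_pow (X : list bool) (n : nat) : list bool :=
  match n with O => [] | S m => X ++ word_pow X m end.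

Lemma word_pow_snoc X n : word_pow X (S n) = word_pow X n ++ X.
Proof.
induction n as [|n IH]; simpl; [now rewrite app_nil_r|].
simpl in IH. rewrite IH at 1. now rewrite app_assoc.
Qed.

Lemma word_pow_length X n : length (word_pow X n) = (n * length X)%nat.
Proof. induction n as [|n IH]; simpl; [reflexivity|]. now rewrite length_app, IH. Qed.

Lemma fixed_point_pow X n : X <> [] -> blocks_act (word_pow X n) (fixed_point X) = fixed_point X.
Proof.
intros H. induction n as [|n IH]; [reflexivity|].
simpl. rewrite blocks_act_app, IH. now apply fixed_point_spec.
Qed.

(** A word stands before the point on which it acts, so its last block is the most recent and pasts
    are compared from the right end. Both words must reach the difference, which is why powers are
    later taken long enough. *)
Definition past_lt (X Y : list bool) : Prop :=
  exists p q s, X = p ++ false :: s /\ Y = q ++ true :: s.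

Definition future_lt (X Y : list bool) : Prop :=
  exists p q s, X = s ++ false :: p /\ Y = s ++ true :: q.

Lemma past_lt_rev X Y : past_lt X Y <-> future_lt (rev X) (rev Y).
Proof.
split.
- intros [p [q [s [-> ->]]]]. exists (rev p), (rev q), (rev s).
  rewrite !rev_app_distr. simpl. now rewrite <- !app_assoc.
- intros [p [q [s [EX EY]]]]. exists (rev p), (rev q), (rev s).
  rewrite <- (rev_involutive X), <- (rev_involutive Y), EX, EY, !rev_app_distr.
  simpl. now rewrite <- !app_assoc.
Qed.

Lemma future_lt_act X Y z z' : 0 < z -> 0 < z' -> future_lt X Y -> blocks_act X z <= blocks_act Y z'.
Proof.
intros Hz Hz' [p [q [s [-> ->]]]].
rewrite !blocks_act_app. change (false :: p) with ([false] ++ p). change (true :: q) with ([true] ++ q).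
rewrite !blocks_act_app, !blocks_act_one.
assert (Hp := blocks_act_pos p z Hz). assert (Hq := blocks_act_pos q z' Hz').
pose proof (block_act_range false _ Hp). pose proof (block_act_range true _ Hq). simpl in *.
pose proof (word_act_incr (expand s) (block_act false (blocks_act p z)) (block_act true (blocks_act q z'))).
unfold blocks_act in *. lra.
Qed.

Section TwistKernel.
Variable F : R -> R.
Variables M B eta : R.
Hypothesis TK : twist_kernel F M B eta.

Lemma block_sum_lipschitz b z1 z2 : 1 <= z1 -> z1 <= z2 ->
  - (4 * B * (z2 - z1)) <= block_sum F b z2 - block_sum F b z1 <= 4 * B * (z2 - z1).
Proof.
intros H1 H2. destruct (tk_constants _ _ _ _ TK) as [_ [HB _]].
assert (G : forall W, / 3 <= word_act W z1 ->
  - (B * (z2 - z1)) <= F (word_act W z2) - F (word_act W z1) <= B * (z2 - z1)).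
{ intros W HW. pose proof (word_act_incr W z1 z2 ltac:(lra) H2).
  pose proof (tk_lipschitz _ _ _ _ TK _ (word_act W z2) HW ltac:(lra)).
  assert (B * (word_act W z2 - word_act W z1) <= B * (z2 - z1)) by (apply Rmult_le_compat_l; lra). lra. }
assert (0 <= B * (z2 - z1)) by (apply Rmult_le_pos; lra).
assert (V1 : 1 / 2 <= z1 / (z1 + 1)).
{ apply Rmult_le_reg_r with (z1 + 1); [lra|]. replace (z1 / (z1 + 1) * (z1 + 1)) with z1 by (field; lra). lra. }
assert (V2 : / 3 <= z1 / (z1 + 1) / (z1 / (z1 + 1) + 1)).
{ apply Rmult_le_reg_r with (z1 / (z1 + 1) + 1); [lra|].
  replace (z1 / (z1 + 1) / (z1 / (z1 + 1) + 1) * (z1 / (z1 + 1) + 1)) with (z1 / (z1 + 1)) by (field; lra). lra. }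
unfold block_sum. destruct b; simpl.
- pose proof (G [true] ltac:(simpl; lra)). pose proof (G [true; true] ltac:(simpl; lra)).
  pose proof (G [false; true; true] ltac:(simpl; lra)). pose proof (G [false; false; true; true] ltac:(simpl; lra)).
  simpl in *. lra.
- pose proof (G [true] ltac:(simpl; lra)). pose proof (G [false; true] ltac:(simpl; lra)).
  simpl in *. lra.
Qed.

(** One block contributes at most [4 B], and distances shrink by 1/4 from block to block; the
    geometric series has sum [16 / 3 * B], below [6 B]. *)
Lemma blocks_sum_lipschitz X z1 z2 : 1 <= z1 -> z1 <= z2 ->
  - (6 * B * (z2 - z1)) <= blocks_sum F X z2 - blocks_sum F X z1 <= 6 * B * (z2 - z1).
Proof.
revert z1 z2. destruct (tk_constants _ _ _ _ TK) as [_ [HB _]].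
induction X as [|b X IH] using rev_ind; intros z1 z2 H1 H2.
- unfold blocks_sum; simpl. assert (0 <= 6 * B * (z2 - z1)) by (apply Rmult_le_pos; lra). lra.
- rewrite !blocks_sum_app, !blocks_act_one, !blocks_sum_one.
  pose proof (block_act_contracts b z1 z2 H1 H2). pose proof (block_act_wide b z1 H1).
  pose proof (IH (block_act b z1) (block_act b z2) ltac:(lra) ltac:(lra)).
  pose proof (block_sum_lipschitz b z1 z2 H1 H2).
  assert (B * (block_act b z2 - block_act b z1) <= B * (/ 4 * (z2 - z1))) by (apply Rmult_le_compat_l; lra).
  assert (0 <= B * (z2 - z1)) by (apply Rmult_le_pos; lra). lra.
Qed.

(** The bounds [tk_upper] telescope along the word, and the displacement of the last image only
    lowers the total. *)
Lemma blocks_sum_incr X z1 z2 : 8 / 5 <= z1 -> z1 <= z2 -> z2 <= 5 / 2 ->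
  0 <= blocks_sum F X z2 - blocks_sum F X z1 <= M * (z2 - z1).
Proof.
revert z1 z2. destruct (tk_constants _ _ _ _ TK) as [HM _].
induction X as [|b X IH] using rev_ind; intros z1 z2 H1 H2 H3.
- unfold blocks_sum; simpl. assert (0 <= M * (z2 - z1)) by (apply Rmult_le_pos; lra). lra.
- rewrite !blocks_sum_app, !blocks_act_one, !blocks_sum_one.
  pose proof (block_act_contracts b z1 z2 ltac:(lra) H2).
  pose proof (block_act_invariant b z1 ltac:(lra)). pose proof (block_act_invariant b z2 ltac:(lra)).
  pose proof (IH (block_act b z1) (block_act b z2) ltac:(lra) ltac:(lra) ltac:(lra)).
  pose proof (tk_incr _ _ _ _ TK b z1 z2 H1 H2 H3). pose proof (tk_upper _ _ _ _ TK b z1 z2 H1 H2 H3). lra.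
Qed.

(* The twist condition: the slope of the sum over a past is monotone in the past. *)
Lemma blocks_sum_twist X Y z1 z2 : past_lt X Y -> 8 / 5 <= z1 -> z1 <= z2 -> z2 <= 5 / 2 ->
  blocks_sum F X z2 - blocks_sum F X z1 <= blocks_sum F Y z2 - blocks_sum F Y z1.
Proof.
intros [p [q [s [-> ->]]]] H1 H2 H3.
change (false :: s) with ([false] ++ s). change (true :: s) with ([true] ++ s).
rewrite !app_assoc, !(blocks_sum_app F _ s).
assert (I1 := blocks_act_invariant s z1 ltac:(lra)). assert (I2 := blocks_act_invariant s z2 ltac:(lra)).
pose proof (blocks_act_contracts s z1 z2 ltac:(lra) H2).
set (u1 := blocks_act s z1) in *. set (u2 := blocks_act s z2) in *.
rewrite !blocks_sum_app, !blocks_act_one, !blocks_sum_one.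
assert (Rg : forall b, 8 / 5 <= block_act b u1 /\ block_act b u1 <= block_act b u2 /\ block_act b u2 <= 5 / 2).
{ intros b. pose proof (block_act_contracts b u1 u2 ltac:(lra) ltac:(lra)).
  pose proof (block_act_invariant b u1 I1). pose proof (block_act_invariant b u2 I2). lra. }
destruct (Rg false) as [A1 [A2 A3]]. destruct (Rg true) as [B1 [B2 B3]].
pose proof (blocks_sum_incr p _ _ A1 A2 A3). pose proof (blocks_sum_incr q _ _ B1 B2 B3).
pose proof (tk_twist _ _ _ _ TK u1 u2 ltac:(lra) ltac:(lra) ltac:(lra)). lra.
Qed.

(** The sum over the futures of one period; the pasts make up the other half of the cycle
    integral. *)
Definition half_value (X : list bool) : R := blocks_sum F X (fixed_point X).

Lemma half_value_app X Y : X <> [] -> Y <> [] ->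
  half_value (X ++ Y) = blocks_sum F X (fixed_point (Y ++ X)) + blocks_sum F Y (fixed_point (X ++ Y)).
Proof. intros HX HY. unfold half_value. now rewrite blocks_sum_app, fixed_point_rotate. Qed.

Lemma half_value_rotate X Y : X <> [] -> Y <> [] -> half_value (X ++ Y) = half_value (Y ++ X).
Proof. intros HX HY. rewrite !half_value_app by assumption. ring. Qed.

Lemma half_value_pow X n : X <> [] -> half_value (word_pow X (S n)) = INR (S n) * half_value X.
Proof.
intros H. assert (E : fixed_point (word_pow X (S n)) = fixed_point X).
{ apply fixed_point_unique.
  - simpl. destruct X; easy.
  - now apply fixed_point_spec.
  - now apply fixed_point_pow. }
unfold half_value. rewrite E. clear E.
induction n as [|n IH].
- simpl. rewrite app_nil_r. ring.
- change (word_pow X (S (S n))) with (X ++ word_pow X (S n)).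
  rewrite blocks_sum_app, IH, fixed_point_pow by exact H. rewrite (S_INR (S n)). ring.
Qed.

(** Since [X] is nonempty, [n] periods bring any two points of the interval within [(/ 4) ^ n] of
    each other. *)
Lemma blocks_sum_pow_error X z n : X <> [] -> 8 / 5 <= z <= 5 / 2 ->
  Rabs (blocks_sum F X (fixed_point X) - blocks_sum F X (blocks_act (word_pow X n) z)) <= 6 * B * (/ 4) ^ n.
Proof.
intros HX Hz. destruct (tk_constants _ _ _ _ TK) as [_ [HB _]].
assert (R := fixed_point_range X HX). rewrite <- (fixed_point_pow X n HX) at 1.
assert (G : forall u v, 8 / 5 <= u -> u <= v -> v <= 5 / 2 ->
  0 <= blocks_act (word_pow X n) v - blocks_act (word_pow X n) u <= (/ 4) ^ n).
{ intros u v H1 H2 H3. pose proof (blocks_act_contracts (word_pow X n) u v ltac:(lra) H2) as C.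
  rewrite word_pow_length in C. split; [lra|].
  assert ((/ 4) ^ (n * length X) <= (/ 4) ^ n).
  { destruct (length X) as [|l] eqn:E; [destruct X; easy|].
    replace (n * S l)%nat with (n + n * l)%nat by lia. rewrite pow_add.
    assert (0 <= (/ 4) ^ n) by (apply pow_le; lra).
    assert ((/ 4) ^ (n * l) <= 1) by (rewrite <- (pow1 (n * l)); apply pow_incr; lra).
    apply Rle_trans with ((/ 4) ^ n * 1); [apply Rmult_le_compat_l; lra|lra]. }
  assert (0 <= (/ 4) ^ (n * length X)) by (apply pow_le; lra).
  assert ((/ 4) ^ (n * length X) * (v - u) <= (/ 4) ^ (n * length X) * 1) by (apply Rmult_le_compat_l; lra). lra. }
assert (I1 := blocks_act_invariant (word_pow X n) z Hz).
assert (I2 := blocks_act_invariant (word_pow X n) (fixed_point X) R).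
assert (P : 0 <= 6 * B) by lra.
destruct (Rle_dec z (fixed_point X)) as [D|D].
- pose proof (G z (fixed_point X) ltac:(lra) D ltac:(lra)) as G1.
  pose proof (blocks_sum_lipschitz X (blocks_act (word_pow X n) z) (blocks_act (word_pow X n) (fixed_point X)) ltac:(lra) ltac:(lra)).
  pose proof (Rmult_le_compat_l (6 * B) _ _ P (proj2 G1)). apply Rabs_le. lra.
- pose proof (G (fixed_point X) z ltac:(lra) ltac:(lra) ltac:(lra)) as G1.
  pose proof (blocks_sum_lipschitz X (blocks_act (word_pow X n) (fixed_point X)) (blocks_act (word_pow X n) z) ltac:(lra) ltac:(lra)).
  pose proof (Rmult_le_compat_l (6 * B) _ _ P (proj2 G1)). apply Rabs_le. lra.
Qed.

Lemma pow_quarter_small c eps : 0 <= c -> 0 < eps -> exists N, forall n, (N <= n)%nat -> c * (/ 4) ^ n <= eps.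
Proof.
intros Hc Heps.
destruct (pow_lt_1_zero (/ 4) ltac:(rewrite Rabs_pos_eq; lra) (eps / (c + 1))) as [N HN].
{ apply Rdiv_lt_0_compat; lra. }
exists N. intros n Hn. specialize (HN n Hn). rewrite Rabs_pos_eq in HN by (apply pow_le; lra).
apply Rle_trans with ((c + 1) * (eps / (c + 1))); [|right; field; lra].
apply Rmult_le_compat; try lra. apply pow_le; lra.
Qed.

(* Aubry's crossing argument: exchanging the tails of two crossing periodic
   sequences does not increase the total sum. *)
Lemma half_value_crossing X Y : X <> [] -> Y <> [] ->
  fixed_point (X ++ Y) <= fixed_point (Y ++ X) ->
  (exists N, forall n, (N <= n)%nat -> past_lt (word_pow X n) (word_pow Y n)) ->
  half_value (X ++ Y) <= half_value X + half_value Y.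
Proof.
intros HX HY Hord [N HN].
destruct (tk_constants _ _ _ _ TK) as [_ [HB _]].
rewrite half_value_app by assumption.
assert (R0 : X ++ Y <> []) by (now destruct X). assert (R1 : Y ++ X <> []) by (now destruct Y).
apply fixed_point_range in R0, R1.
set (z0 := fixed_point (X ++ Y)) in *. set (z1 := fixed_point (Y ++ X)) in *.
assert (E1 : blocks_act X z1 = z0) by now apply fixed_point_rotate.
assert (E0 : blocks_act Y z0 = z1) by now apply fixed_point_rotate.
assert (Id : forall U n a b, blocks_act U a = b ->
  blocks_sum F U a = blocks_sum F (word_pow U n) a - blocks_sum F (word_pow U n) b
    + blocks_sum F U (blocks_act (word_pow U n) a)).
{ intros U n a b E.
  assert (S1 : blocks_sum F (word_pow U (S n)) a = blocks_sum F (word_pow U n) b + blocks_sum F U a)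
    by (now rewrite word_pow_snoc, blocks_sum_app, E).
  assert (S2 : blocks_sum F (word_pow U (S n)) a =
    blocks_sum F U (blocks_act (word_pow U n) a) + blocks_sum F (word_pow U n) a) by (apply blocks_sum_app).
  lra. }
apply le_epsilon. intros eps Heps.
destruct (pow_quarter_small (6 * B) (eps / 2) ltac:(lra) ltac:(lra)) as [N' HN'].
set (n := Nat.max N N'). specialize (HN n ltac:(lia)). specialize (HN' n ltac:(lia)).
pose proof (Id X n z1 z0 E1) as I1. pose proof (Id Y n z0 z1 E0) as I2.
pose proof (blocks_sum_twist _ _ z0 z1 HN ltac:(lra) Hord ltac:(lra)).
pose proof (blocks_sum_pow_error X z1 n HX R1) as Er1. pose proof (blocks_sum_pow_error Y z0 n HY R0) as Er0.
apply Rabs_le_between in Er0, Er1. unfold half_value. lra.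
Qed.
End TwistKernel.

(** * Farey pairs of words *)

Definition word_subst (L R : list bool) (P : list bool) : list bool :=
  flat_map (fun b : bool => if b then R else L) P.

Lemma word_subst_app L R P Q : word_subst L R (P ++ Q) = word_subst L R P ++ word_subst L R Q.
Proof. apply flat_map_app. Qed.

Lemma word_subst_pow L R P n : word_subst L R (word_pow P n) = word_pow (word_subst L R P) n.
Proof. induction n as [|n IH]; simpl; [reflexivity|]. now rewrite word_subst_app, IH. Qed.

Lemma word_subst_comp L R L' R' P :
  word_subst (word_subst L R L') (word_subst L R R') P = word_subst L R (word_subst L' R' P).
Proof.
induction P as [|b P IH]; [reflexivity|]. simpl. rewrite IH, word_subst_app. now destruct b.
Qed.

Lemma word_subst_length L R P : L <> [] -> R <> [] -> (length P <= length (word_subst L R P))%nat.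
Proof.
intros HL HR. induction P as [|b P IH]; simpl; [lia|]. rewrite length_app.
assert (1 <= length (if b then R else L))%nat by (destruct b, L, R; simpl; (easy || lia)). lia.
Qed.

(* The substitution [false -> L], [true -> R] preserves the lexicographic order
   of futures and of pasts. *)
Definition good_pair (L R : list bool) : Prop :=
  L <> [] /\ R <> [] /\
  exists n, forall P Q, (n <= length P)%nat -> (n <= length Q)%nat ->
    past_lt (word_subst L R P ++ L) (word_subst L R Q ++ R) /\
    future_lt (L ++ word_subst L R P) (R ++ word_subst L R Q).

Lemma good_pair_base : good_pair [false] [true].
Proof.
repeat split; try easy. exists O. intros P Q _ _. split.
- now exists (word_subst [false] [true] P), (word_subst [false] [true] Q), [].
- now exists (word_subst [false] [true] P), (word_subst [false] [true] Q), [].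
Qed.

Lemma past_lt_app X Y s : past_lt X Y -> past_lt (X ++ s) (Y ++ s).
Proof.
intros [p [q [u [-> ->]]]]. exists p, q, (u ++ s). now rewrite <- !app_assoc.
Qed.

Lemma future_lt_app X Y s : future_lt X Y -> future_lt (s ++ X) (s ++ Y).
Proof.
intros [p [q [u [-> ->]]]]. exists p, q, (s ++ u). now rewrite <- !app_assoc.
Qed.

(** The new substitution is the old one after replacing [true] by [true false]. Futures are then
    decided by the old pair directly; of pasts one first removes the common final [L]. *)
Lemma good_pair_left L R : good_pair L R -> good_pair L (R ++ L).
Proof.
intros [HL [HR [n Hn]]]. repeat split; [exact HL|now destruct R|]. exists (S n).
intros P Q HP HQ.
assert (E : forall U, word_subst L (R ++ L) U = word_subst L R (word_subst [false] [true; false] U)).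
{ intros U. rewrite <- word_subst_comp. simpl. now rewrite !app_nil_r. }
assert (Len : forall U, (length U <= length (word_subst [false] [true; false] U))%nat)
  by (intros; now apply word_subst_length).
rewrite !E. split.
- rewrite app_assoc. apply past_lt_app.
  destruct (exists_last (l := P)) as [P0 [b EP]]; [destruct P; easy|]. subst P.
  rewrite length_app in HP; simpl in HP.
  (* Both letters have images ending in [false], so once the final [L] is removed the smaller past
     still ends in [L]. *)
  assert (exists P1, (n <= length P1)%nat /\ word_subst [false] [true; false] (P0 ++ [b]) = P1 ++ [false]) as [P1 [HP1 E1]].
  { specialize (Len P0). rewrite word_subst_app. destruct b; simpl.
    - exists (word_subst [false] [true; false] P0 ++ [true]). rewrite length_app, <- app_assoc. split; [lia|reflexivity].
    - exists (word_subst [false] [true; false] P0). split; [lia|reflexivity]. }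
  rewrite E1, word_subst_app. replace (word_subst L R [false]) with L by (simpl; now rewrite app_nil_r). apply Hn; [exact HP1|].
  specialize (Len Q). lia.
- rewrite <- app_assoc.
  replace (L ++ word_subst L R (word_subst [false] [true; false] Q)) with
    (word_subst L R (false :: word_subst [false] [true; false] Q)) by reflexivity.
  apply Hn; [specialize (Len P); lia|]. specialize (Len Q). simpl. lia.
Qed.

(** The mirror image of [good_pair_left]: now the futures share the initial [R], and every image
    begins with [true]. *)
Lemma good_pair_right L R : good_pair L R -> good_pair (R ++ L) R.
Proof.
intros [HL [HR [n Hn]]]. repeat split; [now destruct R|exact HR|]. exists (S n).
intros P Q HP HQ.
assert (E : forall U, word_subst (R ++ L) R U = word_subst L R (word_subst [true; false] [true] U)).
{ intros U. rewrite <- word_subst_comp. simpl. now rewrite !app_nil_r. }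
assert (Len : forall U, (length U <= length (word_subst [true; false] [true] U))%nat)
  by (intros; now apply word_subst_length).
rewrite !E. split.
- rewrite app_assoc.
  replace (word_subst L R (word_subst [true; false] [true] P) ++ R) with
    (word_subst L R (word_subst [true; false] [true] P ++ [true])) by (rewrite word_subst_app; simpl; now rewrite app_nil_r).
  apply Hn; [specialize (Len P); rewrite length_app; lia|specialize (Len Q); lia].
- rewrite <- app_assoc. apply future_lt_app.
  destruct Q as [|b Q]; [simpl in HQ; lia|]. simpl in HQ.
  assert (exists Q1, (n <= length Q1)%nat /\ word_subst [true; false] [true] (b :: Q) = true :: Q1) as [Q1 [HQ1 E1]].
  { specialize (Len Q). destruct b; simpl; eexists; (split; [|reflexivity]); simpl; lia. }
  rewrite E1. simpl. apply Hn; [|exact HQ1]. specialize (Len P). lia.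
Qed.

Lemma word_pow_rev X n : word_pow (rev X) n = rev (word_pow X n).
Proof. induction n as [|n IH]; [reflexivity|]. rewrite (word_pow_snoc X), rev_app_distr, <- IH. reflexivity. Qed.

Lemma rev_nonempty (X : list bool) : X <> [] -> rev X <> [].
Proof. intros H E. apply H. rewrite <- (rev_involutive X), E. reflexivity. Qed.

Section Value.
Variable F : R -> R.
Variables M B eta : R.
Hypothesis TK : twist_kernel F M B eta.

(** The reversed word accounts for the pasts, by [rev_expand] and the symmetry of [F] under
    inversion. *)
Definition value (X : list bool) : R := half_value F X + half_value F (rev X).

Lemma value_rotate X Y : value (X ++ Y) = value (Y ++ X).
Proof.
destruct X as [|x X]; [now rewrite app_nil_r|]. destruct Y as [|y Y]; [now rewrite app_nil_r|].
unfold value. rewrite !rev_app_distr. f_equal.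
- now apply half_value_rotate.
- apply half_value_rotate; now apply rev_nonempty.
Qed.

Lemma value_pow X n : X <> [] -> value (word_pow X (S n)) = INR (S n) * value X.
Proof.
intros H. unfold value. rewrite <- word_pow_rev, !half_value_pow by auto using rev_nonempty. ring.
Qed.

Lemma fixed_point_lt X Y n : X <> [] -> Y <> [] -> future_lt (word_pow X n) (word_pow Y n) ->
  fixed_point X <= fixed_point Y.
Proof.
intros HX HY H. rewrite <- (fixed_point_pow X n HX), <- (fixed_point_pow Y n HY).
apply future_lt_act; [now apply fixed_point_spec|now apply fixed_point_spec|exact H].
Qed.

(** Reversal exchanges past and future, so the four order conditions are the hypotheses of the
    crossing argument for [X], [Y] and for their reversals. *)
Lemma value_crossing X Y N : X <> [] -> Y <> [] ->
  (forall n, (N <= n)%nat ->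
    past_lt (word_pow X n) (word_pow Y n) /\ future_lt (word_pow X n) (word_pow Y n) /\
    future_lt (word_pow (X ++ Y) n) (word_pow (Y ++ X) n) /\
    past_lt (word_pow (Y ++ X) n) (word_pow (X ++ Y) n)) ->
  value (X ++ Y) <= value X + value Y.
Proof.
intros HX HY H.
assert (HX' := rev_nonempty X HX). assert (HY' := rev_nonempty Y HY).
assert (C1 : half_value F (X ++ Y) <= half_value F X + half_value F Y).
{ apply (half_value_crossing F M B eta TK X Y HX HY).
  - apply (fixed_point_lt _ _ N); [now destruct X|now destruct Y|]. apply H. lia.
  - exists N. intros n Hn. now apply H. }
assert (C2 : half_value F (rev X ++ rev Y) <= half_value F (rev X) + half_value F (rev Y)).
{ apply (half_value_crossing F M B eta TK _ _ HX' HY').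
  - apply (fixed_point_lt _ _ N); [now destruct (rev X)|now destruct (rev Y)|].
    rewrite <- !rev_app_distr, !word_pow_rev. apply -> past_lt_rev. apply H. lia.
  - exists N. intros n Hn. rewrite !word_pow_rev. apply past_lt_rev. rewrite !rev_involutive. now apply H. }
unfold value. rewrite rev_app_distr, (half_value_rotate F (rev Y)) by assumption. lra.
Qed.

(** The first word begins and ends with [false], the second with [true]. This alone orders the two
    words, and also their products in either order, both in the future and in the past. *)
Lemma good_pair_crossing L R P1 P2 Q1 Q2 : good_pair L R ->
  false :: P1 = P2 ++ [false] -> true :: Q1 = Q2 ++ [true] ->
  value (word_subst L R (false :: P1) ++ word_subst L R (true :: Q1)) <=
  value (word_subst L R (false :: P1)) + value (word_subst L R (true :: Q1)).
Proof.
intros [HL [HR [n0 Hn0]]] EP EQ.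
set (P := false :: P1) in *. set (Q := true :: Q1) in *.
assert (Shape : forall U V n, (S n0 <= n)%nat ->
  past_lt (word_pow (word_subst L R (U ++ [false])) n) (word_pow (word_subst L R (V ++ [true])) n)).
{ intros U V [|n] Hn; [lia|]. rewrite <- !word_subst_pow, !word_pow_snoc, !app_assoc.
  rewrite !(word_subst_app L R _ [false]), !(word_subst_app L R _ [true]). simpl. rewrite !app_nil_r.
  apply Hn0; rewrite length_app, word_pow_length, length_app; simpl; nia. }
assert (Shape' : forall (U V : list bool) n, (S n0 <= n)%nat ->
  future_lt (word_pow (word_subst L R (false :: U)) n) (word_pow (word_subst L R (true :: V)) n)).
{ intros U V [|n] Hn; [lia|]. rewrite <- !word_subst_pow. simpl word_pow.
  change (word_subst L R ((false :: U) ++ word_pow (false :: U) n)) with (L ++ word_subst L R (U ++ word_pow (false :: U) n)).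
  change (word_subst L R ((true :: V) ++ word_pow (true :: V) n)) with (R ++ word_subst L R (V ++ word_pow (true :: V) n)).
  apply Hn0; rewrite length_app, word_pow_length; simpl; nia. }
assert (NP : word_subst L R P <> []) by (unfold P; simpl; now destruct L).
assert (NQ : word_subst L R Q <> []) by (unfold Q; simpl; now destruct R).
apply (value_crossing _ _ (S n0) NP NQ).
intros n Hn. rewrite <- !word_subst_app. repeat split.
- rewrite EP, EQ. now apply Shape.
- now apply Shape'.
- now apply (Shape' (P1 ++ Q) (Q1 ++ P)).
- rewrite EP, EQ at 1. rewrite EP, EQ, !app_assoc. now apply Shape.
Qed.

(* A vertex [R ++ L] of the Farey tree together with its neighbours
   [V^k ++ L] and [R ++ V^l] at some later level. *)
Definition farey_triple (U V W : list bool) : Prop :=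
  exists L R k l, good_pair L R /\ V = R ++ L /\
    U = word_pow V k ++ L /\ W = R ++ word_pow V l.

Lemma farey_triple_base L R : good_pair L R -> farey_triple L (R ++ L) R.
Proof.
intros H. exists L, R, O, O. simpl. now rewrite app_nil_r.
Qed.

Lemma farey_triple_next U V W : farey_triple U V W -> farey_triple (V ++ U) V (W ++ V).
Proof.
intros [L [R [k [l [H [HV [-> ->]]]]]]]. exists L, R, (S k), (S l).
rewrite (word_pow_snoc V l). simpl word_pow. now rewrite <- !app_assoc.
Qed.

Lemma word_pow_shift P1 P2 n : word_pow (P1 ++ P2) n ++ P1 = P1 ++ word_pow (P2 ++ P1) n.
Proof.
induction n as [|n IH]; simpl; [now rewrite app_nil_r|].
now rewrite <- app_assoc, IH, <- !app_assoc.
Qed.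

Lemma word_pow_add X m n : word_pow X (m + n) = word_pow X m ++ word_pow X n.
Proof. induction m as [|m IH]; simpl; [reflexivity|]. now rewrite IH, app_assoc. Qed.

(** Up to rotation the neighbours are the images of [false (true false)^k] and
    [true (false true)^l], which begin and end with the required letters, and their product rotates
    to [V ^ (k + l + 1)]. *)
Lemma farey_triple_value L R k l : good_pair L R -> let V := R ++ L in
  INR (S (k + l)) * value V <= value (word_pow V k ++ L) + value (R ++ word_pow V l).
Proof.
intros HG V. assert (HG' := HG). destruct HG' as [HL [HR _]].
assert (HV : V <> []) by (unfold V; now destruct R).
rewrite <- value_pow by exact HV.
assert (EV : word_subst L R [true; false] = V) by (simpl; now rewrite app_nil_r).
assert (X : L ++ word_pow V k = word_subst L R (false :: word_pow [true; false] k)).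
{ change (false :: word_pow [true; false] k) with ([false] ++ word_pow [true; false] k).
  rewrite word_subst_app, word_subst_pow, EV. simpl. now rewrite app_nil_r. }
assert (Y : word_pow V l ++ R = word_subst L R (true :: word_pow [false; true] l)).
{ change (true :: word_pow [false; true] l) with ([true] ++ word_pow ([false] ++ [true]) l).
  rewrite <- word_pow_shift, word_subst_app, word_subst_pow.
  change ([true] ++ [false]) with [true; false]. rewrite EV. simpl. now rewrite app_nil_r. }
rewrite (value_rotate (word_pow V k)), (value_rotate R), X, Y.
eapply Rle_trans; [|apply (good_pair_crossing L R _ (word_pow [false; true] k) _ (word_pow [true; false] l) HG)].
- right. rewrite <- X, <- Y, <- app_assoc, (app_assoc (word_pow V k)), <- word_pow_add.
  rewrite value_rotate, <- app_assoc, (value_rotate (word_pow V (k + l))). fold V.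
  change (word_pow V (S (k + l))) with (V ++ word_pow V (k + l)). reflexivity.
- change (false :: word_pow [true; false] k) with ([false] ++ word_pow ([true] ++ [false]) k).
  now rewrite <- word_pow_shift.
- change (true :: word_pow [false; true] l) with ([true] ++ word_pow ([false] ++ [true]) l).
  now rewrite <- word_pow_shift.
Qed.
End Value.

(** * Farey levels and convexity *)

Fixpoint consecutive2 {A} (P : A -> A -> Prop) (l : list A) : Prop :=
  match l with
  | X :: ((Y :: _) as t) => P X Y /\ consecutive2 P t
  | _ => True
  end.

Fixpoint consecutive3 {A} (P : A -> A -> A -> Prop) (l : list A) : Prop :=
  match l with
  | X :: ((Y :: (Z :: _) as t') as t) => P X Y Z /\ consecutive3 P t
  | _ => True
  end.

Lemma consecutive2_impl {A} (P Q : A -> A -> Prop) l :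
  (forall X Y, P X Y -> Q X Y) -> consecutive2 P l -> consecutive2 Q l.
Proof.
intros H. induction l as [|X [|Y t] IH]; [trivial|trivial|].
intros [H1 H2]. split; [now apply H|now apply IH].
Qed.

Lemma consecutive2_and {A} (P Q : A -> A -> Prop) l :
  consecutive2 P l -> consecutive2 Q l -> consecutive2 (fun X Y => P X Y /\ Q X Y) l.
Proof. induction l as [|X [|Y t] IH]; simpl in *; tauto. Qed.

Lemma consecutive3_impl {A} (P Q : A -> A -> A -> Prop) (S : A -> A -> Prop) l :
  (forall X Y Z, S X Y -> S Y Z -> P X Y Z -> Q X Y Z) ->
  consecutive2 S l -> consecutive3 P l -> consecutive3 Q l.
Proof.
intros H. induction l as [|X [|Y [|Z t]] IH]; [trivial|trivial|trivial|].
intros [S1 [S2 S3]] [H1 H2]. split; [now apply H|]. apply IH; [now split|exact H2].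
Qed.

Lemma consecutive2_pairs {A} (P : A -> A -> Prop) l :
  (forall X Y Z, P X Y -> P Y Z -> P X Z) -> consecutive2 P l ->
  forall X Y, In X l -> In Y l -> X = Y \/ P X Y \/ P Y X.
Proof.
intros Tr.
assert (Hd : forall l X, consecutive2 P (X :: l) -> forall Y, In Y l -> P X Y).
{ induction l0 as [|Z t IH]; intros X H Y HY; [easy|]. simpl in H. destruct H as [H1 H2].
  destruct HY as [<-|HY]; [exact H1|]. apply (Tr _ Z); [exact H1|]. now apply IH. }
induction l as [|Z t IH]; intros H X Y HX HY; [easy|].
assert (Ht : consecutive2 P t) by (destruct t; [exact I|apply H]).
destruct HX as [<-|HX], HY as [<-|HY]; [now left| | |now apply IH].
- right; left. now apply (Hd t).
- right; right. now apply (Hd t).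
Qed.

Section ConvexList.
Context {A : Type}.
Variables (x y : A -> R) (s : A -> A -> R).

Definition slope_step (X Y : A) : Prop := x X < x Y /\ y Y - y X = s X Y * (x Y - x X).

Lemma slopes_ge_head l X Y c : consecutive3 (fun U V W => s U V <= s V W) (X :: Y :: l) ->
  c <= s X Y -> consecutive2 (fun U V => c <= s U V) (X :: Y :: l).
Proof.
revert X Y. induction l as [|Z t IH]; intros X Y H Hc; [now simpl|].
destruct H as [H1 H2]. split; [exact Hc|]. apply IH; [exact H2|lra].
Qed.

Lemma slopes_le_last l X Y c : consecutive3 (fun U V W => s U V <= s V W) (l ++ [X; Y]) ->
  s X Y <= c -> consecutive2 (fun U V => s U V <= c) (l ++ [X; Y]).
Proof.
induction l as [|Z [|Z' t] IH]; intros H Hc.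
- now simpl.
- simpl in *. repeat split; lra.
- simpl app in *. destruct (t ++ [X; Y]) as [|Z'' t''] eqn:E; [now destruct t|].
  destruct H as [H1 H2]. specialize (IH H2 Hc). split; [|exact IH].
  destruct IH as [IH _]. lra.
Qed.

Lemma convex_list_support l : consecutive2 slope_step l ->
  consecutive3 (fun U V W => s U V <= s V W) l ->
  forall V, In V l -> exists m, forall Q, In Q l -> y V + m * (x Q - x V) <= y Q.
Proof.
intros H2 H3.
(* The supporting slope is kept above the first slope of the list, so that the support inequality
   survives when a vertex is prepended. *)
assert (K : forall l X Y, consecutive2 slope_step (X :: Y :: l) ->
  consecutive3 (fun U V W => s U V <= s V W) (X :: Y :: l) ->
  (forall V, In V (X :: Y :: l) -> exists m, s X Y <= m /\
     forall Q, In Q (X :: Y :: l) -> y V + m * (x Q - x V) <= y Q)).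
{ clear. induction l as [|Z t IH]; intros X Y [[S1 S2] H2] H3 V HV.
  - destruct HV as [<-|[<-|[]]]; exists (s X Y); (split; [lra|]); intros Q [<-|[<-|[]]]; lra.
  - destruct H3 as [H3 H3']. specialize (IH Y Z H2 H3').
    assert (HY : exists m, s Y Z <= m /\ forall Q, In Q (Y :: Z :: t) -> y Y + m * (x Q - x Y) <= y Q)
      by (apply IH; now left).
    assert (Hmono : forall Q, In Q (Y :: Z :: t) -> x Y <= x Q).
    { intros Q HQ. destruct HQ as [<-|HQ]; [lra|].
      assert (C : consecutive2 (fun U W => x U < x W) (Y :: Z :: t)).
      { eapply consecutive2_impl; [|exact H2]. intros ? ? [? ?]; assumption. }
      revert C HQ. clear. revert Y. generalize (Z :: t). induction l as [|W l IH]; intros Y C HQ; [easy|].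
      destruct C as [C1 C2]. destruct HQ as [<-|HQ]; [lra|]. specialize (IH W C2 HQ). lra. }
    destruct HV as [<-|HV].
    + exists (s X Y). split; [lra|]. intros Q HQ. destruct HQ as [<-|HQ]; [lra|].
      destruct HY as [m [Hm Hs]]. specialize (Hs Q HQ). specialize (Hmono Q HQ).
      assert (s X Y * (x Q - x Y) <= m * (x Q - x Y)) by (apply Rmult_le_compat_r; lra). lra.
    + destruct (IH V HV) as [m [Hm Hs]]. exists m. split; [lra|]. intros Q [<-|HQ]; [|now apply Hs].
      specialize (Hs Y (or_introl eq_refl)).
      assert (s X Y * (x Y - x X) <= m * (x Y - x X)) by (apply Rmult_le_compat_r; lra). lra. }
intros V HV. destruct l as [|X [|Y l]].
- easy.
- exists 0. intros Q HQ. destruct HV as [<-|[]], HQ as [<-|[]]. lra.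
- destruct (K l X Y H2 H3 V HV) as [m [_ Hm]]. now exists m.
Qed.
End ConvexList.

(** * Words as Farey fractions *)

Definition word_num (X : list bool) : Z := Z.of_nat (count_occ Bool.bool_dec X true).
(** The block [false] stands for 0/1 and [true] for 1/2; numerators and denominators add under
    concatenation, as for mediants. *)
Definition word_den (X : list bool) : Z := (Z.of_nat (length X) + word_num X)%Z.

Lemma word_num_app X Y : word_num (X ++ Y) = (word_num X + word_num Y)%Z.
Proof. unfold word_num. rewrite count_occ_app. lia. Qed.

Lemma word_den_app X Y : word_den (X ++ Y) = (word_den X + word_den Y)%Z.
Proof. unfold word_den. rewrite length_app, word_num_app. lia. Qed.

Lemma word_den_pow X n : word_den (word_pow X n) = (Z.of_nat n * word_den X)%Z.
Proof. induction n as [|n IH]; simpl word_pow; [reflexivity|]. rewrite word_den_app, IH. lia. Qed.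

Lemma word_num_bounds X : (0 <= word_num X /\ 2 * word_num X <= word_den X)%Z.
Proof.
unfold word_den, word_num.
pose proof (count_occ_bound Bool.bool_dec true X). lia.
Qed.

Lemma word_den_pos X : X <> [] -> (0 < word_den X)%Z.
Proof. intros H. unfold word_den. pose proof (word_num_bounds X). destruct X; [easy|]. simpl length. lia. Qed.

(** The larger neighbour comes first in the product, as in the recursion for the Markov
    irrationalities. *)
Fixpoint insert_mediants (l : list (list bool)) : list (list bool) :=
  match l with
  | X :: ((Y :: _) as t) => X :: (Y ++ X) :: insert_mediants t
  | _ => l
  end.

Fixpoint farey_level (n : nat) : list (list bool) :=
  match n with
  | O => [[false]; [true]]
  | S m => insert_mediants (farey_level m)
  end.

Definition farey_adjacent (X Y : list bool) : Prop :=
  good_pair X Y /\ (word_den X * word_num Y - word_num X * word_den Y = 1)%Z.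

Lemma farey_adjacent_mediant X Y : farey_adjacent X Y ->
  farey_adjacent X (Y ++ X) /\ farey_adjacent (Y ++ X) Y.
Proof.
intros [H1 H2]. split; split.
- now apply good_pair_left.
- rewrite word_num_app, word_den_app. lia.
- now apply good_pair_right.
- rewrite word_num_app, word_den_app. lia.
Qed.

Lemma insert_mediants_consecutive2 (P : list bool -> list bool -> Prop) l :
  (forall X Y, P X Y -> P X (Y ++ X) /\ P (Y ++ X) Y) ->
  consecutive2 P l -> consecutive2 P (insert_mediants l).
Proof.
intros H. induction l as [|X [|Y t] IH]; [trivial|trivial|].
intros [H1 H2]. specialize (IH H2). destruct (H X Y H1) as [HA HB].
change (insert_mediants (X :: Y :: t)) with (X :: (Y ++ X) :: insert_mediants (Y :: t)).
assert (E : exists u, insert_mediants (Y :: t) = Y :: u) by (destruct t; simpl; eauto).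
destruct E as [u E]. rewrite E in *. simpl. auto.
Qed.

(** In the refined list a consecutive triple is either a new mediant between its parents or an old
    vertex between two new mediants. *)
Lemma insert_mediants_consecutive3 (P : list bool -> list bool -> Prop) (Q : list bool -> list bool -> list bool -> Prop) l :
  (forall X Y, P X Y -> Q X (Y ++ X) Y) ->
  (forall X Y Z, Q X Y Z -> Q (Y ++ X) Y (Z ++ Y)) ->
  consecutive2 P l -> consecutive3 Q l -> consecutive3 Q (insert_mediants l).
Proof.
intros HP HQ. induction l as [|X [|Y [|Z t]] IH]; [trivial|trivial| |].
- intros [H1 _] _. simpl. auto.
- intros [H1 H2] [H3 H4]. specialize (IH H2 H4).
  change (insert_mediants (X :: Y :: Z :: t)) with (X :: (Y ++ X) :: insert_mediants (Y :: Z :: t)).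
  change (insert_mediants (Y :: Z :: t)) with (Y :: (Z ++ Y) :: insert_mediants (Z :: t)) in *.
  simpl. simpl in IH. auto.
Qed.

Lemma farey_level_adjacent n : consecutive2 farey_adjacent (farey_level n).
Proof.
induction n as [|n IH].
- split; [|exact I]. split; [apply good_pair_base|reflexivity].
- apply insert_mediants_consecutive2; [apply farey_adjacent_mediant|exact IH].
Qed.

Lemma farey_level_triple n : consecutive3 farey_triple (farey_level n).
Proof.
induction n as [|n IH]; [exact I|].
apply (insert_mediants_consecutive3 farey_adjacent).
- intros X Y [H _]. now apply farey_triple_base.
- apply farey_triple_next.
- apply farey_level_adjacent.
- exact IH.
Qed.

(** The second word is the fraction [1 / (n + 2)]; the pair carries the first slope of the level. *)
Lemma farey_level_head n : exists t, farey_level n = [false] :: (true :: repeat false n) :: t.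
Proof.
induction n as [|n [t IH]]; [now exists []|].
simpl farey_level. rewrite IH.
exists (insert_mediants ((true :: repeat false n) :: t)).
change (repeat false (S n)) with (false :: repeat false n). rewrite repeat_cons. reflexivity.
Qed.

Lemma insert_mediants_last l X Y : exists l', insert_mediants (l ++ [X; Y]) = l' ++ [Y ++ X; Y].
Proof.
induction l as [|Z [|Z' t] [l' IH]].
- now exists [X].
- exists [Z; X ++ Z; X]. reflexivity.
- exists (Z :: (Z' ++ Z) :: l').
  change (insert_mediants ((Z :: Z' :: t) ++ [X; Y])) with (Z :: (Z' ++ Z) :: insert_mediants ((Z' :: t) ++ [X; Y])).
  now rewrite IH.
Qed.

(** The word before [[true]] is the fraction [n / (2 n + 1)]; the pair carries the last slope of the
    level. *)
Lemma farey_level_last n : exists l, farey_level n = l ++ [repeat true n ++ [false]; [true]].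
Proof.
induction n as [|n [l IH]]; [now exists []|].
simpl farey_level. rewrite IH.
destruct (insert_mediants_last l (repeat true n ++ [false]) [true]) as [l' E]. exists l'. exact E.
Qed.

Lemma insert_mediants_incl l X : In X l -> In X (insert_mediants l).
Proof.
induction l as [|Y [|Z t] IH]; auto.
change (insert_mediants (Y :: Z :: t)) with (Y :: (Z ++ Y) :: insert_mediants (Z :: t)).
intros [<-|H]; [now left|]. right. right. now apply IH.
Qed.

Lemma farey_level_incl n m X : (n <= m)%nat -> In X (farey_level n) -> In X (farey_level m).
Proof. intros H HX. induction H; [exact HX|]. now apply insert_mediants_incl. Qed.

Lemma insert_mediants_in l X : In X (insert_mediants l) ->
  In X l \/ exists l1 U V l2, l = l1 ++ U :: V :: l2 /\ X = V ++ U.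
Proof.
induction l as [|Y [|Z t] IH]; auto.
change (insert_mediants (Y :: Z :: t)) with (Y :: (Z ++ Y) :: insert_mediants (Z :: t)).
intros [<-|[<-|H]].
- left. now left.
- right. now exists [], Y, Z, t.
- destruct (IH H) as [H'|[l1 [U [V [l2 [-> ->]]]]]]; [left; now right|].
  right. now exists (Y :: l1), U, V, l2.
Qed.

Lemma consecutive2_app {A} (P : A -> A -> Prop) l1 U V l2 :
  consecutive2 P (l1 ++ U :: V :: l2) -> P U V.
Proof.
induction l1 as [|X [|Y t] IH]; simpl; intros H; [apply H|apply H|]. apply IH. apply H.
Qed.

Lemma farey_level_nonempty n X : In X (farey_level n) -> X <> [].
Proof.
revert X. induction n as [|n IH]; intros X H.
- destruct H as [<-|[<-|[]]]; easy.
- change (farey_level (S n)) with (insert_mediants (farey_level n)) in H.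
  apply insert_mediants_in in H. destruct H as [H|[l1 [U [V [l2 [E ->]]]]]]; [now apply IH|].
  assert (V <> []) by (apply IH; rewrite E; apply in_or_app; right; right; now left). now destruct V.
Qed.

Lemma word_pow_one (b : bool) n : word_pow [b] n = repeat b n.
Proof. induction n as [|n IH]; [reflexivity|]. simpl. now rewrite IH. Qed.

Lemma rev_repeat (b : bool) n : rev (repeat b n) = repeat b n.
Proof. induction n as [|n IH]; [reflexivity|]. simpl. rewrite IH. symmetry. apply repeat_cons. Qed.

Definition node_x (X : list bool) : R := IZR (word_num X) / IZR (word_den X).

Lemma node_x_range X : X <> [] -> 0 <= node_x X <= 1 / 2.
Proof.
intros H. assert (D := word_den_pos X H). destruct (word_num_bounds X) as [N1 N2].
apply IZR_lt in D. apply IZR_le in N1, N2. rewrite mult_IZR in N2. unfold node_x. split.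
- apply Rmult_le_pos; [lra|left; now apply Rinv_0_lt_compat].
- apply Rmult_le_reg_r with (IZR (word_den X)); [lra|].
  replace (IZR (word_num X) / IZR (word_den X) * IZR (word_den X)) with (IZR (word_num X)) by (field; lra). lra.
Qed.

(** * Slopes between neighbouring Farey nodes *)

Section Nodes.
Variable F : R -> R.
Variables M B eta : R.
Hypothesis TK : twist_kernel F M B eta.

(** The mean over the letters: the expansion of [X] in T and V has [2 * word_den X] letters. *)
Definition node_y (X : list bool) : R := value F X / (2 * IZR (word_den X)).

(** For Farey neighbours the abscissae differ by the inverse of the product of the denominators,
    which clears the difference quotient. *)
Definition farey_slope (X Y : list bool) : R :=
  (IZR (word_den X) * value F Y - IZR (word_den Y) * value F X) / 2.

Lemma farey_adjacent_step X Y : farey_adjacent X Y -> slope_step node_x node_y farey_slope X Y.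
Proof.
intros [[HX [HY _]] D].
assert (DX := IZR_lt _ _ (word_den_pos X HX)). assert (DY := IZR_lt _ _ (word_den_pos Y HY)).
apply (f_equal IZR) in D. rewrite minus_IZR, !mult_IZR in D.
assert (E : node_x Y - node_x X = / (IZR (word_den X) * IZR (word_den Y))).
{ unfold node_x. apply Rmult_eq_reg_r with (IZR (word_den X) * IZR (word_den Y)); [|nra].
  transitivity (IZR (word_den X) * IZR (word_num Y) - IZR (word_num X) * IZR (word_den Y)); [field; lra|].
  rewrite D. field. lra. }
split.
- assert (0 < / (IZR (word_den X) * IZR (word_den Y))) by (apply Rinv_0_lt_compat, Rmult_lt_0_compat; lra). lra.
- rewrite E. unfold node_y, farey_slope. field. lra.
Qed.

(** Since the denominators of [U] and [W] add up to [k + l + 1] times that of [V], the claim is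
    [farey_triple_value] multiplied by the denominator of [V]. *)
Lemma farey_triple_slope U V W : farey_triple U V W -> farey_slope U V <= farey_slope V W.
Proof.
intros [L [R [k [l [HG [EV [-> ->]]]]]]].
assert (T := farey_triple_value F M B eta TK L R k l HG). cbn zeta in T. rewrite <- EV in T.
destruct HG as [HL [HR _]].
assert (DV : 0 < IZR (word_den V)) by (apply IZR_lt, word_den_pos; rewrite EV; now destruct R).
assert (DD : IZR (word_den (word_pow V k ++ L)) + IZR (word_den (R ++ word_pow V l)) = INR (S (k + l)) * IZR (word_den V)).
{ rewrite <- plus_IZR, INR_IZR_INZ, <- mult_IZR, !word_den_app, !word_den_pow. f_equal.
  assert (word_den V = word_den R + word_den L)%Z by (rewrite EV; apply word_den_app). nia. }
unfold farey_slope.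
apply (Rmult_le_compat_l (IZR (word_den V))) in T; [|lra].
set (u := IZR (word_den (word_pow V k ++ L))) in *. set (w := IZR (word_den (R ++ word_pow V l))) in *.
assert ((u + w) * value F V = IZR (word_den V) * (INR (S (k + l)) * value F V)) by (rewrite DD; ring).
lra.
Qed.

Lemma blocks_sum_pow_fixed X n : X <> [] ->
  blocks_sum F (word_pow X n) (fixed_point X) = INR n * half_value F X.
Proof.
intros H. induction n as [|n IH]; [unfold blocks_sum; simpl; ring|].
simpl word_pow. rewrite blocks_sum_app, IH, fixed_point_pow, S_INR by exact H. unfold half_value. ring.
Qed.

Lemma block_sum_pos b z : 0 < z -> 0 < block_sum F b z.
Proof.
intros H. unfold block_sum.
assert (G : forall W, 0 <= word_sum F W z).
{ induction W as [|L W IH]; simpl; [lra|].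
  pose proof (tk_pos _ _ _ _ TK _ (letter_act_pos L _ (word_act_pos W z H))). lra. }
destruct b; simpl block_word; cbn [word_sum].
- pose proof (tk_pos _ _ _ _ TK _ (word_act_pos [false; false; true; true] z H)).
  pose proof (G [false; true; true]). cbn [word_sum] in *. lra.
- pose proof (tk_pos _ _ _ _ TK _ (word_act_pos [false; true] z H)).
  pose proof (G [true]). cbn [word_sum] in *. lra.
Qed.

Lemma half_value_one b : half_value F [b] = block_sum F b (fixed_point [b]).
Proof. apply blocks_sum_one. Qed.

(** Up to [6 B], uniformly in [n], the blocks [false] contribute [n] times the half value of
    [[false]]. The denominator [n + 2] leaves two more such half values, at most [4 B] together. *)
Lemma first_slope n : - (10 * B) <= farey_slope [false] (true :: repeat false n).
Proof.
destruct (tk_constants _ _ _ _ TK) as [_ [HB _]].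
assert (V0 : value F [false] = 2 * half_value F [false]) by (unfold value; simpl; ring).
assert (N : forall U : list bool, [true] ++ U <> []) by easy.
assert (V1 : value F (true :: repeat false n) = 2 * half_value F ([true] ++ repeat false n)).
{ unfold value. change (rev (true :: repeat false n)) with (rev (repeat false n) ++ [true]).
  rewrite rev_repeat. change (true :: repeat false n) with ([true] ++ repeat false n).
  destruct n as [|n]; [simpl; ring|].
  rewrite (half_value_rotate F (repeat false (S n))) by easy. ring. }
assert (H1 : INR n * half_value F [false] - 6 * B <= half_value F ([true] ++ repeat false n)).
{ unfold half_value at 2. rewrite blocks_sum_app, blocks_sum_one.
  set (x := fixed_point ([true] ++ repeat false n)).
  assert (Rx : 8 / 5 <= x <= 5 / 2) by (apply fixed_point_range; easy).
  assert (Ra : 8 / 5 <= fixed_point [false] <= 5 / 2) by (apply fixed_point_range; easy).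
  pose proof (block_sum_pos true (blocks_act (repeat false n) x) (blocks_act_pos _ x ltac:(lra))).
  rewrite <- blocks_sum_pow_fixed, word_pow_one by easy.
  destruct (Rle_dec x (fixed_point [false])) as [D|D].
  - pose proof (blocks_sum_lipschitz F M B eta TK (repeat false n) x (fixed_point [false]) ltac:(lra) D).
    assert (6 * B * (fixed_point [false] - x) <= 6 * B * 1) by (apply Rmult_le_compat_l; lra). lra.
  - pose proof (blocks_sum_lipschitz F M B eta TK (repeat false n) (fixed_point [false]) x ltac:(lra) ltac:(lra)).
    assert (6 * B * (x - fixed_point [false]) <= 6 * B * 1) by (apply Rmult_le_compat_l; lra). lra. }
assert (H2 : half_value F [false] <= 2 * B).
{ rewrite half_value_one. unfold block_sum; cbn [block_word word_sum].
  assert (P := proj1 (fixed_point_spec [false] ltac:(easy))).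
  pose proof (tk_bound _ _ _ _ TK _ (word_act_pos [false; true] _ P)).
  pose proof (tk_bound _ _ _ _ TK _ (word_act_pos [true] _ P)). lra. }
assert (D : IZR (word_den (true :: repeat false n)) = INR n + 2).
{ rewrite INR_IZR_INZ, <- plus_IZR. f_equal. unfold word_den, word_num. simpl length. rewrite repeat_length.
  rewrite count_occ_cons_eq by reflexivity.
  replace (count_occ Bool.bool_dec (repeat false n) true) with O; [lia|].
  symmetry. apply count_occ_not_In. intros HI. apply repeat_spec in HI. discriminate. }
unfold farey_slope. rewrite V0, V1, D.
replace (IZR (word_den [false])) with 1 by reflexivity. lra.
Qed.

(** The [n + 1] blocks [true] are compared with as many periods of [[true]]; their sums differ by at
    most a term in [M] and the increment of one block. In half the slope this leaves one block
    [false] and half a period of [[true]], which is the situation of [tk_slope]. *)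
Lemma last_slope n : farey_slope (repeat true (S n) ++ [false]) [true] <= - (2 * eta).
Proof.
destruct (tk_constants _ _ _ _ TK) as [HM [HB He]].
assert (V0 : value F [true] = 2 * half_value F [true]) by (unfold value; simpl; ring).
assert (V1 : value F (repeat true (S n) ++ [false]) = 2 * half_value F ([false] ++ repeat true (S n))).
{ unfold value. rewrite rev_app_distr, rev_repeat. simpl (rev [false]).
  rewrite (half_value_rotate F (repeat true (S n))) by easy. ring. }
set (x := fixed_point ([false] ++ repeat true (S n))). set (z := fixed_point [true]).
assert (Rx : 8 / 5 <= x <= 5 / 2) by (apply fixed_point_range; easy).
assert (Rz : 8 / 5 <= z <= 5 / 2) by (apply fixed_point_range; easy).
destruct (fixed_point_spec ([false] ++ repeat true (S n)) ltac:(easy)) as [Px Ex]. fold x in Px, Ex.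
destruct (fixed_point_spec [true] ltac:(easy)) as [Pz Ez]. fold z in Pz, Ez. rewrite blocks_act_one in Ez.
assert (mono : forall b u v, 0 < u -> u <= v -> block_act b u <= block_act b v).
{ intros b u v Hu Hv. pose proof (word_act_incr (block_word b) u v Hu Hv). unfold block_act. lra. }
rewrite blocks_act_app, blocks_act_one in Ex.
set (zeta := blocks_act (repeat true (S n)) x) in *.
(* The constants are successive images of the ends of the interval: TTVV sends 8/5 to 50/21 and 5/2
   to 29/12, TV sends 50/21 to 121/71, and TTVV sends 121/71 to 747/313. *)
assert (Hzeta : 50 / 21 <= zeta <= 5 / 2).
{ unfold zeta. split; [|apply blocks_act_invariant; lra].
  change (repeat true (S n)) with ([true] ++ repeat true n). rewrite blocks_act_app, blocks_act_one.
  assert (I := blocks_act_invariant (repeat true n) x Rx).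
  eapply Rle_trans; [|apply (mono true (8 / 5)); lra]. rewrite block_act_eq by lra. lra. }
assert (Hx : 121 / 71 <= x).
{ rewrite <- Ex. eapply Rle_trans; [|apply (mono false (50 / 21)); lra]. rewrite block_act_eq by lra. lra. }
assert (Hbx : 747 / 313 <= block_act true x).
{ eapply Rle_trans; [|apply (mono true (121 / 71)); lra]. rewrite block_act_eq by lra. lra. }
assert (Hz : z <= 29 / 12).
{ rewrite <- Ez. eapply Rle_trans; [apply (mono true z (5 / 2)); lra|]. rewrite block_act_eq by lra. lra. }
assert (Hxz : x <= z).
{ rewrite <- Ex, <- Ez. pose proof (block_act_range false zeta ltac:(lra)). pose proof (block_act_range true z Pz). simpl in *. lra. }
assert (S1 : half_value F ([false] ++ repeat true (S n)) = block_sum F false zeta + blocks_sum F (repeat true (S n)) x).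
{ unfold half_value. fold x. now rewrite blocks_sum_app, blocks_sum_one. }
assert (S2 : blocks_sum F (repeat true (S n)) z - blocks_sum F (repeat true (S n)) x <=
  M * (29 / 12 - 747 / 313) + (block_sum F true (29 / 12) - block_sum F true (121 / 71))).
{ change (repeat true (S n)) with (true :: repeat true n). rewrite repeat_cons.
  rewrite !blocks_sum_app, !blocks_act_one, !blocks_sum_one.
  pose proof (mono true x z Px Hxz) as Hm. pose proof (block_act_invariant true x Rx).
  pose proof (blocks_sum_incr F M B eta TK (repeat true n) (block_act true x) (block_act true z) ltac:(lra) Hm ltac:(lra)).
  rewrite Ez in *.
  assert (M * (z - block_act true x) <= M * (29 / 12 - 747 / 313)) by (apply Rmult_le_compat_l; lra).
  pose proof (tk_incr _ _ _ _ TK true (121 / 71) x ltac:(lra) Hx ltac:(lra)).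
  pose proof (tk_incr _ _ _ _ TK true z (29 / 12) ltac:(lra) Hz ltac:(lra)). lra. }
assert (S3 : blocks_sum F (repeat true (S n)) z = INR (S n) * half_value F [true]).
{ rewrite <- word_pow_one. now apply blocks_sum_pow_fixed. }
assert (S4 : half_value F [true] <= block_sum F true (29 / 12)).
{ rewrite half_value_one. fold z. apply (tk_incr _ _ _ _ TK); lra. }
pose proof (tk_incr _ _ _ _ TK false (50 / 21) zeta ltac:(lra) ltac:(lra) ltac:(lra)).
pose proof (tk_slope _ _ _ _ TK).
assert (D : IZR (word_den (repeat true (S n) ++ [false])) = 2 * INR (S n) + 1).
{ rewrite INR_IZR_INZ, <- mult_IZR, <- plus_IZR. f_equal.
  rewrite word_den_app. unfold word_den, word_num. rewrite repeat_length.
  replace (count_occ Bool.bool_dec (repeat true (S n)) true) with (S n); [simpl; lia|].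
  clear. induction n as [|n IH]; [reflexivity|].
  change (repeat true (S (S n))) with (true :: repeat true (S n)). rewrite count_occ_cons_eq by reflexivity. now rewrite <- IH. }
unfold farey_slope. rewrite V0, V1, D, S1.
replace (IZR (word_den [true])) with 2 by reflexivity. lra.
Qed.

(** The slopes increase along a level, so the first and the last one bound them all. The level is a
    successor because [last_slope] has at least one [true] before the [false]. *)
Lemma level_slopes n : let l := farey_level (S n) in
  consecutive2 (slope_step node_x node_y farey_slope) l /\
  consecutive3 (fun U V W => farey_slope U V <= farey_slope V W) l /\
  consecutive2 (fun U V => - (10 * B) <= farey_slope U V) l /\
  consecutive2 (fun U V => farey_slope U V <= - (2 * eta)) l.
Proof.
cbn zeta.
assert (C3 : consecutive3 (fun U V W => farey_slope U V <= farey_slope V W) (farey_level (S n))).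
{ eapply (consecutive3_impl farey_triple _ farey_adjacent).
  - intros X Y Z _ _. apply farey_triple_slope.
  - apply farey_level_adjacent.
  - apply farey_level_triple. }
repeat split; [|exact C3| |].
- eapply consecutive2_impl; [apply farey_adjacent_step|apply farey_level_adjacent].
- destruct (farey_level_head (S n)) as [t E]. rewrite E in *.
  apply slopes_ge_head; [exact C3|apply first_slope].
- destruct (farey_level_last (S n)) as [t E]. rewrite E in *.
  apply slopes_le_last; [exact C3|apply last_slope].
Qed.

Lemma level_lipschitz n X Y : In X (farey_level (S n)) -> In Y (farey_level (S n)) -> node_x X <= node_x Y ->
  - (10 * B) * (node_x Y - node_x X) <= node_y Y - node_y X <= - (2 * eta) * (node_x Y - node_x X).
Proof.
intros HX HY Hxy. destruct (level_slopes n) as [H1 [_ [H2 H3]]].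
set (P := fun U V => node_x U < node_x V /\
  - (10 * B) * (node_x V - node_x U) <= node_y V - node_y U <= - (2 * eta) * (node_x V - node_x U)).
assert (HP : consecutive2 P (farey_level (S n))).
{ eapply consecutive2_impl; [|exact (consecutive2_and _ _ _ H1 (consecutive2_and _ _ _ H2 H3))].
  intros U V [[A1 A2] [A3 A4]]. split; [exact A1|]. rewrite A2.
  split; apply Rmult_le_compat_r; lra. }
destruct (consecutive2_pairs P _ ltac:(unfold P; intros; lra) HP X Y HX HY) as [->|[[_ H]|[H _]]]; lra.
Qed.

Lemma level_convex n X V Y : In X (farey_level (S n)) -> In V (farey_level (S n)) -> In Y (farey_level (S n)) ->
  node_x X <= node_x V <= node_x Y ->
  (node_x Y - node_x X) * node_y V <=
  (node_x Y - node_x V) * node_y X + (node_x V - node_x X) * node_y Y.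
Proof.
intros HX HV HY Hx. destruct (level_slopes n) as [H1 [H2 _]].
destruct (convex_list_support node_x node_y farey_slope _ H1 H2 V HV) as [m Hm].
pose proof (Rmult_le_compat_l (node_x Y - node_x V) _ _ ltac:(lra) (Hm X HX)).
pose proof (Rmult_le_compat_l (node_x V - node_x X) _ _ ltac:(lra) (Hm Y HY)). lra.
Qed.
End Nodes.

(** * Extension to the interval *)

Section Extension.
(** The known values are given as a graph; it is single-valued by [D_lip] at equal abscissae. *)
Variable D : R -> R -> Prop.
Variables Lip eta y0 : R.
Hypothesis D_range : forall x y, D x y -> 0 <= x <= 1 / 2.
Hypothesis D_lip : forall x y x' y', D x y -> D x' y' -> x <= x' ->
  - Lip * (x' - x) <= y' - y <= - eta * (x' - x).
Hypothesis D_convex : forall x1 y1 x2 y2 x3 y3, D x1 y1 -> D x2 y2 -> D x3 y3 ->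
  x1 <= x2 <= x3 -> (x3 - x1) * y2 <= (x3 - x2) * y1 + (x2 - x1) * y3.
Hypothesis D_dense : forall x eps, 0 <= x <= 1 / 2 -> 0 < eps ->
  exists x' y', D x' y' /\ Rabs (x' - x) < eps.
Hypothesis D_half : D (1 / 2) y0.
Hypothesis y0_pos : 0 < y0.
Hypothesis eta_pos : 0 < eta.
Hypothesis Lip_pos : 0 <= Lip.

Lemma D_lip_abs x y x' y' : D x y -> D x' y' -> Rabs (y' - y) <= Lip * Rabs (x' - x).
Proof.
intros H H'. destruct (Rle_dec x x') as [L|L].
- rewrite (Rabs_pos_eq (x' - x)) by lra. pose proof (D_lip _ _ _ _ H H' L).
  assert (0 <= eta * (x' - x)) by (apply Rmult_le_pos; lra). apply Rabs_le.
  assert (0 <= Lip * (x' - x)) by (apply Rmult_le_pos; lra). lra.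
- rewrite (Rabs_left (x' - x)) by lra. pose proof (D_lip _ _ _ _ H' H ltac:(lra)).
  assert (0 <= eta * (x - x')) by (apply Rmult_le_pos; lra). apply Rabs_le.
  assert (0 <= Lip * (x - x')) by (apply Rmult_le_pos; lra). lra.
Qed.

Lemma D_lower x y : D x y -> y0 <= y.
Proof.
intros H. pose proof (D_range _ _ H). pose proof (D_lip _ _ _ _ H D_half ltac:(lra)).
assert (0 <= eta * (1 / 2 - x)) by (apply Rmult_le_pos; lra). lra.
Qed.

(* McShane extension of a Lipschitz function on a dense set. *)
Lemma mcshane_extension : exists g : R -> R,
  (forall x y, D x y -> g x = y) /\
  (forall x x', Rabs (g x - g x') <= Lip * Rabs (x - x')).
Proof.
assert (H : forall x, exists m, (forall x' y', D x' y' -> m <= y' + Lip * Rabs (x - x')) /\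
  forall b, (forall x' y', D x' y' -> b <= y' + Lip * Rabs (x - x')) -> b <= m).
{ intros x.
  destruct (completeness (fun u => forall x' y', D x' y' -> u <= y' + Lip * Rabs (x - x'))) as [m [Hm1 Hm2]].
  - exists (y0 + Lip * Rabs (x - 1 / 2)). intros u Hu. now apply Hu.
  - exists y0. intros x' y' HD. pose proof (D_lower _ _ HD).
    assert (0 <= Lip * Rabs (x - x')) by (apply Rmult_le_pos; [lra|apply Rabs_pos]). lra.
  - exists m. split.
    + intros x' y' HD. apply Hm2. intros u Hu. now apply Hu.
    + intros b Hb. now apply Hm1. }
destruct (functional_choice _ H) as [g Hg]. exists g. split.
- intros x y HD. destruct (Hg x) as [H1 H2]. apply Rle_antisym.
  + specialize (H1 x y HD). rewrite Rminus_diag, Rabs_R0 in H1. lra.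
  + apply H2. intros x' y' HD'. pose proof (D_lip_abs _ _ _ _ HD' HD) as L.
    apply Rabs_le_between in L. lra.
- assert (G : forall x x', g x - g x' <= Lip * Rabs (x - x')).
  { intros x x'. destruct (Hg x) as [H1 _]. destruct (Hg x') as [_ H2].
    enough (g x - Lip * Rabs (x - x') <= g x') by lra. apply H2. intros u v HD.
    specialize (H1 u v HD).
    assert (T : Rabs (x - u) <= Rabs (x - x') + Rabs (x' - u)).
    { replace (x - u) with ((x - x') + (x' - u)) by ring. apply Rabs_triang. }
    apply (Rmult_le_compat_l Lip) in T; lra. }
  intros x x'. apply Rabs_le. pose proof (G x x'). pose proof (G x' x).
  rewrite (Rabs_minus_sym x' x) in *. lra.
Qed.

(** Values of [g] are within [Lip * d] of those at points of the dense set at distance [d].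
    Convexity passes to the limit, and strictness of the decrease survives because [eta] bounds the
    slopes away from 0. *)
Lemma convex_extension : exists g : R -> R,
  (forall x y, D x y -> g x = y) /\
  (forall x, 0 <= x <= 1 / 2 -> 0 < g x) /\
  continuous_on (fun x : R => 0 <= x <= 1 / 2) g /\
  (forall x y, 0 <= x <= 1 / 2 -> 0 <= y <= 1 / 2 -> x < y -> g y < g x) /\
  (forall x y t, 0 <= x <= 1 / 2 -> 0 <= y <= 1 / 2 -> 0 <= t <= 1 ->
     g (t * x + (1 - t) * y) <= t * g x + (1 - t) * g y).
Proof.
destruct mcshane_extension as [g [Hg HL]]. exists g.
assert (Near : forall x d, 0 <= x <= 1 / 2 -> 0 < d -> exists x' y', D x' y' /\
  - d < x' - x < d /\ - (Lip * d) <= y' - g x <= Lip * d).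
{ intros x d Hx Hd. destruct (D_dense x d Hx Hd) as [x' [y' [HD Hx']]].
  exists x', y'. split; [exact HD|]. pose proof (HL x' x) as HL'. rewrite (Hg _ _ HD) in HL'.
  assert (Lip * Rabs (x' - x) <= Lip * d) by (apply Rmult_le_compat_l; lra).
  apply Rabs_lt_between in Hx'. split; [lra|]. apply Rabs_le_between. lra. }
assert (Dec : forall x y, 0 <= x <= 1 / 2 -> 0 <= y <= 1 / 2 -> x < y -> g y < g x).
{ intros x y Hx Hy Hxy.
  (* The nearby points stay at distance at least [(y - x) / 2], and the two errors [Lip * d] take up
     at most half of the resulting drop. *)
  set (d := Rmin ((y - x) / 4) (eta * (y - x) / (8 * (Lip + 1)))).
  assert (P : 0 < eta * (y - x)) by (apply Rmult_lt_0_compat; lra).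
  assert (Hd : 0 < d) by (apply Rmin_pos; apply Rdiv_lt_0_compat; lra).
  assert (Hd1 : d <= (y - x) / 4) by apply Rmin_l.
  assert (Hd2 : Lip * d <= eta * (y - x) / 8).
  { apply Rle_trans with ((Lip + 1) * (eta * (y - x) / (8 * (Lip + 1)))); [|right; field; lra].
    apply Rmult_le_compat; try lra. apply Rmin_r. }
  destruct (Near x d Hx Hd) as [x1 [h1 [D1 [A1 B1]]]]. destruct (Near y d Hy Hd) as [x2 [h2 [D2 [A2 B2]]]].
  pose proof (D_lip _ _ _ _ D1 D2 ltac:(lra)).
  assert (eta * ((y - x) / 2) <= eta * (x2 - x1)) by (apply Rmult_le_compat_l; lra). lra. }
assert (Hhalf : g (1 / 2) = y0) by now apply Hg.
repeat split.
- exact Hg.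
- intros x Hx. destruct (Req_dec x (1 / 2)) as [->|N]; [lra|].
  pose proof (Dec x (1 / 2) Hx ltac:(lra) ltac:(lra)). lra.
- intros x Hx. apply filterlim_within_ext with g; [reflexivity|].
  eapply filterlim_filter_le_1; [apply filter_le_within|].
  apply (proj2 (filterlim_locally g (g x))). intros eps.
  assert (He : 0 < eps / (Lip + 1)) by (apply Rdiv_lt_0_compat; [apply cond_pos|lra]).
  exists (mkposreal _ He). intros u Hu. change (Rabs (u - x) < eps / (Lip + 1)) in Hu.
  change (Rabs (g u - g x) < eps). eapply Rle_lt_trans; [apply HL|].
  apply Rle_lt_trans with ((Lip + 1) * Rabs (u - x)).
  { apply Rmult_le_compat_r; [apply Rabs_pos|lra]. }
  apply Rlt_le_trans with ((Lip + 1) * (eps / (Lip + 1))); [apply Rmult_lt_compat_l; lra|right; field; lra].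
- exact Dec.
- assert (Cvx : forall x z y, 0 <= x -> x < z -> z < y -> y <= 1 / 2 ->
    (y - x) * g z <= (y - z) * g x + (z - x) * g y).
  { intros x z y H1 H2 H3 H4. apply le_epsilon. intros eps Heps.
    (* [K * d] bounds the sum of the three perturbation errors below. *)
    set (K := 2 * Lip + 4 * (Rabs (g x) + Rabs (g y) + Rabs (g z) + 3 * Lip) + 1).
    assert (HK : 0 < K).
    { pose proof (Rabs_pos (g x)). pose proof (Rabs_pos (g y)). pose proof (Rabs_pos (g z)). unfold K. lra. }
    set (d := Rmin (Rmin 1 (eps / K)) (Rmin ((z - x) / 2) ((y - z) / 2))).
    assert (Hd : 0 < d) by (repeat apply Rmin_pos; try lra; now apply Rdiv_lt_0_compat).
    assert (Hd0 : d <= Rmin 1 (eps / K)) by apply Rmin_l.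
    assert (Hd1 : d <= 1) by (eapply Rle_trans; [exact Hd0|apply Rmin_l]).
    assert (Hd2 : K * d <= eps).
    { apply Rle_trans with (K * (eps / K)); [|right; field; lra].
      apply Rmult_le_compat_l; [lra|]. eapply Rle_trans; [exact Hd0|apply Rmin_r]. }
    assert (Hd3 : d <= (z - x) / 2 /\ d <= (y - z) / 2).
    { assert (Q : d <= Rmin ((z - x) / 2) ((y - z) / 2)) by apply Rmin_r.
      pose proof (Rmin_l ((z - x) / 2) ((y - z) / 2)). pose proof (Rmin_r ((z - x) / 2) ((y - z) / 2)). lra. }
    destruct (Near x d ltac:(lra) Hd) as [x1 [h1 [D1 [A1 B1]]]].
    destruct (Near z d ltac:(lra) Hd) as [x2 [h2 [D2 [A2 B2]]]].
    destruct (Near y d ltac:(lra) Hd) as [x3 [h3 [D3 [A3 B3]]]].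
    pose proof (D_convex _ _ _ _ _ _ D1 D2 D3 ltac:(lra)) as HC.
    assert (Ld : Lip * d <= Lip) by (assert (Lip * d <= Lip * 1) by (apply Rmult_le_compat_l; lra); lra).
    (* replacing an interval length by one within 2d, and a value by one within Lip d *)
    assert (Pert : forall a b u v, 0 <= b <= 1 / 2 -> Rabs (a - b) <= 2 * d -> Rabs (u - v) <= Lip * d ->
      Rabs (a * u - b * v) <= 2 * d * (Rabs v + Lip) + / 2 * (Lip * d)).
    { intros a b u v Hb Ha Hu.
      replace (a * u - b * v) with ((a - b) * u + b * (u - v)) by ring.
      eapply Rle_trans; [apply Rabs_triang|]. rewrite !Rabs_mult.
      assert (Rabs u <= Rabs v + Lip).
      { replace u with (v + (u - v)) by ring. eapply Rle_trans; [apply Rabs_triang|]. lra. }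
      rewrite (Rabs_pos_eq b) by lra.
      apply Rplus_le_compat; apply Rmult_le_compat; try apply Rabs_pos; lra. }
    pose proof (Pert (x3 - x1) (y - x) h2 (g z) ltac:(lra) ltac:(apply Rabs_le; lra) ltac:(apply Rabs_le; lra)) as P1.
    pose proof (Pert (x3 - x2) (y - z) h1 (g x) ltac:(lra) ltac:(apply Rabs_le; lra) ltac:(apply Rabs_le; lra)) as P2.
    pose proof (Pert (x2 - x1) (z - x) h3 (g y) ltac:(lra) ltac:(apply Rabs_le; lra) ltac:(apply Rabs_le; lra)) as P3.
    apply Rabs_le_between in P1, P2, P3.
    assert (0 <= d * Rabs (g x)) by (apply Rmult_le_pos; [lra|apply Rabs_pos]).
    assert (0 <= d * Rabs (g y)) by (apply Rmult_le_pos; [lra|apply Rabs_pos]).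
    assert (0 <= d * Rabs (g z)) by (apply Rmult_le_pos; [lra|apply Rabs_pos]).
    assert (0 <= Lip * d) by (apply Rmult_le_pos; lra).
    unfold K in Hd2. lra. }
  assert (Main : forall x y t, 0 <= x -> x < y -> y <= 1 / 2 -> 0 < t < 1 ->
    g (t * x + (1 - t) * y) <= t * g x + (1 - t) * g y).
  { intros x y t H1 H2 H3 Ht.
    assert (0 < t * (y - x)) by (apply Rmult_lt_0_compat; lra).
    assert (0 < (1 - t) * (y - x)) by (apply Rmult_lt_0_compat; lra).
    assert (C := Cvx x (t * x + (1 - t) * y) y H1 ltac:(lra) ltac:(lra) H3).
    apply Rmult_le_reg_l with (y - x); [lra|].
    replace ((y - x) * (t * g x + (1 - t) * g y)) with
      ((y - (t * x + (1 - t) * y)) * g x + ((t * x + (1 - t) * y) - x) * g y) by ring. exact C. }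
  intros x y t Hx Hy Ht.
  destruct (Req_dec t 0) as [->|T0].
  { right. replace (0 * x + (1 - 0) * y) with y by ring. ring. }
  destruct (Req_dec t 1) as [->|T1].
  { right. replace (1 * x + (1 - 1) * y) with x by ring. ring. }
  destruct (Rtotal_order x y) as [L|[->|L]].
  + apply Main; lra.
  + right. replace (t * y + (1 - t) * y) with y by ring. ring.
  + replace (t * x + (1 - t) * y) with ((1 - t) * y + (1 - (1 - t)) * x) by ring.
    replace (t * g x + (1 - t) * g y) with ((1 - t) * g y + (1 - (1 - t)) * g x) by ring.
    apply Main; lra.
Qed.
End Extension.

(** * Rationals in the Farey levels *)

Section FareySearch.
Local Open Scope Z_scope.

Lemma coprime_fraction_unique p q p' q' : 0 < q -> 0 < q' ->
  rel_prime p q -> rel_prime p' q' -> p * q' = p' * q -> p = p' /\ q = q'.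
Proof.
intros Hq Hq' H H' E.
assert (D1 : (q | q')).
{ apply Gauss with p; [exists p'; lia|now apply rel_prime_sym]. }
assert (D2 : (q' | q)).
{ apply Gauss with p'; [exists p; lia|now apply rel_prime_sym]. }
assert (q = q') by (apply Z.divide_antisym_nonneg; (lia || assumption)).
subst q'. split; [nia|reflexivity].
Qed.

Lemma insert_mediants_app l1 U V l2 : exists l1' l2',
  insert_mediants (l1 ++ U :: V :: l2) = l1' ++ U :: (V ++ U) :: V :: l2'.
Proof.
assert (E : forall t Y, exists u, insert_mediants (Y :: t) = Y :: u) by (intros [|Z t] Y; simpl; eauto).
induction l1 as [|X [|Y t] [l1' [l2' IH]]].
- destruct (E l2 V) as [u Hu]. exists [], u. simpl app.
  change (insert_mediants (U :: V :: l2)) with (U :: (V ++ U) :: insert_mediants (V :: l2)). now rewrite Hu.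
- exists (X :: (U ++ X) :: l1'), l2'. simpl app in *.
  change (insert_mediants (X :: U :: V :: l2)) with (X :: (U ++ X) :: insert_mediants (U :: V :: l2)). now rewrite IH.
- exists (X :: (Y ++ X) :: l1'), l2'. simpl app in *.
  change (insert_mediants (X :: Y :: t ++ U :: V :: l2)) with (X :: (Y ++ X) :: insert_mediants (Y :: t ++ U :: V :: l2)).
  now rewrite IH.
Qed.

Lemma adjacent_coprime X Y : farey_adjacent X Y ->
  rel_prime (word_num X) (word_den X) /\ rel_prime (word_num Y) (word_den Y).
Proof.
intros [_ D]. split; apply bezout_rel_prime.
- apply Bezout_intro with (- word_den Y) (word_num Y). lia.
- apply Bezout_intro with (word_den X) (- word_num X). lia.
Qed.

Lemma farey_level_coprime n X : In X (farey_level n) -> rel_prime (word_num X) (word_den X).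
Proof.
intros H. apply in_split in H. destruct H as [l1 [l2 E]].
assert (C := farey_level_adjacent n). rewrite E in C.
destruct l2 as [|Y l2].
- destruct (farey_level_last n) as [l E']. rewrite E' in E.
  replace (l ++ [repeat true n ++ [false]; [true]]) with ((l ++ [repeat true n ++ [false]]) ++ [[true]]) in E
    by (now rewrite <- app_assoc).
  apply app_inj_tail in E. destruct E as [_ <-].
  apply bezout_rel_prime. now apply Bezout_intro with 1 0.
- apply consecutive2_app in C. now apply adjacent_coprime in C.
Qed.

(** As long as the fraction is not found, it lies strictly between two neighbours, and every
    refinement replaces one of their denominators by the sum of both, so this sum grows by at least
    1. *)
Lemma farey_level_search p q m : 0 <= p -> 0 < q -> 2 * p <= q -> rel_prime p q ->
  (exists X, In X (farey_level m) /\ word_num X = p /\ word_den X = q) \/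
  (exists l1 U V l2, farey_level m = l1 ++ U :: V :: l2 /\
     word_num U * q < p * word_den U /\ p * word_den V < word_num V * q /\
     Z.of_nat m + 3 <= word_den U + word_den V).
Proof.
intros Hp Hq Hpq Hc. induction m as [|m IH].
- destruct (Z.eq_dec p 0) as [E|E].
  { left. exists [false]. split; [now left|]. subst p.
    apply Zgcd_1_rel_prime in Hc. rewrite Z.gcd_0_l, Z.abs_eq in Hc by lia. subst q. now split. }
  destruct (Z.eq_dec (2 * p) q) as [E'|E'].
  { left. exists [true]. split; [right; now left|].
    destruct (coprime_fraction_unique p q 1 2); try lia; [exact Hc| |].
    - apply bezout_rel_prime. now apply Bezout_intro with 1 0.
    - subst. now split. }
  right. exists [], [false], [true], []. split; [reflexivity|].
  change (word_num [false]) with 0. change (word_den [false]) with 1.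
  change (word_num [true]) with 1. change (word_den [true]) with 2. lia.
- change (farey_level (S m)) with (insert_mediants (farey_level m)).
  destruct IH as [[X [HX HX']]|[l1 [U [V [l2 [E [HU [HV Hd]]]]]]]].
  { left. exists X. split; [now apply insert_mediants_incl|exact HX']. }
  assert (A : farey_adjacent U V).
  { apply (consecutive2_app _ l1 U V l2). rewrite <- E. apply farey_level_adjacent. }
  assert (DU : 0 < word_den U) by (apply word_den_pos, A).
  assert (DV : 0 < word_den V) by (apply word_den_pos, A).
  destruct (insert_mediants_app l1 U V l2) as [l1' [l2' E']]. rewrite E, E'.
  assert (N := word_num_app V U). assert (Dn := word_den_app V U).
  destruct (Z.lt_trichotomy (p * word_den (V ++ U)) (word_num (V ++ U) * q)) as [L|[L|L]].
  + right. exists l1', U, (V ++ U), (V :: l2'). repeat split; lia.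
  + left. exists (V ++ U). split; [apply in_or_app; right; right; now left|].
    destruct (coprime_fraction_unique p q (word_num (V ++ U)) (word_den (V ++ U))); try lia.
    * exact Hc.
    * apply farey_adjacent_mediant in A. now apply (adjacent_coprime (V ++ U) V).
  + right. exists (l1' ++ [U]), (V ++ U), V, l2'. split; [now rewrite <- app_assoc|]. lia.
Qed.

Lemma farey_level_contains p q : 0 <= p -> 0 < q -> 2 * p <= q -> rel_prime p q ->
  exists n X, In X (farey_level (S n)) /\ word_num X = p /\ word_den X = q.
Proof.
intros Hp Hq Hpq Hc. exists (Z.to_nat q).
destruct (farey_level_search p q (S (Z.to_nat q)) Hp Hq Hpq Hc) as [H|[l1 [U [V [l2 [E [HU [HV Hd]]]]]]]]; [exact H|].
exfalso.
assert (A : farey_adjacent U V).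
{ apply (consecutive2_app _ l1 U V l2). rewrite <- E. apply farey_level_adjacent. }
destruct A as [[NU [NV _]] D].
assert (DU := word_den_pos U NU). assert (DV := word_den_pos V NV).
(* Both brackets are positive integers, so [q] is at least the sum of the two denominators, against
   the bound from the search. *)
assert (Q : q = word_den V * (p * word_den U - word_num U * q) + word_den U * (word_num V * q - p * word_den V)).
{ transitivity (q * (word_den U * word_num V - word_num U * word_den V)); [rewrite D; ring|ring]. }
nia.
Qed.

Lemma reduced_fraction p q : 0 <= p -> 0 < q -> 2 * p <= q ->
  exists p' q', 0 <= p' /\ 0 < q' /\ 2 * p' <= q' /\ rel_prime p' q' /\
    (IZR p / IZR q = IZR p' / IZR q')%R.
Proof.
intros Hp Hq Hpq. set (g := Z.gcd p q).
assert (Hg : 0 < g).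
{ assert (0 <= g) by apply Z.gcd_nonneg. assert (g <> 0); [|lia]. intros E. apply Z.gcd_eq_0_r in E. lia. }
destruct (Z.gcd_divide_l p q) as [p' Hp']. destruct (Z.gcd_divide_r p q) as [q' Hq']. fold g in Hp', Hq'.
exists p', q'. split; [nia|split; [nia|split; [nia|split]]].
- apply Zgcd_1_rel_prime.
  assert (g * Z.gcd p' q' = g * 1); [|nia].
  rewrite Z.mul_1_r. unfold g at 2. rewrite Hp', Hq', Z.gcd_mul_mono_r_nonneg by lia. ring.
- assert (0 < q') by nia. apply IZR_lt in Hg, H. rewrite Hp', Hq', !mult_IZR. field. lra.
Qed.
End FareySearch.

(** * Continued fractions *)

Lemma INR_pos_ge_1 n : (0 < n)%nat -> 1 <= INR n.
Proof. intros H. apply (le_INR 1). lia. Qed.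

Lemma cf_convergent_bounds a n : (forall k, (0 < a (S k))%nat) ->
  INR (a O) <= cf_convergent a n <= INR (a O) + 1.
Proof.
revert a. induction n as [|n IH]; intros a Ha; simpl; [lra|].
destruct (IH (fun k => a (S k)) (fun k => Ha (S k))) as [H1 H2].
assert (H := INR_pos_ge_1 _ (Ha O)). cbv beta in H1, H2.
set (c := cf_convergent (fun k => a (S k)) n) in *.
assert (0 < / c <= / 1); [|rewrite Rinv_1 in *; lra].
split; [apply Rinv_0_lt_compat; lra|apply Rinv_le_contravar; lra].
Qed.

Lemma is_cf_tail x a : is_cf x a ->
  INR (a O) < x <= INR (a O) + 1 /\ is_cf (/ (x - INR (a O))) (fun k => a (S k)).
Proof.
intros [Ha Hl].
set (c := fun n => cf_convergent (fun k => a (S k)) n).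
assert (Hc : forall n, 1 <= c n <= INR (a 1%nat) + 1).
{ intros n. destruct (cf_convergent_bounds (fun k => a (S k)) n (fun k => Ha (S k))) as [H1 H2].
  pose proof (INR_pos_ge_1 _ (Ha O)). unfold c. lra. }
assert (Hl1 : is_lim_seq (fun n => cf_convergent a (S n)) x) by now apply is_lim_seq_incr_1 in Hl.
assert (Hl2 : is_lim_seq (fun n => / c n) (x - INR (a O))).
{ apply (is_lim_seq_ext (fun n => cf_convergent a (S n) - INR (a O))).
  - intros n. unfold c. simpl. ring.
  - apply is_lim_seq_minus'; [exact Hl1|apply is_lim_seq_const]. }
assert (Hb : forall n, / (INR (a 1%nat) + 1) <= / c n <= 1).
{ intros n. specialize (Hc n). split; [apply Rinv_le_contravar; lra|].
  rewrite <- Rinv_1. apply Rinv_le_contravar; lra. }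
assert (L1 : / (INR (a 1%nat) + 1) <= x - INR (a O)).
{ apply (is_lim_seq_le (fun _ => / (INR (a 1%nat) + 1)) (fun n => / c n) (/ (INR (a 1%nat) + 1)) (x - INR (a O)));
    [apply Hb|apply is_lim_seq_const|exact Hl2]. }
assert (L2 : x - INR (a O) <= 1).
{ apply (is_lim_seq_le (fun n => / c n) (fun _ => 1) (x - INR (a O)) 1); [apply Hb|exact Hl2|apply is_lim_seq_const]. }
assert (P : 0 < / (INR (a 1%nat) + 1)).
{ apply Rinv_0_lt_compat. pose proof (pos_INR (a 1%nat)). lra. }
split; [lra|]. split; [intros n; apply (Ha (S n))|].
apply (is_lim_seq_ext (fun n => / / c n)); [intros n; apply Rinv_inv|].
change (Finite (/ (x - INR (a O)))) with (Rbar_inv (Finite (x - INR (a O)))).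
apply is_lim_seq_inv; [exact Hl2|]. intros E. injection E as E. lra.
Qed.

(** A value [a 0 + 1] would make the tail equal to 1, whereas the tail exceeds its own first
    quotient, which is at least 1. *)
Lemma is_cf_floor x a : is_cf x a -> INR (a O) < x < INR (a O) + 1.
Proof.
intros H. destruct (is_cf_tail x a H) as [[H1 H2] H'].
destruct (is_cf_tail _ _ H') as [[H3 _] _]. cbv beta in H3.
pose proof (INR_pos_ge_1 _ (proj1 H O)).
split; [exact H1|]. destruct (Req_dec x (INR (a O) + 1)) as [E|E]; [|lra].
exfalso. replace (x - INR (a O)) with 1 in H3 by lra. rewrite Rinv_1 in H3. lra.
Qed.

Lemma is_cf_unique x a b : is_cf x a -> is_cf x b -> forall n, a n = b n.
Proof.
intros Ha Hb n. revert x a b Ha Hb. induction n as [|n IH]; intros x a b Ha Hb.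
all: assert (E : a O = b O) by (
  pose proof (is_cf_floor x a Ha); pose proof (is_cf_floor x b Hb);
  apply Nat.le_antisymm; apply Nat.lt_succ_r, INR_lt; rewrite S_INR; lra).
- exact E.
- destruct (is_cf_tail x a Ha) as [_ Ha']. destruct (is_cf_tail x b Hb) as [_ Hb'].
  rewrite <- E in Hb'. exact (IH _ _ _ Ha' Hb').
Qed.

Definition block_quotient (b : bool) : nat := if b then 2%nat else 1%nat.

Definition cf_word (X : list bool) : list nat :=
  flat_map (fun b => [block_quotient b; block_quotient b]) X.

(** A condition without reference to a period, so that it passes to the tail after one block. *)
Definition paired (a : nat -> nat) : Prop :=
  forall j, exists b, a (2 * j)%nat = block_quotient b /\ a (2 * j + 1)%nat = block_quotient b.

Lemma paired_pos a : paired a -> forall k, (0 < a k)%nat.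
Proof.
intros H k. destruct (H (k / 2)%nat) as [b [H1 H2]].
assert (E := Nat.div_mod k 2 ltac:(lia)). assert (M := Nat.mod_upper_bound k 2 ltac:(lia)).
assert (k = (2 * (k / 2))%nat \/ k = (2 * (k / 2) + 1)%nat) as [K|K] by lia; rewrite K;
  [rewrite H1|rewrite H2]; destruct b; simpl; lia.
Qed.

Lemma paired_tail a : paired a -> paired (fun k => a (S (S k))).
Proof.
intros H j. destruct (H (S j)) as [b [H1 H2]]. exists b.
replace (S (S (2 * j))) with (2 * S j)%nat by lia. replace (S (S (2 * j + 1))) with (2 * S j + 1)%nat by lia. auto.
Qed.

(** Two continued fraction steps with equal quotients [a] are one block, since
    [T^a V^a z = a + 1 / (a + 1 / z)]. *)
Lemma cf_convergent_block a n b : paired a -> a O = block_quotient b -> a 1%nat = block_quotient b ->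
  cf_convergent a (S (S n)) = block_act b (cf_convergent (fun k => a (S (S k))) n).
Proof.
intros H E0 E1. simpl cf_convergent. rewrite E0, E1.
assert (P := paired_tail a H).
assert (C := cf_convergent_bounds (fun k => a (S (S k))) n (fun k => paired_pos _ P (S k))). cbv beta in C.
assert (N := INR_pos_ge_1 _ (paired_pos _ P O)). cbv beta in N.
set (c := cf_convergent (fun k => a (S (S k))) n) in *.
rewrite block_act_eq by lra. destruct b; simpl; field; lra.
Qed.

(** All convergents lie between [a 0] and [a 0 + 1], and every common block contracts by 1/4. *)
Lemma cf_convergent_cauchy j : forall a n m, paired a -> (2 * j <= n)%nat -> (2 * j <= m)%nat ->
  Rabs (cf_convergent a n - cf_convergent a m) <= (/ 4) ^ j.
Proof.
induction j as [|j IH]; intros a n m H Hn Hm.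
- pose proof (cf_convergent_bounds a n (fun k => paired_pos _ H (S k))).
  pose proof (cf_convergent_bounds a m (fun k => paired_pos _ H (S k))). simpl. apply Rabs_le. lra.
- destruct n as [|[|n]]; [lia|lia|]. destruct m as [|[|m]]; [lia|lia|].
  destruct (H O) as [b [E0 E1]].
  rewrite (cf_convergent_block a n b), (cf_convergent_block a m b) by assumption.
  assert (P := paired_tail a H). specialize (IH _ n m P ltac:(lia) ltac:(lia)).
  assert (N := INR_pos_ge_1 _ (paired_pos _ P O)). cbv beta in N.
  assert (Cn := cf_convergent_bounds _ n (fun k => paired_pos _ P (S k))).
  assert (Cm := cf_convergent_bounds _ m (fun k => paired_pos _ P (S k))). cbv beta in Cn, Cm.
  set (c := cf_convergent (fun k => a (S (S k))) n) in *. set (d := cf_convergent (fun k => a (S (S k))) m) in *.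
  apply Rabs_le_between in IH. simpl pow. apply Rabs_le.
  destruct (Rle_dec c d).
  + pose proof (block_act_contracts b c d ltac:(lra) ltac:(lra)). lra.
  + pose proof (block_act_contracts b d c ltac:(lra) ltac:(lra)). lra.
Qed.

Lemma paired_cf a : paired a -> exists x, is_cf x a.
Proof.
intros H. destruct (proj2 (ex_lim_seq_cauchy_corr (cf_convergent a))) as [x Hx].
- intros eps. assert (He : 0 < eps / 2) by (pose proof (cond_pos eps); lra).
  destruct (pow_quarter_small 1 (eps / 2) Rle_0_1 He) as [N HN].
  exists (2 * N)%nat. intros n m Hn Hm.
  eapply Rle_lt_trans; [apply (cf_convergent_cauchy N); assumption|].
  specialize (HN N (Nat.le_refl N)). pose proof (cond_pos eps). lra.
- exists x. split; [intros n; now apply paired_pos|exact Hx].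
Qed.

Lemma cf_word_length X : length (cf_word X) = (2 * length X)%nat.
Proof. induction X as [|b X IH]; [reflexivity|]. simpl. rewrite IH. lia. Qed.

Lemma cf_word_app X Y : cf_word (X ++ Y) = cf_word X ++ cf_word Y.
Proof. apply flat_map_app. Qed.

Lemma cf_word_nth X i d : (i < length X)%nat ->
  nth (2 * i) (cf_word X) d = block_quotient (nth i X false) /\
  nth (2 * i + 1) (cf_word X) d = block_quotient (nth i X false).
Proof.
revert i. induction X as [|b X IH]; intros i H; [simpl in H; lia|].
destruct i as [|i]; [now split|]. simpl in H. destruct (IH i ltac:(lia)) as [H1 H2].
replace (2 * S i)%nat with (S (S (2 * i))) by lia. replace (S (S (2 * i)) + 1)%nat with (S (S (2 * i + 1))) by lia.
now split.
Qed.

Lemma periodic_cf_word X j : X <> [] ->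
  periodic (cf_word X) (2 * j) = block_quotient (nth (j mod length X) X false) /\
  periodic (cf_word X) (2 * j + 1) = block_quotient (nth (j mod length X) X false).
Proof.
intros HX. assert (L : length X <> O) by (destruct X; easy).
unfold periodic. rewrite cf_word_length.
assert (E : ((2 * j) mod (2 * length X) = 2 * (j mod length X))%nat) by (apply Nat.Div0.mul_mod_distr_l).
assert (B := Nat.mod_upper_bound j (length X) L).
assert (E' : ((2 * j + 1) mod (2 * length X) = 2 * (j mod length X) + 1)%nat).
{ symmetry. apply (Nat.mod_unique _ _ (j / length X)); [lia|].
  pose proof (Nat.div_mod j (length X) L). nia. }
rewrite E, E'. now apply cf_word_nth.
Qed.

Lemma paired_periodic X : X <> [] -> paired (periodic (cf_word X)).
Proof. intros H j. eexists. now apply periodic_cf_word. Qed.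

Lemma periodic_cf_spec X : X <> [] -> is_cf (periodic_cf (cf_word X)) (periodic (cf_word X)).
Proof. intros H. unfold periodic_cf. apply epsilon_spec. now apply paired_cf, paired_periodic. Qed.

Lemma partial_quotients_periodic X : X <> [] ->
  forall n, partial_quotients (periodic_cf (cf_word X)) n = periodic (cf_word X) n.
Proof.
intros H. apply is_cf_unique with (periodic_cf (cf_word X)); [|now apply periodic_cf_spec].
unfold partial_quotients. apply epsilon_spec. eexists. now apply periodic_cf_spec.
Qed.

Notation count2 s := (count_occ Nat.eq_dec s 2%nat).

Lemma periodic_block s m : s <> [] ->
  map (periodic s) (seq (m * length s) (length s)) = s.
Proof.
intros H. assert (L : length s <> O) by (now destruct s).
apply (nth_ext _ _ O O); [now rewrite length_map, length_seq|].
intros i Hi. rewrite length_map, length_seq in Hi.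
rewrite (nth_indep _ _ (periodic s O)) by (now rewrite length_map, length_seq).
rewrite map_nth, seq_nth by exact Hi. unfold periodic.
rewrite Nat.add_comm, Nat.Div0.mod_add, Nat.mod_small by exact Hi. reflexivity.
Qed.

Lemma periodic_count s m : s <> [] ->
  count2 (map (periodic s) (seq 0 (m * length s))) = (m * count2 s)%nat.
Proof.
intros H. induction m as [|m IH]; [reflexivity|].
replace (S m * length s)%nat with (m * length s + length s)%nat by lia.
rewrite seq_app, map_app, count_occ_app, IH. simpl Nat.add.
rewrite periodic_block by exact H. lia.
Qed.

Lemma cf_word_count X : count2 (cf_word X) = (2 * count_occ Bool.bool_dec X true)%nat.
Proof.
induction X as [|b X IH]; [reflexivity|].
change (cf_word (b :: X)) with (cf_word [b] ++ cf_word X). rewrite count_occ_app, IH.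
destruct b; simpl; lia.
Qed.

Lemma firstn_cf_word X t : firstn (2 * t) (cf_word X) = cf_word (firstn t X).
Proof.
revert X. induction t as [|t IH]; intros X; [reflexivity|].
destruct X as [|b X]; [now rewrite !firstn_nil|].
replace (2 * S t)%nat with (S (S (2 * t))) by lia. simpl. f_equal. f_equal. apply IH.
Qed.

Lemma least_length (P : list nat -> Prop) s : P s ->
  exists t, P t /\ forall u, P u -> (length t <= length u)%nat.
Proof.
remember (length s) as n eqn:E. revert s E.
induction n as [n IH] using lt_wf_ind. intros s E H.
destruct (excluded_middle_informative (exists u, P u /\ (length u < n)%nat)) as [[u [Hu Hl]]|N].
- exact (IH (length u) Hl u eq_refl Hu).
- exists s. split; [exact H|]. intros u Hu.
  destruct (Nat.le_gt_cases (length s) (length u)); [assumption|].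
  exfalso. apply N. exists u. split; [exact Hu|lia].
Qed.

Lemma even_period_cf_word X : X <> [] -> even_period (periodic_cf (cf_word X)) (cf_word X).
Proof.
intros H. split; [now destruct X|]. split; [|now apply periodic_cf_spec].
rewrite cf_word_length. now exists (length X).
Qed.

(* Comparing the frequency of the quotient 2 in the two periods: coprimality
   forces an even period to have at least the length of [cf_word X]. *)
Lemma minimal_even_period_cf_word X : X <> [] -> rel_prime (word_num X) (word_den X) ->
  minimal_even_period (periodic_cf (cf_word X)) = cf_word X.
Proof.
intros HX HC. set (u := periodic_cf (cf_word X)). set (s := cf_word X).
assert (Hs : even_period u s) by now apply even_period_cf_word.
assert (Spec := epsilon_spec (inhabits []) (fun s => even_period u s /\
  forall t, even_period u t -> (length s <= length t)%nat) (least_length _ _ Hs)).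
fold (minimal_even_period u) in Spec. set (t := minimal_even_period u) in *.
destruct Spec as [[Nt [[t' Et] Ct]] Min]. specialize (Min s Hs).
destruct Hs as [Ns [_ Cs]].
assert (E : forall n, periodic t n = periodic s n) by (now apply is_cf_unique with u).
assert (Lt : length t <> O) by (now destruct t).
assert (Ls : length s = (2 * length X)%nat) by apply cf_word_length.
(* Both periods generate the quotients of [u], and the minimal one is not longer. *)
assert (Pre : t = firstn (length t) s).
{ rewrite <- (periodic_block s O Ns). rewrite <- (periodic_block t O Nt) at 1. simpl Nat.mul.
  rewrite firstn_map, <- (map_ext _ _ E). f_equal.
  replace (length s) with (length t + (length s - length t))%nat by lia.
  rewrite seq_app, firstn_app, length_seq, Nat.sub_diag, firstn_O, app_nil_r.
  rewrite firstn_all2; [reflexivity|]. rewrite length_seq. lia. }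
assert (Ct2 : count2 t = (2 * count_occ Bool.bool_dec (firstn t' X) true)%nat).
{ rewrite Pre, Et. unfold s. now rewrite firstn_cf_word, cf_word_count. }
assert (Cs2 : count2 s = (2 * count_occ Bool.bool_dec X true)%nat) by apply cf_word_count.
(* Both sides count the quotient 2 among the first [length s * length t] terms of the common
   sequence. *)
assert (Fr : (length t * count2 s = length s * count2 t)%nat).
{ rewrite <- (periodic_count s) by exact Ns. rewrite <- (periodic_count t) by exact Nt.
  rewrite (Nat.mul_comm (length s) (length t)). f_equal. symmetry. now apply map_ext. }
rewrite Et, Ls, Ct2, Cs2 in Fr.
(* The number of blocks [true] in [X] is prime to the length of [X], because the denominator is the
   sum of the two; the proportion then forces the length to divide [t']. *)
assert (Dv : (Z.of_nat (length X) | Z.of_nat t')%Z).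
{ apply Gauss with (word_num X).
  - exists (Z.of_nat (count_occ Bool.bool_dec (firstn t' X) true)). unfold word_num.
    rewrite <- !Nat2Z.inj_mul. f_equal. nia.
  - apply rel_prime_sym. apply rel_prime_bezout in HC. destruct HC as [a b Hab].
    apply bezout_rel_prime. unfold word_den in Hab.
    apply Bezout_intro with (a + b)%Z b. lia. }
assert (LX : (0 < length X)%nat) by (destruct X; simpl; [easy|lia]).
destruct Dv as [k Hk].
assert (t' = length X).
{ assert (0 < t')%nat by lia. assert (t' <= length X)%nat by (rewrite Et, Ls in Min; lia).
  assert (k = 1)%Z by nia. lia. }
rewrite Pre. rewrite Et, H, <- Ls. apply firstn_all.
Qed.

(** The nodes are reduced fractions, so their continued fraction words are minimal even periods and
    [odot] concatenates exactly these words. *)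
Lemma farey_w_level n X : In X (farey_level n) -> farey_w (node_x X) = periodic_cf (cf_word X).
Proof.
destruct farey_w_spec as [W0 [W1 WM]].
revert X. induction n as [|n IH]; intros X HX.
- destruct HX as [<-|[<-|[]]]; unfold node_x; simpl.
  + rewrite <- W0. f_equal. unfold word_num, word_den; simpl. field.
  + rewrite <- W1. f_equal.
- change (farey_level (S n)) with (insert_mediants (farey_level n)) in HX.
  apply insert_mediants_in in HX. destruct HX as [HX|[l1 [U [V [l2 [E ->]]]]]]; [now apply IH|].
  assert (A := farey_level_adjacent n). rewrite E in A. apply consecutive2_app in A.
  assert (HU : In U (farey_level n)) by (rewrite E; apply in_or_app; right; now left).
  assert (HV : In V (farey_level n)) by (rewrite E; apply in_or_app; right; right; now left).
  assert (NU := farey_level_nonempty n U HU). assert (NV := farey_level_nonempty n V HV).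
  assert (FN : farey_neighbors (word_num U) (word_den U) (word_num V) (word_den V)).
  { pose proof (word_num_bounds U). pose proof (word_num_bounds V).
    pose proof (word_den_pos U NU). pose proof (word_den_pos V NV).
    destruct A as [_ D]. unfold farey_neighbors. lia. }
  unfold node_x at 1. rewrite word_num_app, word_den_app.
  rewrite (Z.add_comm (word_num V)), (Z.add_comm (word_den V)), (WM _ _ _ _ FN).
  fold (node_x U) (node_x V). rewrite (IH U HU), (IH V HV). unfold odot.
  rewrite !minimal_even_period_cf_word, <- cf_word_app; auto.
  + now apply (farey_level_coprime n).
  + now apply (farey_level_coprime n).
Qed.

(** * Cutting words and the limit *)

Definition run (a : nat -> nat) (k : nat) : list bool := repeat (negb (Nat.even k)) (a k).

Lemma cutting_word_runs a n :
  cutting_word a n = map letter_mat (firstn n (concat (map (run a) (seq 0 (S n))))).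
Proof.
unfold cutting_word. rewrite <- firstn_map, concat_map, map_map. do 2 f_equal.
apply map_ext. intros k. unfold run. rewrite map_repeat. now destruct (Nat.even k).
Qed.

Lemma runs_length a s m : (forall k, (0 < a k)%nat) -> (m <= length (concat (map (run a) (seq s m))))%nat.
Proof.
intros H. revert s. induction m as [|m IH]; intros s; simpl; [lia|].
rewrite length_app. unfold run at 1. rewrite repeat_length. specialize (IH (S s)). specialize (H s). lia.
Qed.

Lemma firstn_runs a n m : (forall k, (0 < a k)%nat) -> (n <= m)%nat ->
  firstn n (concat (map (run a) (seq 0 m))) = firstn n (concat (map (run a) (seq 0 n))).
Proof.
intros H L. replace m with (n + (m - n))%nat by lia.
rewrite seq_app, map_app, concat_app, firstn_app.
replace (n - length (concat (map (run a) (seq 0 n))))%nat with O; [now rewrite firstn_O, app_nil_r|].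
pose proof (runs_length a 0 n H). lia.
Qed.

Lemma concat_runs_periodic X m : X <> [] ->
  concat (map (run (periodic (cf_word X))) (seq 0 (2 * (m * length X)))) = expand (word_pow X m).
Proof.
intros HX. assert (L : length X <> O) by (now destruct X).
assert (G : forall j n, concat (map (run (periodic (cf_word X))) (seq (2 * j) (2 * n))) =
  expand (map (fun i => nth (i mod length X) X false) (seq j n))).
{ intros j n. revert j. induction n as [|n IH]; intros j; [reflexivity|].
  replace (2 * S n)%nat with (S (S (2 * n))) by lia.
  change (seq (2 * j) (S (S (2 * n)))) with ((2 * j)%nat :: S (2 * j) :: seq (S (S (2 * j))) (2 * n)).
  replace (S (S (2 * j))) with (2 * S j)%nat by lia.
  cbn [map concat seq]. rewrite IH. destruct (periodic_cf_word X j HX) as [E1 E2].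
  unfold run at 1 2. rewrite Nat.add_1_r in E2. rewrite E1, E2.
  replace (Nat.even (2 * j)) with true by (symmetry; apply Nat.even_spec; now exists j).
  replace (Nat.even (S (2 * j))) with false
    by (symmetry; rewrite Nat.even_succ, <- Nat.negb_even; replace (Nat.even (2 * j)) with true; [reflexivity|symmetry; apply Nat.even_spec; now exists j]).
  unfold expand at 2. cbn [flat_map].
  destruct (nth (j mod length X) X false); reflexivity. }
specialize (G O (m * length X)%nat). rewrite Nat.mul_0_r in G. rewrite G. f_equal. clear G.
assert (P : forall j, map (fun i => nth (i mod length X) X false) (seq (j * length X) (length X)) = X).
{ intros j. apply (nth_ext _ _ false false); [now rewrite length_map, length_seq|].
  intros i Hi. rewrite length_map, length_seq in Hi.
  rewrite (nth_indep _ _ (nth (0 mod length X) X false)) by (now rewrite length_map, length_seq).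
  rewrite (map_nth (fun i => nth (i mod length X) X false)), seq_nth by exact Hi.
  rewrite Nat.add_comm, Nat.Div0.mod_add, Nat.mod_small by exact Hi. reflexivity. }
induction m as [|m IH]; [reflexivity|].
replace (S m * length X)%nat with (m * length X + length X)%nat by lia.
rewrite seq_app, map_app, IH. simpl Nat.add. rewrite P. symmetry. apply word_pow_snoc.
Qed.

Lemma cutting_matrix_periodic X n : X <> [] ->
  cutting_matrix (partial_quotients (periodic_cf (cf_word X))) n =
  word_mat (firstn n (expand (word_pow X (S n)))).
Proof.
intros HX. unfold cutting_matrix, word_mat. f_equal.
rewrite cutting_word_runs. f_equal.
rewrite <- concat_runs_periodic by exact HX.
rewrite (map_ext (run (partial_quotients _)) (run (periodic (cf_word X))))
  by (intros k; unfold run; now rewrite partial_quotients_periodic).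
assert (P : forall k, (0 < periodic (cf_word X) k)%nat) by now apply paired_pos, paired_periodic.
assert (L : (0 < length X)%nat) by (destruct X; simpl; [easy|lia]).
rewrite (firstn_runs _ n (S n)), (firstn_runs _ n (2 * (S n * length X))) by (auto; nia). reflexivity.
Qed.

Lemma firstn_expand_pow X n : X <> [] -> exists m r,
  n = (m * length (expand X) + r)%nat /\ (r < length (expand X))%nat /\
  firstn n (expand (word_pow X (S n))) = expand (word_pow X m) ++ firstn r (expand X).
Proof.
intros HX. assert (L : length (expand X) <> O).
{ destruct X as [|b X]; [easy|]. simpl. destruct b; simpl; lia. }
exists (n / length (expand X))%nat, (n mod length (expand X))%nat.
assert (E := Nat.div_mod n (length (expand X)) L). assert (B := Nat.mod_upper_bound n (length (expand X)) L).
set (m := (n / length (expand X))%nat) in *. set (r := (n mod length (expand X))%nat) in *.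
split; [lia|split; [exact B|]].
assert (LP : forall k, length (expand (word_pow X k)) = (k * length (expand X))%nat).
{ induction k as [|k IH]; [reflexivity|]. simpl word_pow. rewrite expand_app, length_app, IH. reflexivity. }
assert (Hm : (m < S n)%nat) by nia.
replace (S n) with (m + S (n - m))%nat by lia.
rewrite word_pow_add. simpl word_pow. rewrite !expand_app.
rewrite firstn_app, LP. rewrite firstn_all2 by (rewrite LP; lia). f_equal.
replace (n - m * length (expand X))%nat with r by lia.
rewrite firstn_app. replace (r - length (expand X))%nat with O by lia. now rewrite firstn_O, app_nil_r.
Qed.

Lemma letter_act_swap L z : 0 < z -> letter_act (negb L) (/ z) = / letter_act L z.
Proof. intros H. destruct L; simpl; field; lra. Qed.

Lemma word_act_swap W z : 0 < z -> word_act (map negb W) (/ z) = / word_act W z.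
Proof.
intros H. induction W as [|L W IH]; [reflexivity|]. simpl. rewrite IH. now apply letter_act_swap, word_act_pos.
Qed.

(** Reading TV or TTVV backwards amounts to exchanging the two letters, which is also the effect of
    inversion on the action. *)
Lemma rev_expand X : rev (expand X) = map negb (expand (rev X)).
Proof.
induction X as [|b X IH]; [reflexivity|].
change (b :: X) with ([b] ++ X). rewrite expand_app, !rev_app_distr, IH, expand_app, map_app. f_equal.
now destruct b.
Qed.

Section Limit.
Variable F : R -> R.
Variables M B eta : R.
Hypothesis TK : twist_kernel F M B eta.

Lemma word_sum_swap W z : 0 < z -> word_sum F (map negb W) (/ z) = word_sum F W z.
Proof.
intros H. induction W as [|L W IH]; [reflexivity|]. simpl. rewrite IH. f_equal.
rewrite word_act_swap, letter_act_swap by (auto using word_act_pos).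
apply (tk_inv _ _ _ _ TK). now apply letter_act_pos, word_act_pos.
Qed.

Lemma word_sum_bound W z : 0 < z -> 0 <= word_sum F W z <= INR (length W) * B.
Proof.
intros H. induction W as [|L W IH]; [simpl; lra|]. simpl length. rewrite S_INR. simpl word_sum.
assert (P := letter_act_pos L _ (word_act_pos W z H)).
pose proof (tk_pos _ _ _ _ TK _ P). pose proof (tk_bound _ _ _ _ TK _ P). lra.
Qed.

(** The period nearest to an arbitrary starting point [z] is bounded crudely. After it the point
    lies in [[1, 5/2]], and the Lipschitz constant [6 B] times the length 3/2 gives [9 B]. *)
Lemma blocks_sum_pow_bound X m z : X <> [] -> 0 < z ->
  Rabs (blocks_sum F (word_pow X m) z - INR m * half_value F X) <= 9 * B + 2 * (INR (length (expand X)) * B).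
Proof.
intros HX Hz. destruct (tk_constants _ _ _ _ TK) as [_ [HB _]].
assert (Nn : 0 <= INR (length (expand X)) * B) by (apply Rmult_le_pos; [apply pos_INR|lra]).
destruct m as [|m].
- unfold blocks_sum; simpl. replace (0 - 0 * half_value F X) with 0 by ring. rewrite Rabs_R0. lra.
- assert (Rf := fixed_point_range X HX). assert (Fx := proj2 (fixed_point_spec X HX)).
  rewrite <- blocks_sum_pow_fixed by exact HX.
  rewrite word_pow_snoc, !blocks_sum_app, Fx.
  assert (Rz := blocks_act_nonempty X z HX Hz).
  pose proof (word_sum_bound (expand X) z Hz) as B1.
  pose proof (word_sum_bound (expand X) (fixed_point X) ltac:(lra)) as B2.
  fold (blocks_sum F X z) in B1. fold (blocks_sum F X (fixed_point X)) in B2.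
  set (u := blocks_act X z) in *. set (v := fixed_point X) in *.
  destruct (Rle_dec u v) as [D|D].
  + pose proof (blocks_sum_lipschitz F M B eta TK (word_pow X m) u v ltac:(lra) D).
    assert (6 * B * (v - u) <= 6 * B * (3 / 2)) by (apply Rmult_le_compat_l; lra). apply Rabs_le. lra.
  + pose proof (blocks_sum_lipschitz F M B eta TK (word_pow X m) v u ltac:(lra) ltac:(lra)).
    assert (6 * B * (u - v) <= 6 * B * (3 / 2)) by (apply Rmult_le_compat_l; lra). apply Rabs_le. lra.
Qed.

Lemma expand_length_rev X : length (expand (rev X)) = length (expand X).
Proof. rewrite <- (length_rev (expand X)), rev_expand, length_map. reflexivity. Qed.

(** Two bounds for full periods, one for futures and one for pasts, and two crude bounds for the
    incomplete period [rho]. The fixed points of the truncated word differ from those of [X], so [x]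
    and [y] are left arbitrary. *)
Lemma word_sums_bound X m rho x y : X <> [] -> 0 < x -> 0 < y -> (length rho <= length (expand X))%nat ->
  let W := expand (word_pow X m) ++ rho in
  Rabs (word_sum F W x + word_sum F (rev W) y - INR m * value F X) <=
  18 * B + 6 * (INR (length (expand X)) * B).
Proof.
intros HX Hx Hy Hr. cbn zeta. destruct (tk_constants _ _ _ _ TK) as [_ [HB _]].
rewrite rev_app_distr, !word_sum_app.
assert (Hx' := word_act_pos rho x Hx).
pose proof (blocks_sum_pow_bound X m _ HX Hx') as P1.
assert (Hy' : 0 < / y) by now apply Rinv_0_lt_compat.
pose proof (blocks_sum_pow_bound (rev X) m _ (rev_nonempty X HX) Hy') as P2.
rewrite expand_length_rev in P2.
assert (E : word_sum F (rev (expand (word_pow X m))) y = blocks_sum F (word_pow (rev X) m) (/ y)).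
{ rewrite rev_expand, word_pow_rev. rewrite <- (Rinv_inv y) at 1.
  rewrite word_sum_swap by exact Hy'. reflexivity. }
rewrite E. fold (blocks_sum F (word_pow X m) (word_act rho x)).
pose proof (word_sum_bound rho x Hx) as B1.
pose proof (word_sum_bound (rev rho) (word_act (rev (expand (word_pow X m))) y) (word_act_pos _ y Hy)) as B2.
rewrite length_rev in B2. apply le_INR in Hr.
assert (INR (length rho) * B <= INR (length (expand X)) * B) by (apply Rmult_le_compat_r; lra).
apply Rabs_le_between in P1, P2. unfold value. apply Rabs_le. lra.
Qed.
End Limit.

(** The blocks TV and TTVV have twice as many letters as their denominators 1 and 2. *)
Lemma expand_length X : INR (length (expand X)) = 2 * IZR (word_den X).
Proof.
rewrite INR_IZR_INZ, <- mult_IZR. f_equal. unfold word_den, word_num.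
induction X as [|b X IH]; [reflexivity|].
change (b :: X) with ([b] ++ X). rewrite expand_app, !length_app, count_occ_app.
replace (length (expand [b])) with (if b then 4%nat else 2%nat) by (now destruct b).
replace (length [b]) with 1%nat by reflexivity.
replace (count_occ Bool.bool_dec [b] true) with (if b then 1%nat else 0%nat) by (now destruct b).
destruct b; lia.
Qed.

Lemma is_lim_seq_bounded_over_n (u : nat -> R) l C N :
  (forall n, (N <= n)%nat -> Rabs (u n - INR n * l) <= C) -> is_lim_seq (fun n => u n / INR n) l.
Proof.
intros H. apply is_lim_seq_spec. intros eps.
set (K := Rmax C 0 + 1). assert (HK : 0 < K) by (pose proof (Rmax_r C 0); unfold K; lra).
destruct (archimed (K / eps)) as [A _].
assert (Hp : 0 < K / eps) by (apply Rdiv_lt_0_compat; [lra|apply cond_pos]).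
exists (Nat.max N (Z.to_nat (up (K / eps)))). intros n Hn.
assert (Hn1 : K / eps < INR n).
{ apply Rlt_le_trans with (IZR (up (K / eps))); [exact A|]. rewrite INR_IZR_INZ. apply IZR_le. lia. }
specialize (H n ltac:(lia)).
replace (u n / INR n - l) with ((u n - INR n * l) / INR n) by (field; lra).
unfold Rdiv. rewrite Rabs_mult, (Rabs_pos_eq (/ INR n)) by (left; apply Rinv_0_lt_compat; lra).
apply Rmult_lt_reg_r with (INR n); [lra|]. rewrite Rmult_assoc, Rinv_l, Rmult_1_r by lra.
apply Rle_lt_trans with C; [exact H|]. apply Rlt_trans with K; [pose proof (Rmax_l C 0); unfold K; lra|].
apply (Rmult_lt_compat_r eps) in Hn1; [|apply cond_pos].
pose proof (cond_pos eps). replace (K / eps * eps) with K in Hn1 by (field; lra). lra.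
Qed.

(** A prefix consists of [m] periods and less than one more. Its cycle integral differs from [m]
    times the value of the period by a bounded amount, so the upper limit is a limit. *)
Lemma Lambda_periodic f tau0 X M B eta : holomorphic_on_H f ->
  (forall A tau, mdet A = 1%Z -> upper_half_plane tau -> f (moebius A tau) = f tau) ->
  (forall t, PI / 3 <= t <= 2 * PI / 3 -> Im (f (circle t)) = 0) ->
  twist_kernel (arc_kernel f) M B eta ->
  upper_half_plane tau0 -> X <> [] ->
  Lambda f tau0 (periodic_cf (cf_word X)) = Finite (node_y (arc_kernel f) X).
Proof.
intros Hf Hinv Hreal TK Ht HX. unfold Lambda. apply is_LimSup_seq_unique, is_lim_LimSup_seq.
set (F := arc_kernel f) in *. destruct (tk_constants _ _ _ _ TK) as [_ [HB _]].
assert (HD : 0 < IZR (word_den X)) by (apply IZR_lt, word_den_pos; exact HX).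
set (l := length (expand X)).
(* From [n = l] on the prefix contains a full period and is hyperbolic; shorter prefixes are
   ignored. *)
apply (is_lim_seq_bounded_over_n _ _ (18 * B + 6 * (INR l * B) + Rabs (value F X)) l).
intros n Hn. rewrite cutting_matrix_periodic by exact HX.
destruct (firstn_expand_pow X n HX) as [m [r [En [Hr EW]]]]. rewrite EW. fold l in En, Hr.
set (W := expand (word_pow X m) ++ firstn r (expand X)).
assert (Hm : m <> O) by (intros ->; lia).
assert (HW : hyperbolic (word_mat W)).
{ unfold W. destruct m as [|m]; [easy|]. destruct X as [|b X]; [easy|].
  change (word_pow (b :: X) (S m)) with ([b] ++ (X ++ word_pow (b :: X) m)).
  rewrite expand_app, <- app_assoc. replace (expand [b]) with (block_word b) by (simpl; now rewrite app_nil_r).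
  apply block_word_hyperbolic. }
destruct (word_fixed_points W HW) as [x [Hx Ex]]. destruct (hyperbolic_rev W HW) as [y [Hy Ey]].
rewrite (Re_cycle_integral f W tau0 x y) by assumption. fold F.
assert (Bd := word_sums_bound F M B eta TK X m (firstn r (expand X)) x y HX Hx Hy).
cbn zeta in Bd. fold W l in Bd.
specialize (Bd ltac:(rewrite length_firstn; unfold l; lia)).
assert (EV : INR n * node_y F X - INR m * value F X = INR r / INR l * value F X).
{ assert (El : INR l = 2 * IZR (word_den X)) by apply expand_length.
  rewrite En, plus_INR, mult_INR, El. unfold node_y. field. lra. }
assert (Hrl : Rabs (INR r / INR l * value F X) <= Rabs (value F X)).
{ rewrite Rabs_mult. apply lt_INR in Hr. pose proof (pos_INR r).
  assert (0 <= INR r / INR l <= 1).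
  { split; [apply Rmult_le_pos; [lra|left; apply Rinv_0_lt_compat; lra]|].
    apply Rmult_le_reg_r with (INR l); [lra|]. replace (INR r / INR l * INR l) with (INR r) by (field; lra). lra. }
  rewrite (Rabs_pos_eq (INR r / INR l)) by lra. pose proof (Rabs_pos (value F X)).
  assert (INR r / INR l * Rabs (value F X) <= 1 * Rabs (value F X)) by (apply Rmult_le_compat_r; lra). lra. }
replace (word_sum F W x + word_sum F (rev W) y - INR n * node_y F X) with
  ((word_sum F W x + word_sum F (rev W) y - INR m * value F X) + - (INR r / INR l * value F X)) by lra.
eapply Rle_trans; [apply Rabs_triang|]. rewrite Rabs_Ropp. lra.
Qed.

(** * Positivity of the total weight and assembly of the extension *)

Lemma total_weight_modular (f : C -> C) : weakly_holomorphic_modular_function f ->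
  (exists tau : C, upper_half_plane tau /\ f tau <> RtoC 0) ->
  (forall t : R, PI / 3 <= t <= 2 * PI / 3 ->
     Im (f (circle t)) = 0 /\ 0 <= Re (f (circle t))) ->
  0 < total_weight f.
Proof.
intros hf [tau [Htau Hne]] harc. apply total_weight_pos; [exact (proj1 hf)|apply harc|].
apply NNPP. intros N. apply Hne. apply arc_vanishing; [exact hf| |exact Htau].
intros t Ht. destruct (harc t Ht) as [H1 H2].
destruct (Req_dec (Re (f (circle t))) 0) as [E|E].
- apply injective_projections; [exact E|exact H1].
- exfalso. apply N. exists t. split; [exact Ht|lra].
Qed.

Theorem theorem1p9 (f : C -> C)
  (hf : weakly_holomorphic_modular_function f)
  (hf0 : exists tau : C, upper_half_plane tau /\ f tau <> RtoC 0)
  (harc : forall t : R, PI / 3 <= t <= 2 * PI / 3 ->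
     Im (f (cos t, sin t)) = 0 /\ 0 <= Re (f (cos t, sin t))) :
  exists g : R -> R,
    (forall (tau0 : C) (p q : Z), upper_half_plane tau0 ->
       (0 <= p)%Z -> (0 < q)%Z -> (2 * p <= q)%Z ->
       Lambda f tau0 (farey_w (IZR p / IZR q)) = Finite (g (IZR p / IZR q))) /\
    (forall x : R, 0 <= x <= 1 / 2 -> 0 < g x) /\
    continuous_on (fun x : R => 0 <= x <= 1 / 2) g /\
    (forall x y : R, 0 <= x <= 1 / 2 -> 0 <= y <= 1 / 2 -> x < y -> g y < g x) /\
    (forall x y t : R, 0 <= x <= 1 / 2 -> 0 <= y <= 1 / 2 -> 0 <= t <= 1 ->
       g (t * x + (1 - t) * y) <= t * g x + (1 - t) * g y).
Proof.
change (forall t, PI / 3 <= t <= 2 * PI / 3 ->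
  Im (f (circle t)) = 0 /\ 0 <= Re (f (circle t))) in harc.
assert (Wpos := total_weight_modular f hf hf0 harc).
destruct hf as [Hf [Hinv _]].
assert (TK := arc_kernel_twist f Hf (fun t Ht => proj2 (harc t Ht)) Wpos).
set (F := arc_kernel f) in *. set (M := / 5 * total_weight f) in *.
set (B := 5 * total_weight f) in *. set (eta := / 100 * total_weight f) in *.
destruct (tk_constants _ _ _ _ TK) as [_ [HB He]].
(* Levels from 1 on, where the slope bounds hold. The levels increase, so the two or three nodes in
   a hypothesis on [D] lie in a common one. *)
set (D := fun x y => exists n X, In X (farey_level (S n)) /\ x = node_x X /\ y = node_y F X).
assert (Top : forall n m X, In X (farey_level (S n)) -> (n <= m)%nat -> In X (farey_level (S m))).
{ intros n m X HX L. apply (farey_level_incl (S n)); [lia|exact HX]. }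
assert (Hone : In [true] (farey_level 1)) by (right; right; now left).
destruct (convex_extension D (10 * B) (2 * eta) (node_y F [true])) as [g [Hg Hrest]].
- intros x y [n [X [HX [-> _]]]]. apply node_x_range. now apply (farey_level_nonempty (S n)).
- intros x y x' y' [n [X [HX [-> ->]]]] [n' [X' [HX' [-> ->]]]] Hx.
  apply (level_lipschitz F M B eta TK (Nat.max n n')); [apply (Top n)|apply (Top n')|exact Hx]; (assumption || lia).
- intros x1 y1 x2 y2 x3 y3 [n1 [X1 [H1 [-> ->]]]] [n2 [X2 [H2 [-> ->]]]] [n3 [X3 [H3 [-> ->]]]] Hx.
  apply (level_convex F M B eta TK (Nat.max n1 (Nat.max n2 n3)));
    [apply (Top n1)|apply (Top n2)|apply (Top n3)|exact Hx]; (assumption || lia).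
- intros x eps Hx Heps.
  (* With [q] above [/ eps] and [p] the integer part of [x * q], the fraction [p / q] approximates
     [x] from below within [eps] and stays in the interval. *)
  destruct (archimed (/ eps)) as [A _]. set (q := up (/ eps)) in *.
  assert (He' : 0 < / eps) by now apply Rinv_0_lt_compat.
  assert (Hq : (0 < q)%Z) by (apply lt_IZR; lra).
  set (p := Int_part (x * IZR q)).
  destruct (base_Int_part (x * IZR q)) as [P1 P2]. fold p in P1, P2.
  assert (HqR := IZR_lt _ _ Hq).
  assert (Xq : 0 <= x * IZR q) by (apply Rmult_le_pos; lra).
  assert (Hp : (0 <= p)%Z) by (apply Z.lt_succ_r, lt_IZR; rewrite succ_IZR; lra).
  assert (Hpq : (2 * p <= q)%Z).
  { apply le_IZR. rewrite mult_IZR. assert (x * IZR q <= 1 / 2 * IZR q) by (apply Rmult_le_compat_r; lra). lra. }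
  destruct (reduced_fraction p q Hp Hq Hpq) as [p' [q' [Hp' [Hq' [Hpq' [Hc E]]]]]].
  destruct (farey_level_contains p' q' Hp' Hq' Hpq' Hc) as [n [X [HX [<- <-]]]].
  exists (node_x X), (node_y F X). split; [now exists n, X|].
  unfold node_x. rewrite <- E. rewrite Rabs_minus_sym.
  replace (x - IZR p / IZR q) with ((x * IZR q - IZR p) / IZR q) by (field; lra).
  assert (I : / IZR q < eps).
  { rewrite <- (Rinv_inv eps). apply Rinv_lt_contravar; [apply Rmult_lt_0_compat; lra|lra]. }
  assert (I0 : 0 < / IZR q) by now apply Rinv_0_lt_compat.
  unfold Rdiv. rewrite Rabs_mult, !Rabs_pos_eq by lra.
  apply Rle_lt_trans with (1 * / IZR q); [apply Rmult_le_compat_r; lra|lra].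
- exists O, [true]. split; [exact Hone|split; [|reflexivity]].
  unfold node_x. simpl. reflexivity.
- unfold node_y, value. simpl rev. rewrite half_value_one.
  assert (P := proj1 (fixed_point_spec [true] ltac:(easy))).
  pose proof (block_sum_pos F M B eta TK true _ P).
  apply Rdiv_lt_0_compat; [lra|]. replace (IZR (word_den [true])) with 2 by reflexivity. lra.
- lra.
- lra.
- exists g. split; [|exact Hrest].
  intros tau0 p q Ht Hp Hq Hpq.
  destruct (reduced_fraction p q Hp Hq Hpq) as [p' [q' [Hp' [Hq' [Hpq' [Hc E]]]]]].
  destruct (farey_level_contains p' q' Hp' Hq' Hpq' Hc) as [n [X [HX [<- <-]]]].
  rewrite E. fold (node_x X). rewrite (farey_w_level (S n) X HX).
  rewrite (Lambda_periodic f tau0 X M B eta); auto.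
  + f_equal. symmetry. apply Hg. now exists n, X.
  + intros t Htt. now apply harc.
  + now apply (farey_level_nonempty (S n)).
Qed.
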